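(* Let $\theta\in(0,1)$ and let $c=c(\theta)>0$ be a known function of $\theta\in(0,1)$ for which the derivative $\frac{dc}{d\theta}$ exists. Suppose the urn probabilities satisfy $$p_i=c\, i^{-1/\theta}\bigl(1+o(i^{-1/2})\bigr)\quad\text{as } i\to\infty .$$ Let $k\ge1$ be an integer and let $\theta^*_{n,R},\theta^*_{n,U},\theta^*_{n,k}\in(0,1)$ be solutions, in the unknown $\theta$ (with $c=c(\theta)$), of the equations $$R_n=\Gamma(1-\theta)(cn)^{\theta},\qquad U_n=2^{\theta-1}\Gamma(1-\theta)(cn)^{\theta},\qquad R_{n,k}=\theta\,\frac{\Gamma(k-\theta)}{k!}(cn)^{\theta},$$ respectively. Then, as $n\to\infty$, $$\ln n\,\sqrt{R_n}\,(\theta^*_{n,R}-\theta)\Rightarrow \mathbf{N}_{0,\,2^{\theta}-1},\qquad \ln n\,\sqrt{U_n}\,(\theta^*_{n,U}-\theta)\Rightarrow \mathbf{N}_{0,\,2^{\theta-1}},$$ $$\ln n\,\sqrt{R_{n,k}}\,(\theta^*_{n,k}-\theta)\Rightarrow \mathbf{N}_{0,\sigma^2},\qquad \sigma^2=1-\frac{2^{\theta}\,\Gamma(2k-\theta)}{2^{2k}\,k!\,\Gamma(k-\theta)} .$$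
   Context: Infinite urn scheme: there are infinitely many urns $i=1,2,\ldots$ with probabilities $p_1\ge p_2\ge\cdots>0$, $\sum_i p_i=1$. Each of $n$ balls is independently placed in urn $i$ with probability $p_i$. $J_i(n)$ is the number of balls in urn $i$ after $n$ balls. $R_n=\sum_{i\ge1}\mathbf{I}\{J_i(n)>0\}$ is the number of nonempty urns; $R_{n,k}=\sum_{i\ge1}\mathbf{I}\{J_i(n)=k\}$ is the number of urns with exactly $k$ balls; $U_n=\sum_{i\ge1}\mathbf{I}\{J_i(n)\equiv1\ (\mathrm{mod}\ 2)\}$ is the number of urns with an odd number of balls. $\Gamma$ is the Gamma function. $\Rightarrow\mathbf{N}_{0,\sigma^2}$ denotes weak convergence to the normal law with mean $0$ and variance $\sigma^2$.
   Formalization: Added for each estimator: for some 0<a, b<1 the probability that a≤θ*_n≤b tends to 1; otherwise, for c vanishing fast near 1, extra solutions near 1 make the claim false. Estimators are random variables solving their equation whenever a solution in (0,1) exists. *)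

(* Defs.v *)
(* MathComp / MathComp-Analysis *)
From HB Require Import structures.
From mathcomp Require Import all_boot all_order all_algebra.
From mathcomp Require Import all_classical all_reals all_analysis.

Set Implicit Arguments.
Unset Strict Implicit.
Unset Printing Implicit Defensive.

Import Order.TTheory GRing.Theory Num.Theory.
Import numFieldNormedType.Exports.

Local Open Scope classical_set_scope.
Local Open Scope ring_scope.

Section Gamma.
Variable R : realType.

Definition Gamma (x : R) : R :=
  \int[@lebesgue_measure R]_(t in `]0, +oo[) (t `^ (x - 1) * expR (- t)).

End Gamma.

Section Probability.
Context (d : measure_display) (T : measurableType d) (R : realType)
  (P : probability T R).

Definition mutually_independent (I : choiceType) (d' : measure_display)
    (T' : measurableType d') (X : I -> T -> T') : Prop :=
  forall (s : seq I) (A : I -> set T'), uniq s ->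
    (forall j, measurable (A j)) ->
    P (\bigcap_(j in [set` s]) (X j @^-1` A j)) =
    (\prod_(j <- s) P (X j @^-1` A j))%E.

Definition weak_cvg (Y : nat -> T -> R)
    (mu : probability (measurableTypeR R) R) : Prop :=
  forall f : R -> R, continuous f -> (exists M, forall x, `|f x| <= M) ->
    ('E_P[f \o Y n] @[n --> \oo] --> \int[mu]_x (f x)%:E)%E.

(* The normal law N_(0, v) is parameterized by its variance, whereas
   [normal_prob] takes the standard deviation. *)
Definition weak_cvg_normal (Y : nat -> T -> R) (v : R) : Prop :=
  weak_cvg Y (normal_prob 0 (Num.sqrt v)).

End Probability.

(* Urns are indexed from 0: index [i] stands for the urn number [i.+1].
   [X j w] is the urn receiving ball [j], and the first [n] balls are those
   with [j < n]. *)
Section Urns.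
Context (T : Type) (R : realType) (X : nat -> T -> nat).

Definition balls (i n : nat) (w : T) : nat := (\sum_(j < n) (X j w == i))%N.

(* Only finitely many terms of these sums over all urns are nonzero, so that
   the finitely supported sum is the sum of the series; for [nb_exact] this
   uses [0 < k]. *)
Definition nb_nonempty (n : nat) (w : T) : R :=
  \sum_(i \in [set: nat]) ((0 < balls i n w)%N%:R : R).

Definition nb_exact (k n : nat) (w : T) : R :=
  \sum_(i \in [set: nat]) ((balls i n w == k)%:R : R).

Definition nb_odd (n : nat) (w : T) : R :=
  \sum_(i \in [set: nat]) ((balls i n w == 1 %[mod 2])%:R : R).

End Urns.

(* [th n w] is a solution [t] in (0, 1) of [S n w = F n t] as soon as there is
   one, and is arbitrary otherwise. For instance, with [0 < n], the right-hand
   sides considered below are positive, whereas the number of urns with an odd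
   number of balls, or with exactly [k] balls, can be zero. *)
Definition solution_estimator (T : Type) (R : realType)
    (S : nat -> T -> R) (F : nat -> R -> R) (th : nat -> T -> R) : Prop :=
  forall n w, (exists t, 0 < t < 1 /\ S n w = F n t) ->
    0 < th n w < 1 /\ S n w = F n (th n w).

(* For an arbitrary function [c], the equations may have additional solutions
   tending to 0 or 1 as [n] grows, for which asymptotic normality fails.
   The following excludes those and does not require that [th] be close to the
   true parameter. *)
Definition inside_unit_interval (d : measure_display) (T : measurableType d)
    (R : realType) (P : probability T R) (th : nat -> T -> R) : Prop :=
  exists a b : R, [/\ 0 < a, b < 1 &
    P [set w | a <= th n w <= b] @[n --> \oo] --> 1%E].

(* Main.v *)
(* Fix n and merge all urns with index at least K = K(n), where K is so large
   that with high probability none of them receives a ball. The statistic is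
   then a sum over finitely many urns. When the number of balls is Poisson with
   mean n, the occupancy numbers are independent, so the statistic is a sum of
   independent Bernoulli variables with means rho(n p_i), where rho is explicit.
   Its central limit theorem follows from Lindeberg's replacement argument,
   carried out with the heat kernel as test function. A second moment bound on
   the Poisson number of balls removes the randomization, since adding r balls
   to at least n/2 balls moves the statistic, in mean, by a quantity of order
   o(n^(theta/2)) (1 + r^2/n).
   Writing rho as an integral of Poisson weights and counting the urns with
   c i^(-1/theta) > t turns the sums over the urns into Gamma integrals, which
   gives the centering F_n(theta) up to o(n^(theta/2)), and the variance.
   Finally, ln F_n(t) = phi(t) + t ln n with phi locally Lipschitz, so that the
   equation S_n = F_n(t) has a solution with high probability, and a solution
   that stays away from 0 and 1 satisfies
   ln n sqrt(S_n) (t - theta) = (S_n - F_n(theta)) / sqrt(F_n(theta)) + o(1). *)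
Require Import Defs.
From HB Require Import structures.
From mathcomp Require Import all_boot all_order all_algebra.
From mathcomp Require Import all_classical all_reals all_analysis.
From mathcomp Require Import measurable_realfun zify ring lra.
Import Order.TTheory GRing.Theory Num.Theory.
Import numFieldNormedType.Exports.
Local Open Scope classical_set_scope.
Local Open Scope ring_scope.
Set Implicit Arguments.
Unset Strict Implicit.
Unset Printing Implicit Defensive.

(** * The heat kernel *)

(** Every error is measured against n^(theta/2), the order of the standard deviation. This explains
    the condition o(i^(-1/2)): the sum of i^(-1/2) min(1, n p_i) is of order n^(theta/2), so passing
    from p_i to the exact power law is just negligible. Removing the randomization means controlling
    about sqrt(n) additional balls. For nonempty urns and for urns with exactly k balls, a ball
    changes the statistic with probability at most of order n^(theta-1), and sqrt(n) n^(theta-1) =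
    o(n^(theta/2)) because theta < 1. For the parity, every ball changes the number of odd urns by
    one, so absolute values would only give sqrt(n); the cancellation of signs has to be used,
    through a second moment. The variances need no separate asymptotics: in all three cases rho (1 -
    rho) is, like rho, a combination of Poisson tails at dilated arguments. In the estimating
    equation, u ln n dominates phi(theta + u) - phi(theta) as soon as phi is Lipschitz at theta, so
    differentiability of c is enough and the factor ln n appears in the limit. *)

Section TaylorBounds.
Context {R : realType}.
Implicit Types f g : R -> R.

Lemma mvt_le f (df : R -> R) (x y C : R) :
  (forall z, (x <= z <= y) || (y <= z <= x) -> is_derive z 1 f (df z)) ->
  (forall z, (x <= z <= y) || (y <= z <= x) -> `|df z| <= C) ->
  `|f y - f x| <= C * `|y - x|.
Proof.
wlog xy : x y / x <= y => [H|].
  have [xy|yx] := leP x y; first exact: H.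
  move=> d b; rewrite distrC (distrC y); apply: (H _ _ (ltW yx)) => z zz.
    by apply: d; rewrite orbC.
  by apply: b; rewrite orbC.
move=> d b.
have dd c : c \in `]x, y[ -> is_derive c 1 f (df c).
  by rewrite in_itv/= => /andP[xc cy]; apply: d; rewrite (ltW xc) (ltW cy).
have cf : {within `[x, y], continuous f}.
  apply: continuous_in_subspaceT => c; rewrite inE/= in_itv/= => cxy.
  have dc : is_derive c 1 f (df c) by apply: d; rewrite cxy.
  by apply/differentiable_continuous/derivable1_diffP.
have [c cxy ->] := MVT_segment xy dd cf.
rewrite normrM ler_wpM2r//; apply: b.
by move: cxy; rewrite in_itv/= => ->.
Qed.

(** The mean value bound is applied to [f] minus its tangent; the constant is not optimal, which
    costs nothing below. Asking the hypotheses only between the two points lets the lemma apply to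
    the variance variable, which must stay positive. *)
Lemma taylor1_le f (df ddf : R -> R) (x h C : R) :
  (forall z, (x <= z <= x + h) || (x + h <= z <= x) -> is_derive z 1 f (df z)) ->
  (forall z, (x <= z <= x + h) || (x + h <= z <= x) ->
     is_derive z 1 df (ddf z)) ->
  (forall z, (x <= z <= x + h) || (x + h <= z <= x) -> `|ddf z| <= C) ->
  `|f (x + h) - f x - h * df x| <= C * `|h| ^+ 2.
Proof.
move=> d1 d2 b.
pose g z := f z - z * df x.
have -> : f (x + h) - f x - h * df x = g (x + h) - g x by rewrite /g; ring.
have := @mvt_le g (fun z => df z - df x) x (x + h) (C * `|h|).
have -> : x + h - x = h by ring.
rewrite expr2 mulrA; apply.
- move=> z zz; have := d1 z zz => dz; apply: is_derive_eq.
  by rewrite scaler0 add0r /GRing.scale/= mulr1.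
- move=> z zz; have sub : forall w, (x <= w <= z) || (z <= w <= x) ->
    (x <= w <= x + h) || (x + h <= w <= x).
    move=> w; case/orP: zz => /andP[a1 a2] /orP[]/andP[a3 a4]; apply/orP; lra.
  have := @mvt_le df ddf x z C.
  move=> /(_ (fun w ww => d2 w (sub w ww)) (fun w ww => b w (sub w ww))).
  move=> /le_trans; apply.
  have C0 : 0 <= C by apply: le_trans (b _ zz).
  apply: ler_wpM2l => //.
  by case/orP: zz => /andP[a1 a2]; [rewrite !ger0_norm|rewrite !ler0_norm]; lra.
Qed.

Lemma taylor2_le f (df ddf dddf : R -> R) (x h C : R) :
  (forall z : R, is_derive z 1 f (df z)) ->
  (forall z : R, is_derive z 1 df (ddf z)) ->
  (forall z : R, is_derive z 1 ddf (dddf z)) ->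
  (forall z : R, `|dddf z| <= C) ->
  `|f (x + h) - f x - h * df x - h ^+ 2 / 2 * ddf x| <= C * `|h| ^+ 3.
Proof.
move=> d1 d2 d3 b.
have C0 : 0 <= C by apply: le_trans (b 0).
pose g z := f z - z * df x - (z - x) ^+ 2 / 2 * ddf x.
have -> : f (x + h) - f x - h * df x - h ^+ 2 / 2 * ddf x = g (x + h) - g x.
  by rewrite /g; field.
have := @mvt_le g (fun z => df z - df x - (z - x) * ddf x) x (x + h)
  (C * `|h| ^+ 2).
have -> : x + h - x = h by ring.
have -> : C * `|h| ^+ 3 = C * `|h| ^+ 2 * `|h| by ring.
move=> H; apply: H.
- move=> z _; have := d1 z => dz; apply: is_derive_eq.
  by rewrite /GRing.scale/=; field.
- move=> z zz.
  have H : `|df (x + (z - x)) - df x - (z - x) * ddf x| <= C * `|z - x| ^+ 2.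
    by apply: (@taylor1_le df ddf dddf).
  have xz : x + (z - x) = z by ring.
  rewrite xz in H; apply: le_trans H _.
  apply: ler_wpM2l => //; rewrite lerXn2r ?nnegrE//.
  by case/orP: zz => /andP[a1 a2]; [rewrite !ger0_norm|rewrite !ler0_norm]; lra.
Qed.

End TaylorBounds.

Section HeatKernel.
Context {R : realType}.
Implicit Types v x : R.

(** Up to the factor (2 pi)^(-1/2), the normal density of variance [v]. With v^(-1/2) moved into the
    exponent, each derivative is [heat] times a rational function of [x] and [v]; the letters after
    [heat] name the variables of differentiation. *)
Definition heat v x : R := expR (- x ^+ 2 / (v *+ 2) - ln v / 2).
Definition heatx v x : R := heat v x * (- x / v).
Definition heatxx v x : R := heat v x * ((x * v^-1) ^+ 2 - v^-1).
Definition heatxxx v x : R := heat v x * (3 * x / v ^+ 2 - x ^+ 3 / v ^+ 3).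
Definition heatvv v x : R := heat v x *
  ((x ^+ 2 / v ^+ 2 - v^-1) ^+ 2 / 4 - x ^+ 2 / v ^+ 3 + v^-2 / 2).

Lemma is_derive_heat v x : 0 < v -> is_derive x 1 (heat v) (heatx v x).
Proof.
move=> v0; apply: is_derive_eq; rewrite /heatx /heat /GRing.scale/=.
by field; lra.
Qed.

Lemma is_derive_heatx v x : 0 < v -> is_derive x 1 (heatx v) (heatxx v x).
Proof.
move=> v0; have := is_derive_heat x v0 => d; apply: is_derive_eq.
by rewrite /heatxx /heatx /GRing.scale/=; field; lra.
Qed.

Lemma is_derive_heatxx v x : 0 < v -> is_derive x 1 (heatxx v) (heatxxx v x).
Proof.
move=> v0; have := is_derive_heat x v0 => d; apply: is_derive_eq.
by rewrite /heatxxx /heatx /GRing.scale/=; field; lra.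
Qed.

(** The heat equation: a derivative in the variance is half a second derivative in space. It makes
    the second-order terms cancel in [heat_step]. *)
Lemma is_derive_heatv v x :
  0 < v -> is_derive v 1 (heat^~ x) (heatxx v x / 2).
Proof.
move=> v0; have := is_derive1_ln v0 => dln.
have v20 : v *+ 2 != 0 by lra.
apply: is_derive_eq; rewrite /heatxx /heat /GRing.scale/=.
by field; lra.
Qed.

Lemma is_derive_heatvv v x :
  0 < v -> is_derive v 1 (fun v => heatxx v x / 2) (heatvv v x).
Proof.
move=> v0; have := is_derive_heatv x v0 => d.
have v20 : v != 0 by lra.
have di : is_derive v 1 (fun v : R => v^-1) (- v ^- 2).
  have := @is_deriveV R id v 1 1 v20 (is_derive_id _ _).
  by rewrite /GRing.scale/= mulr1.
apply: is_derive_eq; rewrite /heatvv /heatxx /GRing.scale/=.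
by field; lra.
Qed.

(* With [t = x ^+ 2 / v], the derivatives are dominated by
   [(1 + t + t ^+ 2) * expR (- t / 2)]. *)
Lemma heat_bound (e : R) : 0 < e -> exists2 C : R, 0 < C & forall v x, e <= v ->
  [/\ heat v x <= C, `|heatxxx v x| <= C & `|heatvv v x| <= C].
Proof.
move=> e0.
pose A := expR (- ln e / 2).
(* A crude majorant of 5/2 u + 11 u^2 and of 8 u^2, the polynomials in u = 1/v that appear in the
   two derivatives. *)
pose D := 11 * (e^-1 ^+ 2 + e^-1 + 1) * 3.
exists (A * (D + 1)).
  by rewrite mulr_gt0 ?expR_gt0// /D; have := invr_gt0 e; rewrite e0; nra.
move=> v x ev; have v0 : 0 < v by lra.
pose t := x ^+ 2 / v.
have t0 : 0 <= t by rewrite /t divr_ge0 ?sqr_ge0 ?ltW.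
pose u := v^-1.
have u0 : 0 < u by rewrite invr_gt0.
have ue : u <= e^-1 by rewrite lef_pV2.
pose E := expR (- (t / 2)).
have E0 : 0 < E by exact: expR_gt0.
have E1 : E <= 1 by rewrite /E -[leRHS]expR0 ler_expR; lra.
have ev2 : E * expR (t / 2) = 1 by rewrite /E -expRD addNr expR0.
have ex1 := expR_ge1Dx (t / 2).
have ex2 : (t / 4) ^+ 2 <= expR (t / 2).
  have -> : t / 2 = t / 4 + t / 4 by field.
  rewrite expRD -expr2 lerXn2r ?nnegrE ?expR_ge0//; first by lra.
  by apply: le_trans (expR_ge1Dx _); lra.
have Et : E * t <= 2 by nra.
have Et2 : E * t ^+ 2 <= 16 by nra.
have hE : heat v x <= A * E.
  rewrite /heat /A /E -expRD ler_expR.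
  have : ln e <= ln v by rewrite ler_ln ?posrE.
  have -> : - x ^+ 2 / (v *+ 2) = - (t / 2) by rewrite /t; field; lra.
  lra.
have h0 : 0 < heat v x by exact: expR_gt0.
have A0 : 0 < A by exact: expR_gt0.
have e10 : 0 < e^-1 by rewrite invr_gt0.
have D1 : 0 < D by rewrite /D; nra.
have key (q : R) : E * `|q| <= D -> `|heat v x * q| <= A * (D + 1).
  move=> H; rewrite normrM (gtr0_norm h0).
  apply: le_trans (_ : A * E * `|q| <= _); first exact: ler_wpM2r.
  by rewrite -mulrA ler_pM2l//; lra.
have uu : u ^+ 2 <= e^-1 ^+ 2 by nra.
split.
- by apply: le_trans hE _; nra.
- apply: key.
  have -> : 3 * x / v ^+ 2 - x ^+ 3 / v ^+ 3 = x * u * (3 * u - t * u).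
    by rewrite /t /u; field; lra.
  rewrite normrM.
  have xu : `|x * u| ^+ 2 = t * u by rewrite real_normK ?num_real// /t /u; field; lra.
  have xu1 : `|x * u| <= (1 + t * u) / 2.
    by have := sqr_ge0 (`|x * u| - 1); rewrite sqrrB1; nra.
  have b2 : `|3 * u - t * u| <= (3 + t) * u.
    by apply: le_trans (ler_normB _ _) _; rewrite !ger0_norm; nra.
  have b3 : `|x * u| * `|3 * u - t * u| <= (1 + t * u) / 2 * ((3 + t) * u).
    exact: ler_pM.
  apply: le_trans (_ : E * ((1 + t * u) / 2 * ((3 + t) * u)) <= _).
    by rewrite ler_pM2l.
  have -> : E * ((1 + t * u) / 2 * ((3 + t) * u)) =
    u / 2 * (3 * E + E * t) + u ^+ 2 / 2 * (3 * (E * t) + E * t ^+ 2) by field.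
  have : 3 * E + E * t <= 5 by lra.
  have : 3 * (E * t) + E * t ^+ 2 <= 22 by lra.
  move=> p1 p2.
  apply: le_trans (_ : u / 2 * 5 + u ^+ 2 / 2 * 22 <= _).
    by apply: lerD; apply: ler_wpM2l => //; nra.
  by rewrite /D; nra.
- apply: key.
  have -> : (x ^+ 2 / v ^+ 2 - v^-1) ^+ 2 / 4 - x ^+ 2 / v ^+ 3 + v^-2 / 2 =
    u ^+ 2 * (t ^+ 2 / 4 - 3 / 2 * t + 3 / 4).
    by rewrite /t /u; field; lra.
  rewrite normrM (ger0_norm (sqr_ge0 _)).
  have b : `|t ^+ 2 / 4 - 3 / 2 * t + 3 / 4| <= t ^+ 2 / 4 + 3 / 2 * t + 3 / 4.
    by rewrite ler_norml; apply/andP; split; nra.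
  apply: le_trans (_ : E * (u ^+ 2 * (t ^+ 2 / 4 + 3 / 2 * t + 3 / 4)) <= _).
    by rewrite ler_pM2l// ler_wpM2l ?sqr_ge0.
  have -> : E * (u ^+ 2 * (t ^+ 2 / 4 + 3 / 2 * t + 3 / 4)) =
     u ^+ 2 * (E * t ^+ 2 / 4 + 3 / 2 * (E * t) + 3 / 4 * E) by field.
  apply: le_trans (_ : u ^+ 2 * 8 <= _).
    by rewrite ler_wpM2l ?sqr_ge0//; lra.
  by rewrite /D; nra.
Qed.

(** A centred Bernoulli variable of size [dl] is exchanged for a normal one of the same variance.
    First-order terms cancel by centring and second-order terms by the heat equation. The error
    keeps the factor [q * (1 - q)], so that over many steps it sums to the variance. *)
Lemma heat_step (e : R) : 0 < e -> exists2 C : R, 0 < C & forall v y q (dl : R), e <= v ->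
  0 <= q <= 1 -> 0 < dl <= 1 ->
  `|(1 - q) * heat v (y - q * dl) + q * heat v (y + (1 - q) * dl)
    - heat (v + dl ^+ 2 * (q * (1 - q))) y| <= C * (dl ^+ 3 * (q * (1 - q))).
Proof.
move=> e0; have [C C0 H] := heat_bound e0.
exists (2 * C); first lra.
move=> v y q dl ev q01 dl01; have v0 : 0 < v by lra.
pose r h := heat v (y + h) - heat v y - h * heatx v y - h ^+ 2 / 2 * heatxx v y.
have rb h : `|r h| <= C * `|h| ^+ 3.
  apply: (@taylor2_le R (heat v) (heatx v) (heatxx v) (heatxxx v) y h C) => z.
  - exact: is_derive_heat.
  - exact: is_derive_heatx.
  - exact: is_derive_heatxx.
  - by have [] := H v z ev.
pose w := dl ^+ 2 * (q * (1 - q)).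
have w0 : 0 <= w by rewrite /w mulr_ge0 ?sqr_ge0//; nra.
pose s := heat (v + w) y - heat v y - w * (heatxx v y / 2).
have sb : `|s| <= C * `|w| ^+ 2.
  apply: (@taylor1_le R (heat^~ y) (fun v => heatxx v y / 2) (heatvv^~ y) v w).
  - by move=> z zz; apply: is_derive_heatv; case/orP: zz => /andP[]; lra.
  - by move=> z zz; apply: is_derive_heatvv; case/orP: zz => /andP[]; lra.
  - move=> z zz; have : e <= z by case/orP: zz => /andP[]; lra.
    by move=> /(H z y)[].
have -> : (1 - q) * heat v (y - q * dl) + q * heat v (y + (1 - q) * dl)
    - heat (v + dl ^+ 2 * (q * (1 - q))) y =
  (1 - q) * r (- (q * dl)) + q * r ((1 - q) * dl) - s.
  by rewrite /r /s -/w /w; field.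
have r1 := rb (- (q * dl)); have r2 := rb ((1 - q) * dl).
have /andP[q0 q1] := q01; have /andP[dl0 dl1] := dl01.
rewrite normrN (ger0_norm (x := q * dl)) in r1; last by nra.
rewrite (ger0_norm (x := (1 - q) * dl)) in r2; last by nra.
rewrite (ger0_norm w0) in sb.
apply: le_trans (ler_normB _ _) _.
apply: le_trans (lerD (ler_normD _ _) (lexx _)) _.
rewrite !normrM (ger0_norm (x := q)) ?(ger0_norm (x := 1 - q)); try lra.
have {}r1 := ler_wpM2l (_ : 0 <= 1 - q) r1.
have {}r2 := ler_wpM2l (_ : 0 <= q) r2.
have qq : 0 <= q * (1 - q) by nra.
have d3 : 0 <= dl ^+ 3 * (q * (1 - q)) by rewrite mulr_ge0// exprn_ge0; lra.
have {}sb : `|s| <= C * (dl ^+ 3 * (q * (1 - q))).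
  apply: le_trans sb _; rewrite ler_pM2l// /w.
  have -> : (dl ^+ 2 * (q * (1 - q))) ^+ 2 = dl * (q * (1 - q)) * (dl ^+ 3 * (q * (1 - q))) by ring.
  by rewrite ler_piMl//; nra.
(* The third absolute moment is at most the variance, as q^2 + (1 - q)^2 <= 1. *)
have t1 : (1 - q) * (C * (q * dl) ^+ 3) + q * (C * ((1 - q) * dl) ^+ 3) <=
   C * (dl ^+ 3 * (q * (1 - q))).
  have -> : (1 - q) * (C * (q * dl) ^+ 3) + q * (C * ((1 - q) * dl) ^+ 3) =
    (q ^+ 2 + (1 - q) ^+ 2) * (C * (dl ^+ 3 * (q * (1 - q)))) by ring.
  by rewrite ler_piMl//; [rewrite mulr_ge0// ltW|nra].
move: r1 r2; move=> /(_ ltac:(lra)) r1 /(_ ltac:(lra)) r2.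
lra.
Qed.

End HeatKernel.

(** * Passing to the limit under integrals *)

Section RealIntegrals.
Context {R : realType} d (T : measurableType d) (mu : {measure set T -> \bar R}).
Implicit Types f g : T -> R.

Lemma Rintegral_cvg_on (D : set T) (f_ : nat -> T -> R) (f g : T -> R) :
  measurable D ->
  (forall n, measurable_fun D (f_ n)) ->
  (forall x, D x -> f_ ^~ x @ \oo --> f x) ->
  mu.-integrable D (EFin \o g) ->
  (forall n x, D x -> `|f_ n x| <= g x) ->
  \int[mu]_(x in D) f_ n x @[n --> \oo] --> \int[mu]_(x in D) f x.
Proof.
move=> mD mf fcv ig fg.
have mfl : measurable_fun D f by apply: (measurable_fun_cvg (h := f_)).
have fgl x : D x -> `|f x| <= g x.
  move=> Dx; have nf : `|f_ n x| @[n --> \oo] --> `|f x|.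
    by apply: cvg_norm; exact: fcv.
  have cg : (fun=> g x) @ \oo --> g x by exact: cvg_cst.
  by apply: (ler_cvg_to nf cg); near=> n; exact: fg.
have gi : mu.-integrable D (EFin \o f).
  apply: (le_integrable _ _ _ ig) => //; first exact/measurable_EFinP.
  move=> x Dx /=; rewrite lee_fin (le_trans (fgl x Dx))//.
  exact: ler_norm.
apply: fine_cvg; rewrite fineK; last exact: integrable_fin_num.
apply: (@dominated_cvg _ _ _ _ _ _ _ _ (EFin \o g)) => //.
- by move=> n; apply/measurable_EFinP.
- by move=> x Dx; apply/cvg_EFin; [near=> n|exact: fcv].
Unshelve. all: by end_near. Qed.

Lemma Rintegral_cvg (f_ : nat -> T -> R) f g :
  (forall n, measurable_fun setT (f_ n)) ->
  (forall x, f_ ^~ x @ \oo --> f x) ->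
  mu.-integrable setT (EFin \o g) ->
  (forall n x, `|f_ n x| <= g x) ->
  \int[mu]_x f_ n x @[n --> \oo] --> \int[mu]_x f x.
Proof.
move=> mf fcv ig fg; apply: (Rintegral_cvg_on measurableT mf _ ig) => [x _|n x _].
  exact: fcv.
exact: fg.
Qed.

Lemma integrable_add f g : mu.-integrable setT (EFin \o f) ->
  mu.-integrable setT (EFin \o g) ->
  mu.-integrable setT (EFin \o (fun x => f x + g x)).
Proof. by move=> i1 i2; exact: (integrableD measurableT i1 i2). Qed.

Lemma integrable_sub f g : mu.-integrable setT (EFin \o f) ->
  mu.-integrable setT (EFin \o g) ->
  mu.-integrable setT (EFin \o (fun x => f x - g x)).
Proof. by move=> i1 i2; exact: (integrableB measurableT i1 i2). Qed.

Lemma integrable_scale (c : R) f : mu.-integrable setT (EFin \o f) ->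
  mu.-integrable setT (EFin \o (fun x => c * f x)).
Proof. by move=> i; exact: (integrableZl measurableT c i). Qed.

Lemma integrable_bounded_mul f g (M : R) : measurable_fun setT f ->
  (forall x, `|f x| <= M) -> mu.-integrable setT (EFin \o g) ->
  mu.-integrable setT (EFin \o (fun x => f x * g x)).
Proof.
move=> mf fM ig.
have ig2 := integrableZl measurableT M ig.
apply: (le_integrable _ _ _ ig2) => //.
  apply/measurable_EFinP/measurable_funM => //.
  by have /measurable_EFinP := measurable_int _ ig.
move=> x _ /=; rewrite lee_fin !normrM ler_wpM2r// (le_trans (fM x))//.
exact: ler_norm.
Qed.

(** Scheffe's lemma. The sequence itself has no common majorant, but the positive part of [h - h_ n]
    is at most [h], and equality of the total masses turns its integral into half of the L^1
    distance. *)
Lemma scheffe (h_ : nat -> T -> R) h f (M : R) :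
  (forall n, mu.-integrable setT (EFin \o h_ n)) ->
  mu.-integrable setT (EFin \o h) ->
  (forall n x, 0 <= h_ n x) -> (forall x, 0 <= h x) ->
  (forall n, \int[mu]_x h_ n x = \int[mu]_x h x) ->
  (forall x, h_ ^~ x @ \oo --> h x) ->
  measurable_fun setT f -> (forall x, `|f x| <= M) ->
  \int[mu]_x (f x * h_ n x) @[n --> \oo] --> \int[mu]_x (f x * h x).
Proof.
move=> ih_ ih h_0 h0 e hcv mf fM.
have mh n : measurable_fun setT (h_ n).
  by have /measurable_EFinP := measurable_int _ (ih_ n).
have mhh : measurable_fun setT h.
  by have /measurable_EFinP := measurable_int _ ih.
have M0 : 0 <= M by apply: le_trans (fM point).
pose g n x := Num.max (h x - h_ n x) 0.
have mg n : measurable_fun setT (g n).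
  by apply: measurable_maxr => //; apply: measurable_funB.
have gh n x : `|g n x| <= h x.
  rewrite /g ger0_norm ?le_max ?lexx ?orbT// ge_max h0 andbT.
  by have := h_0 n x; lra.
have ig n : mu.-integrable setT (EFin \o g n).
  apply: (le_integrable _ _ _ ih) => //; first exact/measurable_EFinP.
  by move=> x _ /=; rewrite lee_fin (le_trans (gh n x))// ler_norm.
have gcv : \int[mu]_x g n x @[n --> \oo] --> (0 : R).
  have -> : 0 = \int[mu]_x (cst 0 x) by rewrite /= Rintegral_cst// mul0r.
  apply: (Rintegral_cvg (g := h)) => // x.
  have cst0 : (fun=> 0 : R) @ \oo --> (0 : R) by exact: cvg_cst.
  have c1 : (h x - h_ n x) @[n --> \oo] --> h x - h x.
    by apply: cvgB; [exact: cvg_cst|exact: hcv].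
  rewrite subrr in c1.
  have c2 : `|h x - h_ n x| @[n --> \oo] --> `|0 : R| by apply: cvg_norm.
  rewrite normr0 in c2.
  apply: squeeze_cvgr cst0 c2; near=> n.
  by rewrite /g le_max lexx orbT ge_max normr_ge0 andbT ler_norm.
have ifh n : mu.-integrable setT (EFin \o (fun x => f x * h_ n x)).
  exact: integrable_bounded_mul (ih_ n).
have ifh0 : mu.-integrable setT (EFin \o (fun x => f x * h x)).
  exact: integrable_bounded_mul ih.
have key n : `|\int[mu]_x (f x * h_ n x) - \int[mu]_x (f x * h x)| <=
   M * 2 * \int[mu]_x g n x.
  rewrite -RintegralB//.
  have ifd := integrable_sub (ifh n) ifh0.
  apply: le_trans (le_normr_Rintegral _ ifd) _ => //.
  have ib := integrable_sub (ih_ n) ih.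
  have ig2 := integrable_scale 2 (ig n).
  have ih2 := integrable_add ib ig2.
  apply: (@le_trans _ _ (\int[mu]_x (M * (h_ n x - h x + 2 * g n x)))).
    apply: le_Rintegral => //.
    - exact: integrable_norm ifd.
    - exact: integrable_scale ih2.
    move=> x _; rewrite -mulrBr normrM.
    (* The signed difference integrates to zero; only the doubled positive part remains. *)
    have -> : h_ n x - h x + 2 * g n x = `|h_ n x - h x|.
      rewrite /g; case: (leP (h x - h_ n x) 0) => H.
        by rewrite ger0_norm; lra.
      by rewrite ler0_norm; lra.
    by rewrite ler_wpM2r.
  rewrite RintegralZl// RintegralD// RintegralB// e subrr add0r RintegralZl//.
  by rewrite mulrA.
apply/cvgrPdist_le => eps eps0.
have /cvgrPdist_le : M * 2 * \int[mu]_x g n x @[n --> \oo] --> M * 2 * 0.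
  by apply: cvgMr.
rewrite mulr0 => /(_ eps eps0); apply: filterS => n; rewrite sub0r normrN => H.
rewrite distrC; apply: le_trans (key n) _.
by apply: le_trans H; exact: ler_norm.
Unshelve. all: by end_near. Qed.

End RealIntegrals.

Section NormalDensity.
Context {R : realType}.
Local Notation mu := (@lebesgue_measure R).

Lemma normal_prob_density (s : R) (f : R -> R) (M : R) :
  measurable_fun [set: measurableTypeR R] f -> (forall x, `|f x| <= M) ->
  \int[normal_prob 0 s]_x f x = \int[mu]_x (f x * normal_pdf 0 s x).
Proof.
move=> mf fM; congr fine.
have fi : (normal_prob 0 s).-integrable setT (EFin \o f).
  apply: measurable_bounded_integrable => //.
    by rewrite (le_lt_trans (probability_le1 _ _))// ltry.
  exists M; split; first exact: num_real.
  by move=> y My x _; apply: le_trans (fM x) (ltW My).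
rewrite -(Radon_Nikodym_change_of_variables (normal_prob_dominates 0 s))//=.
apply: ae_eq_integral => //.
- apply: emeasurable_funM => //; first exact/measurable_EFinP.
  apply: (measurable_int mu).
  by apply: Radon_Nikodym_integrable; exact: normal_prob_dominates.
- apply/measurable_EFinP/measurable_funM => //.
  exact: measurable_normal_pdf.
- rewrite [X in ae_eq _ _ _ X](_ : _ = (fun x => (f x)%:E * (normal_pdf 0 s x)%:E)%E)//.
  apply: ae_eqe_mul2l => /=.
  rewrite Radon_NikodymE//=; first exact: normal_prob_dominates.
  move=> abmu; case: cid => /= h [h1 h2 h3].
  apply: integral_ae_eq => //=.
  + by apply/measurable_EFinP; exact: measurable_normal_pdf.
  + by move=> E E01 mE; rewrite -h3.
Qed.

End NormalDensity.

(** * A central limit theorem for Bernoulli sums *)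

Section BernoulliSums.
Context {R : realType}.
Local Notation mu := (@lebesgue_measure R).
Implicit Types (s : seq R) (u : R -> R) (x : R).

(* [bern s u x] is the expectation of [u (x + S)], where [S] is a sum of
   independent Bernoulli variables with parameters listed in [s]. *)
Fixpoint bern s u x : R :=
  if s is q :: s' then (1 - q) * bern s' u x + q * bern s' u (x + 1) else u x.

Definition bern_mean s := \sum_(q <- s) q.
Definition bern_var s := \sum_(q <- s) q * (1 - q).

Definition probs s := all (fun q : R => 0 <= q <= 1) s.

Lemma bern_var_ge0 s : probs s -> 0 <= bern_var s.
Proof.
move=> /allP s01; rewrite /bern_var big_seq; apply: sumr_ge0 => q /s01 /andP[q0 q1].
by rewrite mulr_ge0 ?subr_ge0.
Qed.

Lemma bern_dist s u w x (e : R) : probs s -> (forall y, `|u y - w y| <= e) ->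
  `|bern s u x - bern s w x| <= e.
Proof.
move=> + uw; elim: s x => [|q s IH] x //= /andP[/andP[q0 q1] s01].
have -> : (1 - q) * bern s u x + q * bern s u (x + 1) -
   ((1 - q) * bern s w x + q * bern s w (x + 1)) =
   (1 - q) * (bern s u x - bern s w x) +
   q * (bern s u (x + 1) - bern s w (x + 1)) by ring.
apply: le_trans (ler_normD _ _) _; rewrite !normrM (ger0_norm q0).
rewrite (ger0_norm (x := 1 - q)) ?subr_ge0//.
have := IH x s01; have := IH (x + 1) s01; nra.
Qed.

Lemma bern_ge0 s u x : probs s -> (forall y, 0 <= u y) -> 0 <= bern s u x.
Proof.
move=> + u0; elim: s x => [|q s IH] x //= /andP[/andP[q0 q1] s01].
by rewrite addr_ge0 ?mulr_ge0 ?subr_ge0 ?IH.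
Qed.

Lemma bern_cst s (a x : R) : bern s (cst a) x = a.
Proof. by elim: s x => [|q s IH] x //=; rewrite !IH; ring. Qed.

Lemma bernZ s a u x : bern s (fun y => a * u y) x = a * bern s u x.
Proof. by elim: s x => [|q s IH] x //=; rewrite !IH; ring. Qed.

(** Lindeberg's replacement, one variable per induction step. The variance of the kernel only grows,
    hence stays at least [e], and one constant serves all steps. *)
Lemma bern_heat (e : R) : 0 < e -> exists2 C : R, 0 < C &
  forall s v (dl a x : R), probs s -> e <= v -> 0 < dl <= 1 ->
  `|bern s (fun y => heat v (dl * y - a)) x -
    heat (v + dl ^+ 2 * bern_var s) (dl * (x + bern_mean s) - a)| <=
  C * (dl ^+ 3 * bern_var s).
Proof.
move=> e0; have [C C0 H] := heat_step e0; exists C => //.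
move=> s v dl a x + ev dl01; elim: s x => [|q s IH] x /=.
  by rewrite /bern_mean /bern_var !big_nil !mulr0 !addr0 subrr normr0.
move=> /andP[q01 s01]; have v0 := bern_var_ge0 s01.
rewrite /bern_mean /bern_var !big_cons -/(bern_mean s) -/(bern_var s).
set v' := v + dl ^+ 2 * bern_var s; set y := dl * (x + (q + bern_mean s)) - a.
have h1 := IH x s01; have h2 := IH (x + 1) s01.
have ev' : e <= v' by rewrite /v' ler_wpDr// mulr_ge0// sqr_ge0.
have h3 := H v' y q dl ev' q01 dl01.
have y1 : y - q * dl = dl * (x + bern_mean s) - a by rewrite /y; ring.
have y2 : y + (1 - q) * dl = dl * (x + 1 + bern_mean s) - a by rewrite /y; ring.
have v2 : v' + dl ^+ 2 * (q * (1 - q)) =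
  v + dl ^+ 2 * (q * (1 - q) + bern_var s) by rewrite /v'; ring.
rewrite y1 y2 v2 in h3.
have /andP[q0 q1] := q01.
set b1 := bern s _ x in h1 *; set b2 := bern s _ (x + 1) in h2 *.
set g1 := heat v' (dl * (x + bern_mean s) - a) in h1 h3.
set g2 := heat v' (dl * (x + 1 + bern_mean s) - a) in h2 h3.
set g3 := heat (v + _) y in h3 *.
have -> : (1 - q) * b1 + q * b2 - g3 = (1 - q) * (b1 - g1) + q * (b2 - g2) +
  ((1 - q) * g1 + q * g2 - g3) by ring.
apply: le_trans (ler_normD _ _) _.
apply: le_trans (lerD (ler_normD _ _) h3) _.
rewrite !normrM (ger0_norm q0) (ger0_norm (x := 1 - q)) ?subr_ge0//.
by nra.
Qed.

Definition gauss_density v x : R := (Num.sqrt (pi *+ 2))^-1 * heat v x.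

Lemma gauss_densityE v x y :
  0 < v -> gauss_density v (x - y) = normal_pdf x (Num.sqrt v) y.
Proof.
move=> v0; have sv : Num.sqrt v != 0 by rewrite sqrtr_eq0 -ltNge.
rewrite normal_pdfE// /normal_peak /normal_fun /gauss_density /heat.
have eL : expR (- (ln v / 2)) = (Num.sqrt v)^-1.
  by rewrite expRN -powR12_sqrt ?ltW// /powR gt_eqF// [_ / 2]mulrC.
rewrite sqr_sqrtr ?ltW// -mulrnAr sqrtrM ?ltW// invfM expRD.
have -> : - (x - y) ^+ 2 / (v *+ 2) = - (y - x) ^+ 2 / (v *+ 2).
  by congr (_ / _); ring.
by rewrite mulNr eL; ring.
Qed.

Lemma gauss_density_even v x : gauss_density v (- x) = gauss_density v x.
Proof. by rewrite /gauss_density /heat sqrrN. Qed.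

Lemma gauss_density_ge0 v x : 0 <= gauss_density v x.
Proof. by rewrite mulr_ge0 ?expR_ge0// invr_ge0 sqrtr_ge0. Qed.

Lemma integrable_gauss_density v x : 0 < v ->
  mu.-integrable setT (EFin \o (fun y => gauss_density v (x - y))).
Proof.
move=> v0; rewrite (_ : (fun y => _) = normal_pdf x (Num.sqrt v)).
  exact: integrable_normal_pdf.
by apply/funext => y; rewrite gauss_densityE.
Qed.

Lemma Rintegral_gauss_density v x : 0 < v ->
  \int[mu]_y gauss_density v (x - y) = 1.
Proof.
move=> v0; rewrite (_ : (fun y => _) = normal_pdf x (Num.sqrt v)).
  by rewrite /Rintegral integral_normal_pdf.
by apply/funext => y; rewrite gauss_densityE.
Qed.

Lemma bern_integral s (k : R -> R -> R) x :
  (forall y, mu.-integrable setT (EFin \o k y)) ->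
  mu.-integrable setT (EFin \o (fun z => bern s (k^~ z) x)) /\
  \int[mu]_z bern s (k^~ z) x = bern s (fun y => \int[mu]_z k y z) x.
Proof.
move=> ik; elim: s x => [|q s IH] x /=.
  by split; [exact: (ik x)|].
have [i1 e1] := IH x; have [i2 e2] := IH (x + 1).
have i3 := integrable_scale (1 - q) i1; have i4 := integrable_scale q i2.
split; first exact: integrable_add.
by rewrite RintegralD// !RintegralZl// e1 e2.
Qed.

End BernoulliSums.

(** * Gaussian smoothing and the limit of Bernoulli sums *)

Section BernoulliCLT.
Context {R : realType}.
Local Notation mu := (@lebesgue_measure R).

Definition lipschitz_bounded (f : R -> R) (L M : R) : Prop :=
  (forall x y, `|f x - f y| <= L * `|x - y|) /\ (forall x, `|f x| <= M).

Lemma lipschitz_bounded_ge0 f L M : lipschitz_bounded f L M -> 0 <= L /\ 0 <= M.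
Proof.
move=> [fL fM]; split; last by apply: le_trans (fM 0).
by have := le_trans (normr_ge0 _) (fL 1 0); rewrite subr0 normr1 mulr1.
Qed.

Lemma lipschitz_continuous f L M : lipschitz_bounded f L M -> continuous f.
Proof.
move=> fLM; have [L0 _] := lipschitz_bounded_ge0 fLM; have [fL _] := fLM.
move=> x; apply/cvgrPdist_le => e e0; near=> y.
apply: le_trans (fL x y) _.
have : `|x - y| <= e / (L + 1).
  near: y; apply: cvgr_dist_le; first exact: cvg_id.
  by rewrite divr_gt0 ?ltr_wpDl.
rewrite ler_pdivlMr ?ltr_wpDl//; have := normr_ge0 (x - y); nra.
Unshelve. all: by end_near. Qed.

Lemma lipschitz_measurable f L M : lipschitz_bounded f L M ->
  measurable_fun [set: measurableTypeR R] f.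
Proof. by move=> /lipschitz_continuous; exact: continuous_measurable_fun. Qed.

(** Convolution of [f] with a normal law of variance [w]: a mixture of heat kernels, so that
    [bern_heat] applies under the integral sign although [f] is only Lipschitz. *)
Definition smooth (f : R -> R) (w x : R) : R :=
  \int[mu]_z (f z * gauss_density w (x - z)).

(** Half of the Gaussian exponent absorbs the factor |u|; the other half is the kernel of variance 2
    w, whose integral is known. This bounds the first absolute moment without computing it. *)
Lemma norm_gauss_density (w u : R) : 0 < w ->
  `|u| * gauss_density w u <= Num.sqrt (2 * w) * gauss_density (2 * w) u.
Proof.
move=> w0; rewrite /gauss_density !mulrA ![_ * (Num.sqrt (pi *+ 2))^-1]mulrC.
rewrite -!mulrA ler_wpM2l ?invr_ge0 ?sqrtr_ge0//.
have w20 : 0 < 2 * w by rewrite mulr_gt0.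
have sE (r : R) : 0 < r -> expR (- (ln r / 2)) = (Num.sqrt r)^-1.
  by move=> r0; rewrite expRN -powR12_sqrt ?ltW// /powR gt_eqF// [_ / 2]mulrC.
have eq1 : Num.sqrt (2 * w) * heat (2 * w) u = expR (- (u ^+ 2 / (4 * w))).
  rewrite /heat expRD sE// mulrCA divff ?mulr1 ?gt_eqF ?sqrtr_gt0//.
  by congr expR; field; lra.
have sw0 : 0 < Num.sqrt w by rewrite sqrtr_gt0.
have eq2 : heat w u = (Num.sqrt w)^-1 * (expR (- (u ^+ 2 / (4 * w))) * expR (- (u ^+ 2 / (4 * w)))).
  rewrite /heat expRD sE// mulrC -expRD; congr (_ * expR _).
  by field; lra.
rewrite eq1 eq2; set E := expR _.
have E0 : 0 < E by exact: expR_gt0.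
pose s := `|u| / Num.sqrt w.
have s2 : u ^+ 2 / (4 * w) = s ^+ 2 / 4.
  rewrite /s expr_div_n sqr_sqrtr ?ltW// real_normK ?num_real//.
  by field; lra.
have sE1 : s * E <= 1.
  have : s <= expR (u ^+ 2 / (4 * w)).
    by rewrite s2; apply: le_trans (expR_ge1Dx _); have := sqr_ge0 (s / 2 - 1); lra.
  have : E * expR (u ^+ 2 / (4 * w)) = 1 by rewrite /E -expRD addNr expR0.
  by nra.
have -> : `|u| * ((Num.sqrt w)^-1 * (E * E)) = s * E * E by rewrite /s; ring.
by rewrite ler_piMl// ltW.
Qed.

Lemma smooth_dist f L M (w x : R) : lipschitz_bounded f L M -> 0 < w ->
  `|f x - smooth f w x| <= L * Num.sqrt (2 * w).
Proof.
move=> fLM w0; have [L0 M0] := lipschitz_bounded_ge0 fLM.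
have mf := lipschitz_measurable fLM; have [fL fM] := fLM.
have w20 : 0 < 2 * w by rewrite mulr_gt0.
have ig := integrable_gauss_density x w0.
have ifg := integrable_bounded_mul mf fM ig.
have ifx := integrable_scale (f x) ig.
have -> : f x - smooth f w x =
  \int[mu]_z (f x * gauss_density w (x - z) - f z * gauss_density w (x - z)).
  by rewrite RintegralB// RintegralZl// Rintegral_gauss_density// mulr1.
have ifd := integrable_sub ifx ifg.
apply: le_trans (le_normr_Rintegral _ ifd) _ => //.
have ig2 := integrable_scale (L * Num.sqrt (2 * w)) (integrable_gauss_density x w20).
apply: (@le_trans _ _ (\int[mu]_z (L * Num.sqrt (2 * w) * gauss_density (2 * w) (x - z)))).
  apply: le_Rintegral => //; first exact: integrable_norm ifd.
  move=> z _; rewrite -mulrBl normrM (ger0_norm (gauss_density_ge0 _ _)).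
  apply: le_trans (_ : L * `|x - z| * gauss_density w (x - z) <= _).
    by rewrite ler_wpM2r ?gauss_density_ge0.
  by rewrite -!mulrA ler_wpM2l// norm_gauss_density.
rewrite RintegralZl//; last exact: integrable_gauss_density.
by rewrite Rintegral_gauss_density// mulr1.
Qed.

Lemma gauss_density_cvg (w_ : nat -> R) (w x : R) : 0 < w -> w_ @ \oo --> w ->
  gauss_density (w_ n) x @[n --> \oo] --> gauss_density w x.
Proof.
move=> w0 wcv; apply: cvgMr; apply: (cvg_comp w_ (heat^~ x)) wcv _.
have d := is_derive_heatv x w0.
have /differentiable_continuous : differentiable (heat^~ x) w.
  by apply/derivable1_diffP.
by [].
Qed.

Section CLT.
Variables (s_ : nat -> seq R) (dl : nat -> R) (v : R).
Hypotheses (v0 : 0 < v) (s01 : forall n, probs (s_ n)) (dl0 : forall n, 0 < dl n)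
  (dlcv : dl @ \oo --> (0 : R))
  (vcv : dl n ^+ 2 * bern_var (s_ n) @[n --> \oo] --> v).
Variables (f : R -> R) (L M : R).
Hypothesis fLM : lipschitz_bounded f L M.

(** The expectation of the smoothed function is the integral of [f] against [h n], the density of
    the normalized sum plus an independent normal variable of variance [w]. These densities converge
    pointwise by [bern_heat], and [scheffe] concludes. *)
Lemma smooth_clt (w : R) : 0 < w ->
  bern (s_ n) (fun y => smooth f w (dl n * (y - bern_mean (s_ n)))) 0 @[n --> \oo] -->
  \int[mu]_z (f z * gauss_density (w + v) z).
Proof.
move=> w0; have mf := lipschitz_measurable fLM; have [_ fM] := fLM.
have wv0 : 0 < w + v by rewrite addr_gt0.
pose h n z := bern (s_ n) (fun y => gauss_density w (dl n * (y - bern_mean (s_ n)) - z)) 0.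
have ih n : mu.-integrable setT (EFin \o h n) /\ \int[mu]_z h n z = 1.
  have [|i e] := @bern_integral R (s_ n)
    (fun y z => gauss_density w (dl n * (y - bern_mean (s_ n)) - z)) 0.
    by move=> y; exact: integrable_gauss_density.
  split => //; rewrite e -[RHS](bern_cst (s_ n) 1 0); congr bern.
  by apply/funext => y; rewrite Rintegral_gauss_density.
have -> : (fun n => bern (s_ n) (fun y => smooth f w (dl n * (y - bern_mean (s_ n)))) 0) =
  (fun n => \int[mu]_z (f z * h n z)).
  apply/funext => n.
  have [|i e] := @bern_integral R (s_ n)
    (fun y z => f z * gauss_density w (dl n * (y - bern_mean (s_ n)) - z)) 0.
    by move=> y; exact: (integrable_bounded_mul mf fM (integrable_gauss_density _ w0)).
  by rewrite -e; congr Rintegral; apply/funext => z; rewrite bernZ.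
have gE (u : R) : 0 < u -> gauss_density u = fun z => gauss_density u (0 - z).
  by move=> u0; apply/funext => z; rewrite sub0r gauss_density_even.
have igv : mu.-integrable setT (EFin \o gauss_density (w + v)).
  by rewrite gE//; exact: integrable_gauss_density.
apply: (@scheffe R _ _ mu h _ f M) => //.
- by move=> n; case: (ih n).
- by move=> n z; apply: bern_ge0 => // y; exact: gauss_density_ge0.
- by move=> z; exact: gauss_density_ge0.
- by move=> n; rewrite (ih n).2 gE// Rintegral_gauss_density.
move=> z; have [C C0 H] := bern_heat w0.
pose r n := gauss_density (w + dl n ^+ 2 * bern_var (s_ n)) (- z).
have rcv : r @ \oo --> gauss_density (w + v) z.
  rewrite -gauss_density_even; apply: gauss_density_cvg => //.
  by apply: cvgD => //; exact: cvg_cst.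
pose c0 := (Num.sqrt (pi *+ 2 : R))^-1.
have c00 : 0 <= c0 by rewrite invr_ge0 sqrtr_ge0.
(* The Lindeberg error is of third order: [dl] times the convergent variance. *)
have bcv : c0 * C * dl n * (dl n ^+ 2 * bern_var (s_ n)) @[n --> \oo] --> (0 : R).
  have -> : 0 = c0 * C * 0 * v by ring.
  by apply: cvgM => //; apply: cvgMr.
have dcv : h n z - r n @[n --> \oo] --> (0 : R).
  apply/cvgrPdist_le => e e0; near=> n; rewrite sub0r normrN.
  have -> : h n z - r n = c0 * (bern (s_ n) (fun y => heat w (dl n * y - (dl n * bern_mean (s_ n) + z))) 0
     - heat (w + dl n ^+ 2 * bern_var (s_ n)) (dl n * (0 + bern_mean (s_ n)) - (dl n * bern_mean (s_ n) + z))).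
    rewrite mulrBr -bernZ /h /r /gauss_density -/c0; congr (bern _ _ _ - _ * heat _ _).
      by apply/funext => y; congr (_ * heat _ _); ring.
    by ring.
  rewrite normrM (ger0_norm c00).
  apply: le_trans (_ : c0 * (C * (dl n ^+ 3 * bern_var (s_ n))) <= _).
    apply: ler_wpM2l => //; apply: H => //; rewrite dl0/=.
    by near: n; apply: cvgr_le; [exact: dlcv|].
  have -> : c0 * (C * (dl n ^+ 3 * bern_var (s_ n))) =
    c0 * C * dl n * (dl n ^+ 2 * bern_var (s_ n)) by ring.
  by near: n; apply: cvgr_le; [exact: bcv|].
have -> : (fun n => h n z) = (fun n => (h n z - r n) + r n).
  by apply/funext => n; rewrite subrK.
by rewrite -[gauss_density _ _]add0r; apply: cvgD.
Unshelve. all: by end_near. Qed.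

Theorem bernoulli_clt :
  bern (s_ n) (fun y => f (dl n * (y - bern_mean (s_ n)))) 0 @[n --> \oo] -->
  \int[normal_prob 0 (Num.sqrt v)]_x f x.
Proof.
have mf := lipschitz_measurable fLM; have [_ fM] := fLM.
have [L0 M0] := lipschitz_bounded_ge0 fLM.
have pdfE (u : R) : 0 < u -> normal_pdf 0 (Num.sqrt u) = gauss_density u.
  by move=> u0; apply/funext => z; rewrite -gauss_densityE// sub0r gauss_density_even.
rewrite (normal_prob_density _ mf fM) pdfE//.
have igv (u : R) : 0 < u -> mu.-integrable setT (EFin \o gauss_density u).
  by move=> u0; rewrite -pdfE//; exact: integrable_normal_pdf.
have igv1 (u : R) : 0 < u -> \int[mu]_x gauss_density u x = 1.
  by move=> u0; rewrite -pdfE// /Rintegral integral_normal_pdf.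
pose w m : R := m.+1%:R^-1.
have w0 m : 0 < w m by rewrite invr_gt0.
have wcv : w @ \oo --> (0 : R) by exact: cvg_harmonic.
have c1 : \int[mu]_x (f x * gauss_density (w m + v) x) @[m --> \oo] -->
  \int[mu]_x (f x * gauss_density v x).
  apply: (@scheffe R _ _ mu (fun m => gauss_density (w m + v)) (gauss_density v) f M).
  - by move=> n; apply: igv; rewrite addr_gt0.
  - exact: igv.
  - by move=> n x; exact: gauss_density_ge0.
  - by move=> x; exact: gauss_density_ge0.
  - by move=> n; rewrite !igv1// addr_gt0.
  - move=> x; apply: gauss_density_cvg => //.
    by rewrite -[v in _ --> v]add0r; apply: cvgD => //; exact: cvg_cst.
  - by [].
  - by [].
have c2 : L * Num.sqrt (2 * w m) @[m --> \oo] --> (0 : R).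
  have -> : 0 = L * Num.sqrt (2 * 0 : R) by rewrite mulr0 sqrtr0 mulr0.
  apply: cvgMr; apply: (cvg_comp _ (@Num.sqrt R)); last exact: sqrt_continuous.
  exact: cvgMr.
apply/cvgrPdist_le => e e0.
have e30 : 0 < e / 3 by lra.
(* The smoothing level is fixed before [n], since its error does not depend on [n]. *)
have [m [m1 m2]] : exists m, L * Num.sqrt (2 * w m) <= e / 3 /\
  `|\int[mu]_x (f x * gauss_density v x) -
    \int[mu]_x (f x * gauss_density (w m + v) x)| <= e / 3.
  move/cvgrPdist_le: c1 => /(_ _ e30) n1.
  have n2 : \forall m \near \oo, L * Num.sqrt (2 * w m) <= e / 3.
    by apply: cvgr_le; [exact: c2|].
  by have [m _ H] := filterI n1 n2; exists m; have [] := H m (leqnn m).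
have /cvgrPdist_le /(_ _ e30) := smooth_clt (w0 m).
apply: filterS => n n1.
have sd y : `|smooth f (w m) (dl n * (y - bern_mean (s_ n))) -
    f (dl n * (y - bern_mean (s_ n)))| <= L * Num.sqrt (2 * w m).
  by rewrite distrC; apply: (smooth_dist _ fLM).
have := @bern_dist R (s_ n) (fun y => smooth f (w m) (dl n * (y - bern_mean (s_ n))))
  (fun y => f (dl n * (y - bern_mean (s_ n)))) 0 _ (s01 n) sd.
set a := \int[mu]_x _ in m2 *; set b := \int[mu]_x _ in m2 n1.
set c := bern _ _ _ in n1 *; set dd := bern _ _ _.
move: m2 n1; rewrite !ler_norml => /andP[? ?] /andP[? ?] /andP[? ?].
by apply/andP; split; lra.
Qed.

End CLT.
End BernoulliCLT.

(** * Weak convergence from Lipschitz test functions *)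

Section WeakConvergence.
Context {R : realType} d (T : measurableType d) (P : probability T R).
Implicit Types (Y Z : nat -> T -> R) (f g : R -> R).

Lemma integrable_bounded (h : T -> R) (M : R) : measurable_fun setT h ->
  (forall x, `|h x| <= M) -> P.-integrable setT (EFin \o h).
Proof.
move=> mh hM; apply: measurable_bounded_integrable => //.
  by rewrite (le_lt_trans (probability_le1 _ _))// ltry.
exists M; split; first exact: num_real.
by move=> y My x _; apply: le_trans (hM x) (ltW My).
Qed.

Lemma Rintegral_dist_le (h k : T -> R) (A : set T) (M e : R) :
  measurable_fun setT h -> measurable_fun setT k -> measurable A ->
  (forall x, `|h x| <= M) -> (forall x, `|k x| <= M) -> 0 <= e ->
  (forall x, ~ A x -> `|h x - k x| <= e) ->
  `|\int[P]_x h x - \int[P]_x k x| <= e + 2 * M * fine (P A).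
Proof.
move=> mh mk mA hM kM e0 hk.
have ih := integrable_bounded mh hM; have ik := integrable_bounded mk kM.
have ii : P.-integrable setT (EFin \o (\1_A : T -> R)).
  apply: (@integrable_bounded _ 1); first exact: measurable_indic.
  by move=> x; rewrite indicE; case: (_ \in _); rewrite ?normr1 ?normr0 ?ler01.
have ic : P.-integrable setT (EFin \o (cst e : T -> R)).
  by apply: (@integrable_bounded _ `|e|) => // x; exact: lexx.
rewrite -RintegralB//.
have id := integrable_sub ih ik.
apply: le_trans (le_normr_Rintegral _ id) _ => //.
have is2 := integrable_scale (2 * M) ii.
have iss := integrable_add ic is2.
apply: (@le_trans _ _ (\int[P]_x (cst e x + 2 * M * \1_A x))).
  apply: le_Rintegral => //; first exact: integrable_norm id.
  move=> x _ /=; rewrite indicE; case: (boolP (x \in A)) => xA /=.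
    rewrite mulr1; apply: le_trans (ler_normB _ _) _.
    by have := hM x; have := kM x; lra.
  by rewrite mulr0 addr0 hk// => Ax; move: xA; rewrite notin_setE.
rewrite RintegralD// RintegralZl// Rintegral_cst//= probability_setT/= mulr1.
by rewrite {1}/Rintegral integral_indic// setIT.
Qed.

Definition lip_cvg Y (v : R) := forall f (L M : R), lipschitz_bounded f L M ->
  \int[P]_w f (Y n w) @[n --> \oo] --> \int[normal_prob 0 (Num.sqrt v)]_x f x.

Section InfConvolution.
Variables (f : R -> R) (M : R).
Hypotheses (fc : continuous f) (fM : forall x, `|f x| <= M).

(** The largest [k]-Lipschitz function below [f]. It increases to [f] with [k] and so gives
    one-sided estimates for a continuous function; the other side comes from [- f]. *)
Definition infconv (k : nat) (x : R) : R :=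
  inf (range (fun y => f y + k%:R * `|x - y|)).

Let lbnd (k : nat) x y : - M <= f y + k%:R * `|x - y|.
Proof.
have := fM y; rewrite ler_norml => /andP[+ _] => h.
by apply: le_trans h _; rewrite lerDl mulr_ge0.
Qed.

Let hinf (k : nat) x : has_inf (range (fun y => f y + k%:R * `|x - y|)).
Proof.
split; first by exists (f x + k%:R * `|x - x|), x.
by exists (- M) => _ [y _ <-]; exact: lbnd.
Qed.

Lemma infconv_le (k : nat) x y : infconv k x <= f y + k%:R * `|x - y|.
Proof. by apply: ge_inf; [case: (hinf k x)|exists y]. Qed.

Lemma infconv_ge (k : nat) x b :
  (forall y, b <= f y + k%:R * `|x - y|) -> b <= infconv k x.
Proof.
move=> H; apply: lb_le_inf; first by case: (hinf k x).
by move=> _ [y _ <-].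
Qed.

Lemma infconv_le_self (k : nat) x : infconv k x <= f x.
Proof. by have := infconv_le k x x; rewrite subrr normr0 mulr0 addr0. Qed.

Lemma infconv_lipschitz (k : nat) : lipschitz_bounded (infconv k) k%:R M.
Proof.
have key x y : infconv k x - k%:R * `|x - y| <= infconv k y.
  apply: infconv_ge => z; have := infconv_le k x z.
  have : k%:R * `|x - z| <= k%:R * (`|x - y| + `|y - z|).
    by rewrite ler_wpM2l// ler_distD.
  by rewrite mulrDr; lra.
split=> [x y|x].
  rewrite ler_norml; have := key x y; have := key y x; rewrite (distrC y x).
  by move=> *; apply/andP; split; lra.
rewrite ler_norml infconv_ge//= (le_trans (infconv_le_self k x))//.
by rewrite (le_trans (ler_norm _)).
Qed.

Lemma infconv_cvg x : infconv k x @[k --> \oo] --> f x.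
Proof.
apply/cvgrPdist_le => e e0.
have [dl dl0 H] : exists2 dl : R, 0 < dl & forall y, `|x - y| < dl -> `|f x - f y| <= e.
  have /cvgrPdist_le /(_ e e0) := fc (x := x).
  by move=> /nbhs_ballP [dl /= dl0 H]; exists dl => // y xy; apply: H.
near=> k.
rewrite ger0_norm ?subr_ge0 ?infconv_le_self// lerBlDr -lerBlDl.
apply: infconv_ge => y; have [xy|xy] := ltP `|x - y| dl.
  have := H y xy; rewrite ler_norml => /andP[h1 h2].
  have : 0 <= k%:R * `|x - y| by rewrite mulr_ge0.
  by lra.
(* Beyond distance [dl] the penalty is at least 2 M, a bound on the oscillation of [f]. *)
have kd : 2 * M <= k%:R * dl.
  rewrite -ler_pdivrMr//; near: k; exact: nbhs_infty_ger.
have := fM x; have := fM y; rewrite !ler_norml => /andP[a1 a2] /andP[a3 a4].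
have : k%:R * dl <= k%:R * `|x - y| by rewrite ler_wpM2l.
lra.
Unshelve. all: by end_near. Qed.

Lemma lip_cvg_liminf Y (v e : R) : (forall n, measurable_fun setT (Y n)) ->
  lip_cvg Y v -> 0 < e ->
  \forall n \near \oo,
    \int[normal_prob 0 (Num.sqrt v)]_x f x - e <= \int[P]_w f (Y n w).
Proof.
move=> mY lY e0; set N := normal_prob 0 (Num.sqrt v).
have mf : measurable_fun [set: measurableTypeR R] f.
  exact: continuous_measurable_fun.
have mk k : measurable_fun [set: measurableTypeR R] (infconv k).
  exact: lipschitz_measurable (infconv_lipschitz k).
have ck : \int[N]_x infconv k x @[k --> \oo] --> \int[N]_x f x.
  apply: (@Rintegral_cvg R _ (measurableTypeR R) N infconv f (cst M)).
  - exact: mk.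
  - exact: infconv_cvg.
  - apply: measurable_bounded_integrable => //.
      by rewrite (le_lt_trans (probability_le1 _ _))// ltry.
    exists `|M|; split; first exact: num_real.
    by move=> y My x _; exact: ltW.
  - by move=> k x; case: (infconv_lipschitz k).
have e20 : 0 < e / 2 by lra.
move/cvgrPdist_le: ck => /(_ _ e20) [k _ /(_ k (leqnn k))] hk.
have /cvgrPdist_le /(_ _ e20) := lY _ _ _ (infconv_lipschitz k).
apply: filterS => n hn.
have : \int[P]_w infconv k (Y n w) <= \int[P]_w f (Y n w).
  apply: le_Rintegral => //.
  - apply: (@integrable_bounded _ M).
      exact: (measurableT_comp (mk k) (mY n)).
    by move=> w; case: (infconv_lipschitz k).
  - apply: (@integrable_bounded _ M) => //.
    exact: (measurableT_comp mf (mY n)).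
  - by move=> w _; exact: infconv_le_self.
move: hk hn; rewrite -/N; set b := \int[N]_x infconv k x.
set b' := \int[P]_w infconv k _; set a := \int[N]_x f x.
set a' := \int[P]_w f _; rewrite !ler_norml => /andP[? ?] /andP[? ?] ?; lra.
Qed.

End InfConvolution.

Lemma lip_cvg_weak Y (v : R) : (forall n, measurable_fun setT (Y n)) ->
  lip_cvg Y v -> weak_cvg_normal P Y v.
Proof.
move=> mY lY f fc [M fM].
have mf : measurable_fun [set: measurableTypeR R] f.
  exact: continuous_measurable_fun.
set N := normal_prob 0 (Num.sqrt v).
have iN : N.-integrable setT (EFin \o f).
  apply: measurable_bounded_integrable => //.
    by rewrite (le_lt_trans (probability_le1 _ _))// ltry.
  exists M; split; first exact: num_real.
  by move=> y My x _; apply: le_trans (fM x) (ltW My).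
have iP n : P.-integrable setT (EFin \o (f \o Y n)).
  apply: (@integrable_bounded _ M); first exact: (measurableT_comp mf (mY n)).
  by move=> w /=.
have -> : (\int[N]_x (f x)%:E)%E = (\int[N]_x f x)%:E.
  by rewrite /Rintegral fineK//; exact: integrable_fin_num.
have -> : (fun n => 'E_P[f \o Y n])%E = (fun n => (\int[P]_w f (Y n w))%:E).
  apply/funext => n; rewrite unlock /Rintegral fineK//.
  exact: (integrable_fin_num measurableT (iP n)).
apply: cvg_EFin; first by near=> n.
rewrite /comp /=; apply/cvgrPdist_le => e e0.
have h1 := lip_cvg_liminf fc fM mY lY e0.
have gc : continuous (fun x => - f x) by move=> x; apply: cvgN; exact: fc.
have gM x : `|- f x| <= M by rewrite normrN.
have h2 := lip_cvg_liminf gc gM mY lY e0.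
have eN : \int[N]_x (- f x) = - \int[N]_x f x.
  have := @RintegralZl _ _ _ N setT f (-1) measurableT iN.
  by under eq_Rintegral do rewrite mulN1r; rewrite mulN1r.
have eP n : \int[P]_w (- f (Y n w)) = - \int[P]_w f (Y n w).
  have := @RintegralZl _ _ _ P setT (f \o Y n) (-1) measurableT (iP n).
  by under eq_Rintegral do rewrite mulN1r; rewrite mulN1r.
near=> n.
have n1 : \int[N]_x f x - e <= \int[P]_w f (Y n w) by near: n.
have n2 : \int[N]_x (- f x) - e <= \int[P]_w (- f (Y n w)) by near: n.
rewrite eN eP in n2; rewrite ler_norml; move: n1 n2.
set a := \int[N]_x f x; set b := \int[P]_w f _.
by move=> n1 n2; apply/andP; split; lra.
Unshelve. all: by end_near. Qed.

(** The bad event may be any measurable set, which lets the estimators below use a union of two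
    explicit events. *)
Lemma lip_cvg_slutsky Y Z (v : R) :
  (forall n, measurable_fun setT (Y n)) -> (forall n, measurable_fun setT (Z n)) ->
  (forall e eta : R, 0 < e -> 0 < eta -> \forall n \near \oo, exists A : set T,
    [/\ measurable A, (P A <= eta%:E)%E &
      forall w, ~ A w -> `|Z n w - Y n w| <= e]) ->
  lip_cvg Y v -> lip_cvg Z v.
Proof.
move=> mY mZ YZ lY f L M fLM.
have [L0 M0] := lipschitz_bounded_ge0 fLM; have [fL fM] := fLM.
have mf := lipschitz_measurable fLM.
apply/cvgrPdist_le => e e0.
have e30 : 0 < e / 2 by lra.
have /cvgrPdist_le /(_ _ e30) h1 := lY f L M fLM.
(* The shifts by one cover L = 0 and M = 0. *)
pose a := e / 4 / (L + 1); pose b := e / 8 / (M + 1).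
have a0 : 0 < a by rewrite !divr_gt0// ltr_wpDl.
have b0 : 0 < b by rewrite !divr_gt0// ltr_wpDl.
have h2 := YZ _ _ a0 b0.
near=> n.
have n1 : `|\int[normal_prob 0 (Num.sqrt v)]_x f x - \int[P]_w f (Y n w)| <= e / 2.
  by near: n.
have [A [mA PA HA]] : exists A : set T, [/\ measurable A, (P A <= b%:E)%E &
      forall w, ~ A w -> `|Z n w - Y n w| <= a] by near: n.
have La : L * a <= e / 4.
  by rewrite /a mulrCA ler_piMr ?ler_pdivrMr ?ltr_wpDl//; lra.
have Mb : 2 * M * fine (P A) <= e / 4.
  have PA2 : fine (P A) <= b.
    by rewrite -lee_fin fineK// fin_num_measure.
  apply: le_trans (_ : 2 * M * b <= _); first by rewrite ler_wpM2l// mulr_ge0.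
  have : M * b <= e / 8.
    by rewrite /b mulrCA ler_piMr ?ler_pdivrMr ?ltr_wpDl//; lra.
  lra.
have := @Rintegral_dist_le (fun w => f (Z n w)) (fun w => f (Y n w)) A M (L * a).
move=> /(_ (measurableT_comp mf (mZ n)) (measurableT_comp mf (mY n)) mA).
move=> /(_ (fun w => fM _) (fun w => fM _) (mulr_ge0 L0 (ltW a0))).
have H w : ~ A w -> `|f (Z n w) - f (Y n w)| <= L * a.
  move=> Aw; apply: le_trans (fL _ _) _; rewrite ler_wpM2l//.
  exact: HA.
move=> /(_ H).
move: n1 Mb; set i1 := \int[normal_prob _ _]_x f x; set i2 := \int[P]_w f (Y n w).
set i3 := \int[P]_w f (Z n w); set pA := 2 * M * _.
rewrite !ler_norml => /andP[? ?] Mb /andP[? ?].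
by apply/andP; split; lra.
Unshelve. all: by end_near. Qed.

Lemma lip_cvg_tight Y (v eta : R) : (forall n, measurable_fun setT (Y n)) ->
  lip_cvg Y v -> 0 < eta ->
  exists2 B : R, 0 < B &
    \forall n \near \oo, (P [set w | (B < `|Y n w|)%R] <= eta%:E)%E.
Proof.
move=> mY lY eta0; set N := normal_prob 0 (Num.sqrt v).
(* A Lipschitz ramp from 0 at |x| = m to 1 at |x| = m + 1. It dominates the indicator of |x| > m +
   1, whence the witness [m.+1]. *)
pose f (m : nat) (x : R) : R := Num.min 1 (Num.max 0 (`|x| - m%:R)).
have fLM m : lipschitz_bounded (f m) 1 1.
  split=> [x y|x]; last first.
    rewrite ger0_norm /f; first by rewrite ge_min lexx.
    by rewrite le_min ler01 le_max lexx.
  have key a b : f m a <= f m b + `|a - b|.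
    have := lerB_dist a b => h; have h0 := normr_ge0 (a - b).
    rewrite /f addr_minl addr_maxl le_min !ge_min !ge_max !le_max.
    have -> : 1 <= 1 + `|a - b| by lra.
    have -> : 0 <= 0 + `|a - b| by lra.
    have -> : `|a| - m%:R <= `|b| - m%:R + `|a - b| by lra.
    by rewrite orbT orTb orbT.
  rewrite mul1r ler_norml; have := key x y; have := key y x.
  by rewrite (distrC y x) => *; apply/andP; split; lra.
have c : \int[N]_x f m x @[m --> \oo] --> (0 : R).
  have := @Rintegral_cvg R _ (measurableTypeR R) N f (fun=> 0) (fun=> 1).
  rewrite Rintegral_cst// mul0r; apply.
  - by move=> m; exact: lipschitz_measurable (fLM m).
  - move=> x; apply: cvg_near_cst; near=> m.
    have xm : `|x| <= m%:R by near: m; exact: nbhs_infty_ger.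
    by rewrite /f max_l ?subr_le0// min_r.
  - apply: measurable_bounded_integrable => //.
      by rewrite (le_lt_trans (probability_le1 _ _))// ltry.
    exists 1; split; first exact: num_real.
    by move=> y My x _; rewrite normr1 ltW.
  - by move=> m x; case: (fLM m) => _; apply.
have e20 : 0 < eta / 2 by lra.
move/cvgrPdist_le: c => /(_ _ e20) [m _ /(_ m (leqnn m))] hm.
exists m.+1%:R; first by rewrite ltr0n.
have /cvgrPdist_le /(_ _ e20) := lY _ _ _ (fLM m).
apply: filterS => n hn.
have mA : measurable [set w | m.+1%:R < `|Y n w|].
  rewrite (_ : [set w | _] = (fun w => `|Y n w|) @^-1` `]m.+1%:R, +oo[).
    have mm : measurable_fun setT (fun w => `|Y n w|) by exact: measurableT_comp.
    by have := mm measurableT _ (measurable_itv `]m.+1%:R, +oo[); rewrite setTI.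
  by apply/seteqP; split=> w /=; rewrite in_itv/= andbT.
rewrite -[P _]fineK ?fin_num_measure// lee_fin.
have : fine (P [set w | m.+1%:R < `|Y n w|]) <= \int[P]_w f m (Y n w).
  have -> : fine (P [set w | m.+1%:R < `|Y n w|]) =
     \int[P]_w (\1_[set w | m.+1%:R < `|Y n w|] w).
    by rewrite /Rintegral integral_indic// setIT.
  apply: le_Rintegral => //.
  - apply: (@integrable_bounded _ 1); first exact: measurable_indic.
    by move=> x; rewrite indicE; case: (_ \in _); rewrite ?normr1 ?normr0 ?ler01.
  - apply: (@integrable_bounded _ 1).
      exact: (measurableT_comp (lipschitz_measurable (fLM m)) (mY n)).
    by move=> w; case: (fLM m).
  - move=> w _; rewrite indicE; case: (boolP (_ \in _)) => /=.
      rewrite inE/= /f => h; rewrite le_min lexx/= le_max; apply/orP; right.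
      by move: h; rewrite -natr1; lra.
    by move=> _; rewrite le_min ler01 le_max lexx.
move: hm hn; rewrite -/N; set b := \int[N]_x f m x.
set b' := \int[P]_w f m _; set a := fine _.
rewrite !ler_norml => /andP[? ?] /andP[? ?] ?; lra.
Unshelve. all: by end_near. Qed.

End WeakConvergence.

(** * Random allocations and Poissonization *)

Section Allocation.
Context {R : realType} {I : finType} (q : I -> R).
Implicit Types (F G : seq I -> R) (s t : seq I).

(* [Ex m F] is the expectation of [F] at the list of the urns of [m]
   independent balls. *)
Fixpoint Ex (m : nat) F : R :=
  if m is m'.+1 then \sum_i q i * Ex m' (fun s => F (i :: s)) else F [::].

Lemma eq_Ex m F G : (forall s, size s = m -> F s = G s) -> Ex m F = Ex m G.
Proof.
elim: m F G => [|m IH] F G FG /=; first exact: FG.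
by apply: eq_bigr => i _; congr (_ * _); apply: IH => s sm; apply: FG; rewrite /= sm.
Qed.

Lemma ExD m F G : Ex m (fun s => F s + G s) = Ex m F + Ex m G.
Proof.
elim: m F G => [//|m IH] F G /=.
by rewrite -big_split/=; apply: eq_bigr => i _; rewrite IH mulrDr.
Qed.

Lemma ExZ m a F : Ex m (fun s => a * F s) = a * Ex m F.
Proof.
elim: m F => [//|m IH] F /=.
by rewrite big_distrr/=; apply: eq_bigr => i _; rewrite IH mulrCA.
Qed.

Lemma ExB m F G : Ex m (fun s => F s - G s) = Ex m F - Ex m G.
Proof.
rewrite -[in RHS](mulN1r (Ex m G)) -ExZ -ExD.
by apply: eq_Ex => s _; rewrite mulN1r.
Qed.

Lemma Ex_sum m (J : Type) (r : seq J) (Q : pred J) (F : J -> seq I -> R) :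
  Ex m (fun s => \sum_(j <- r | Q j) F j s) = \sum_(j <- r | Q j) Ex m (F j).
Proof.
elim: m F => [//|m IH] F /=.
rewrite exchange_big/=; apply: eq_bigr => i _; rewrite IH big_distrr//.
Qed.

Lemma Ex_cat l r F : Ex (l + r) F = Ex l (fun s => Ex r (fun t => F (s ++ t))).
Proof.
by elim: l F => [//|l IH] F /=; apply: eq_bigr => i _; rewrite IH.
Qed.

Hypothesis q0 : forall i, 0 <= q i.
Hypothesis q1 : \sum_i q i = 1.

Lemma le_Ex m F G : (forall s, size s = m -> F s <= G s) -> Ex m F <= Ex m G.
Proof.
elim: m F G => [|m IH] F G FG /=; first exact: FG.
apply: ler_sum => i _; apply: ler_wpM2l => //; apply: IH => s sm.
by apply: FG; rewrite /= sm.
Qed.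

Lemma Ex_cst m a : Ex m (fun=> a) = a.
Proof.
elim: m => [//|m IH] /=.
by under eq_bigr do rewrite IH; rewrite -big_distrl/= q1 mul1r.
Qed.

Lemma le_norm_Ex m F : `|Ex m F| <= Ex m (fun s => `|F s|).
Proof.
rewrite ler_norml; apply/andP; split; last by apply: le_Ex => s _; exact: ler_norm.
rewrite -mulN1r -ExZ; apply: le_Ex => s _; rewrite mulN1r.
by have := ler_norm (- F s); rewrite normrN; lra.
Qed.

Lemma Ex_prod m (f : I -> R) :
  Ex m (fun s => \prod_(x <- s) f x) = (\sum_i q i * f i) ^+ m.
Proof.
elim: m => [|m IH] /=; first by rewrite big_nil expr0.
rewrite exprS -IH big_distrl/=; apply: eq_bigr => i _.
rewrite -mulrA; congr (_ * _); rewrite -ExZ; apply: eq_Ex => s _.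
by rewrite big_cons.
Qed.

Definition cnt i s := count_mem i s.

Section ProductFormula.
Implicit Types (g : I -> nat -> R) (N : I -> nat).

(** The exponential generating function of the weights of urn [i], cut off at degree [n] to stay a
    polynomial. Multinomial expectations are coefficients of products of these. *)
Definition egf (n : nat) g i : {poly R} :=
  \poly_(a < n.+1) (q i ^+ a / a`!%:R * g i a).

Definition shift i0 g := fun i a => g i ((i0 == i) + a)%N.

Lemma deriv_prod_seq (r : seq I) (p : I -> {poly R}) : uniq r ->
  (\prod_(i <- r) p i)^`() =
  \sum_(i <- r) (p i)^`() * \prod_(j <- r | j != i) p j.
Proof.
elim: r => [_|i0 r IH /= /andP[i0r ur]]; first by rewrite !big_nil derivC.
rewrite !big_cons derivM IH// eqxx/=; congr (_ * _ + _).
  rewrite big_seq [RHS]big_seq_cond; apply: eq_bigl => j.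
  by case: (boolP (j \in r)) => //= jr; apply/esym; apply: contraNN i0r => /eqP <-.
rewrite big_distrr/= big_seq [RHS]big_seq; apply: eq_bigr => i ir.
rewrite big_cons; have -> : i0 != i by apply: contraNN i0r => /eqP ->.
by rewrite mulrCA.
Qed.

Lemma deriv_egf n g i : (egf n.+1 g i)^`() = q i *: egf n (shift i g) i.
Proof.
apply/polyP => a; rewrite coef_deriv coefZ !coef_poly ltnS.
case: ifP => _; last by rewrite mul0rn mulr0.
rewrite /shift eqxx add1n -[LHS]mulr_natr factS exprS natrM.
have a1 : a.+1%:R != 0 :> R by rewrite pnatr_eq0.
have af : a`!%:R != 0 :> R by rewrite pnatr_eq0 -lt0n fact_gt0.
by field; rewrite nat1r a1 af.
Qed.

(** The first ball on the left corresponds to a derivative on the right: [m.+1] times a coefficient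
    is a coefficient of the derivative, and differentiating the factor of urn [i] shifts its weights
    by one ball. This lowers the cutoff of that factor alone, hence a separate cutoff [N i] for each
    urn. *)
Lemma Ex_prod_cnt m g N : (forall i, (m <= N i)%N) ->
  Ex m (fun s => \prod_i g i (cnt i s)) =
  m`!%:R * (\prod_i egf (N i) g i)`_m.
Proof.
elim: m g N => [|m IH] g N mN /=.
  rewrite fact0 mul1r -horner_coef0 horner_prod; apply: eq_bigr => i _.
  by rewrite horner_coef0 coef_poly /= expr0 fact0 invr1 !mul1r.
rewrite factS mulnC natrM -mulrA [m.+1%:R * _]mulr_natl -coef_deriv.
rewrite deriv_prod_seq ?index_enum_uniq// coef_sum big_distrr/=.
apply: eq_bigr => i _.
pose N' j := if j == i then (N i).-1 else N j.
transitivity (q i * Ex m (fun s => \prod_j (shift i g) j (cnt j s))).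
  by congr (_ * _); apply: eq_Ex => s _.
rewrite (IH _ N'); last first.
  move=> j; rewrite /N'; case: eqP => _; last exact: ltnW.
  by have := mN i; case: (N i).
rewrite mulrCA; congr (_ * _).
have -> : egf (N i) g i = egf (N i).-1.+1 g i.
  by have := mN i; case: (N i).
rewrite deriv_egf -scalerAl coefZ; congr (_ * _).
apply: (congr1 (fun p : {poly R} => p`_m)).
rewrite [LHS](bigD1 i)//=; congr GRing.mul; first by rewrite /N' eqxx.
apply: eq_bigr => j ji; rewrite /N' (negbTE ji); apply/polyP => a; rewrite !coef_poly.
by rewrite /shift eq_sym (negbTE ji).
Qed.

Definition pois (x : R) (a : nat) : R := expR (- x) * (x ^+ a / a`!%:R).

Lemma pois_ge0 x a : 0 <= x -> 0 <= pois x a.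
Proof. by move=> x0; rewrite mulr_ge0 ?expR_ge0// divr_ge0// exprn_ge0. Qed.

Lemma sum_pois_cvg x : \sum_(a < M) pois x a @[M --> \oo] --> (1 : R).
Proof.
have c := @is_cvg_series_exp_coeff R x.
have : expR (- x) * series (exp_coeff x) M @[M --> \oo] --> expR (- x) * expR x.
  by apply: cvgMr; exact: c.
rewrite -expRD addNr expR0; apply: cvg_trans; apply: near_eq_cvg; near=> M.
rewrite /series/= big_mkord big_distrr/=; apply: eq_bigr => a _.
by rewrite /pois exp_coeffE [_^-1 * _]mulrC.
Unshelve. all: by end_near. Qed.

Lemma coef_norm_prod (J : Type) (r : seq J) (p p' : J -> {poly R}) :
  (forall j a, `|(p j)`_a| <= (p' j)`_a) ->
  forall a, `|(\prod_(j <- r) p j)`_a| <= (\prod_(j <- r) p' j)`_a.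
Proof.
move=> pp'; elim: r => [|j r IH] a.
  by rewrite !big_nil coef1; case: eqP => _; rewrite ?normr1 ?normr0.
rewrite !big_cons !coefM; apply: le_trans (ler_norm_sum _ _ _) _.
by apply: ler_sum => i _; rewrite normrM ler_pM.
Qed.

Lemma cvg_prod_seq (J : Type) (r : seq J) (u : J -> nat -> R) (l : J -> R) :
  (forall j, u j @ \oo --> l j) ->
  \prod_(j <- r) u j n @[n --> \oo] --> \prod_(j <- r) l j.
Proof.
move=> ul; elim: r => [|j r IH].
  by under eq_fun do rewrite big_nil; rewrite big_nil; exact: cvg_cst.
by under eq_fun do rewrite big_cons; rewrite big_cons; exact: cvgM.
Qed.

(* Both sides have the same Taylor coefficients of degree less than [M]; the
   remaining ones are dominated by those obtained for [g = 1], which sum to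
   the tail of the exponential series. *)
Lemma poissonized_prod (x : R) g (e : I -> R) : 0 <= x ->
  (forall i a, `|g i a| <= 1) ->
  (forall i, \sum_(a < M) pois (x * q i) a * g i a @[M --> \oo] --> e i) ->
  \sum_(m < M) pois x m * Ex m (fun s => \prod_i g i (cnt i s)) @[M --> \oo] -->
  \prod_i e i.
Proof.
move=> x0 g1 ge; have FF : Filter (\oo : set_system nat) by exact _.
pose H g M : {poly R} := \prod_i egf M g i.
have hornerH g' M : expR (- x) * (H g' M).[x] =
    \prod_i \sum_(a < M.+1) pois (x * q i) a * g' i a.
  have -> : - x = \sum_i - (x * q i) by rewrite sumrN -big_distrr/= q1 mulr1.
  rewrite expR_sum.
  rewrite horner_prod -big_split/=; apply: eq_bigr => i _.
  rewrite horner_poly big_distrr/=; apply: eq_bigr => a _.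
  by rewrite /pois exprMn; ring.
have coefH g' M m : (m <= M)%N ->
    pois x m * Ex m (fun s => \prod_i g' i (cnt i s)) =
    expR (- x) * ((H g' M)`_m * x ^+ m).
  move=> mM; rewrite (@Ex_prod_cnt m g' (fun=> M))// /pois -/(H g' M).
  have mf : m`!%:R != 0 :> R by rewrite pnatr_eq0 -lt0n fact_gt0.
  by field.
pose h1 : I -> nat -> R := fun _ _ => 1.
(* Up to degree [M] the coefficients are exact; above it the cutoff spoils them, and only their
   domination by those of [h1] is used. *)
have splitH g' M : expR (- x) * (H g' M).[x] =
    \sum_(m < M.+1) pois x m * Ex m (fun s => \prod_i g' i (cnt i s)) +
    \sum_(M.+1 <= m < maxn M.+1 (size (H g' M))) expR (- x) * ((H g' M)`_m * x ^+ m).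
  rewrite (@horner_coef_wide _ (maxn M.+1 (size (H g' M)))) ?leq_maxr//.
  rewrite big_distrr/= -(big_mkord xpredT (fun i => expR (- x) * ((H g' M)`_i * x ^+ i))).
  rewrite (@big_cat_nat _ _ _ M.+1) ?leq_maxl//=; congr (_ + _).
  rewrite big_mkord; apply: eq_bigr => m _; rewrite (coefH _ M)//.
  by rewrite -ltnS.
have normH M m : `|(H g M)`_m| <= (H h1 M)`_m.
  apply: coef_norm_prod => i a; rewrite !coef_poly; case: ifP => _; rewrite ?normr0//.
  rewrite normrM mulr1 -[leRHS]mulr1 ger0_norm ?divr_ge0 ?exprn_ge0//.
  by rewrite ler_wpM2l ?divr_ge0 ?exprn_ge0.
have key M : `|expR (- x) * (H g M).[x] -
   \sum_(m < M.+1) pois x m * Ex m (fun s => \prod_i g i (cnt i s))| <=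
   expR (- x) * (H h1 M).[x] - \sum_(m < M.+1) pois x m.
  rewrite !splitH addrAC subrr add0r.
  have -> : \sum_(m < M.+1) pois x m * Ex m (fun s => \prod_i h1 i (cnt i s)) =
     \sum_(m < M.+1) pois x m.
    apply: eq_bigr => m _; transitivity (pois x m * Ex m (fun=> 1)).
      by congr (_ * _); apply: eq_Ex => s _; rewrite big1.
    by rewrite Ex_cst mulr1.
  rewrite [X in _ <= X]addrAC subrr add0r.
  apply: le_trans (ler_norm_sum _ _ _) _.
  have sz : (size (H g M) <= maxn M.+1 (size (H h1 M)))%N.
    apply/leq_sizeP => j jm; apply/eqP; rewrite -normr_le0.
    apply: le_trans (normH M j) _; rewrite nth_default//.
    by apply: leq_trans jm; rewrite leq_maxr.
  apply: (@le_trans _ _ (\sum_(M.+1 <= m < maxn M.+1 (size (H h1 M)))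
    `|expR (- x) * ((H g M)`_m * x ^+ m)|)).
    rewrite [X in _ <= X](@big_cat_nat _ _ _ (maxn M.+1 (size (H g M)))) ?leq_maxl//=.
      by rewrite lerDl sumr_ge0.
    by rewrite geq_max leq_maxl.
  apply: ler_sum => m _; rewrite !normrM (ger0_norm (expR_ge0 _)).
  rewrite ler_wpM2l ?expR_ge0// normrX (ger0_norm x0) ler_wpM2r ?exprn_ge0//.
have lim1 g' (e' : I -> R) : (forall i, \sum_(a < M) pois (x * q i) a * g' i a @[M --> \oo] --> e' i) ->
    expR (- x) * (H g' M).[x] @[M --> \oo] --> \prod_i e' i.
  move=> ge'; under eq_fun do rewrite hornerH.
  apply: cvg_prod_seq => i; have := ge' i.
  by rewrite -(cvg_shiftS (fun M => \sum_(a < M) pois (x * q i) a * g' i a)).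
have L1 := lim1 g e ge.
have L2 : expR (- x) * (H h1 M).[x] @[M --> \oo] --> (1 : R).
  have -> : 1 = \prod_(i : I) (1 : R) by rewrite big1.
  apply: lim1 => i; under eq_fun do under eq_bigr do rewrite mulr1.
  exact: sum_pois_cvg.
have L3 : \sum_(m < M.+1) pois x m @[M --> \oo] --> (1 : R).
  by have := @sum_pois_cvg x; rewrite -(cvg_shiftS (fun M => \sum_(a < M) pois x a)).
rewrite -(cvg_shiftS (fun M => \sum_(m < M) _)).
have L4 : expR (- x) * (H g M).[x] -
   \sum_(m < M.+1) pois x m * Ex m (fun s => \prod_i g i (cnt i s)) @[M --> \oo] --> (0 : R).
  have L5 := @cvgB R R nat \oo FF _ _ _ _ L2 L3; rewrite subrr in L5.
  apply/cvgrPdist_le => eps eps0; move/cvgrPdist_le: L5 => /(_ eps eps0).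
  apply: filterS => M; rewrite !sub0r !normrN => L5.
  by apply: le_trans (key M) _; apply: le_trans (ler_norm _) L5.
have L5 := @cvgB R R nat \oo FF _ _ _ _ L1 L4; rewrite subr0 in L5.
apply: cvg_trans L5; apply: near_eq_cvg; near=> M.
by rewrite fctE opprB addrC subrK.
Unshelve. all: by end_near. Qed.

End ProductFormula.
End Allocation.

(** * Poisson moments *)

Section PoissonMoments.
Context {R : realType}.
Implicit Types x : R.

Lemma poisS x a : pois x a.+1 * a.+1%:R = x * pois x a.
Proof.
rewrite /pois factS exprS natrM.
have a1 : a.+1%:R != 0 :> R by rewrite pnatr_eq0.
have af : a`!%:R != 0 :> R by rewrite pnatr_eq0 -lt0n fact_gt0.
by field; rewrite nat1r a1 af.
Qed.

Lemma sum_pois_le1 x M : 0 <= x -> \sum_(a < M) pois x a <= 1.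
Proof.
move=> x0; have c := @sum_pois_cvg R x.
have nd : {homo (fun M : nat => \sum_(a < M) pois x a) : n m / (n <= m)%N >-> n <= m}.
  apply/nondecreasing_seqP => n; rewrite big_ord_recr/= lerDl.
  exact: pois_ge0.
have := @nondecreasing_cvgn_le R _ nd; rewrite (cvg_lim _ c)//.
by move=> /(_ c).
Qed.

(** An exact formula for partial sums, which telescopes by [poisS]. The boundary term has a
    favourable sign as soon as M >= x, so the variance bound needs no passage to the limit. *)
Lemma pois_second_moment x M :
  \sum_(a < M.+1) pois x a * (a%:R - x) ^+ 2 =
  x * \sum_(a < M) pois x a - x * (M%:R - x) * pois x M.
Proof.
elim: M => [|M IH].
  rewrite big_ord_recl !big_ord0 /= !sub0r addr0; ring.
rewrite big_ord_recr/= IH big_ord_recr/=.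
have := poisS x M; rewrite -natr1 => e.
apply/eqP; rewrite -subr_eq0; apply/eqP.
transitivity ((M%:R + 1 - x) * (pois x M.+1 * (M%:R + 1) - x * pois x M)).
  by ring.
by rewrite e subrr mulr0.
Qed.

Lemma pois_second_moment_le x M : 0 <= x ->
  \sum_(a < M) pois x a * (a%:R - x) ^+ 2 <= x.
Proof.
move=> x0; set u := fun M : nat => \sum_(a < M) pois x a * (a%:R - x) ^+ 2.
have nd : {homo u : n m / (n <= m)%N >-> n <= m}.
  apply/nondecreasing_seqP => n; rewrite /u big_ord_recr/= lerDl.
  by rewrite mulr_ge0 ?pois_ge0 ?sqr_ge0.
have [N xN] : exists N : nat, x <= N%:R.
  by have [N _ /(_ N (leqnn N))] := @nbhs_infty_ger R x; exists N.
(* All terms are nonnegative, so the sum may be prolonged until the boundary term has the right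
   sign. *)
apply: le_trans (nd M (maxn M N).+1 _) _; first by rewrite ltnW// ltnS leq_maxl.
rewrite /u pois_second_moment lerBlDr.
apply: le_trans (_ : x * 1 <= _); first by rewrite ler_wpM2l ?sum_pois_le1.
rewrite mulr1 lerDl; apply: mulr_ge0; last exact: pois_ge0.
apply: mulr_ge0 => //; rewrite subr_ge0.
by apply: le_trans xN _; rewrite ler_nat leq_maxr.
Qed.

End PoissonMoments.

(** * The statistic under Poissonization *)

Section PoissonizedStatistic.
Context {R : realType} {I : finType} (q : I -> R).
Hypothesis q0 : forall i, 0 <= q i.
Hypothesis q1 : \sum_i q i = 1.
Variable h : I -> nat -> bool.
Implicit Types (F : seq I -> R) (s t : seq I).

Definition stat (s : seq I) : nat := (\sum_i h i (cnt i s))%N.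

Variables (x : R) (e : I -> R).
Hypothesis x0 : 0 <= x.
Hypothesis he : forall i,
  \sum_(a < M) pois (x * q i) a * (h i a)%:R @[M --> \oo] --> e i.

(** Urns are moved one at a time from the argument of [f] to the product. Splitting on the value of
    [h j] turns urn [j] into an indicator factor, and the two cases recombine through the recursion
    of [bern]. The weights [g] are arbitrary so that these indicators can enter the induction
    hypothesis. *)
Lemma poissonized_partial (r : seq I) (f : R -> R) (y : R) (g : I -> nat -> R) (l : I -> R) :
  uniq r -> (forall i a, `|g i a| <= 1) ->
  (forall i, \sum_(a < M) pois (x * q i) a * g i a @[M --> \oo] --> l i) ->
  \sum_(m < M) pois x m * Ex q m (fun s =>
    f (y + \sum_(i <- r) (h i (cnt i s))%:R) *
    \prod_(i | i \notin r) g i (cnt i s)) @[M --> \oo] -->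
  bern (map e r) f y * \prod_(i | i \notin r) l i.
Proof.
have FF : Filter (\oo : set_system nat) by exact _.
elim: r f y g l => [|j r IH] f y g l.
  move=> _ g1 gl; under eq_fun => M do under eq_bigr => m _ do
    under eq_Ex => s _ do rewrite big_nil addr0.
  have c := poissonized_prod q0 q1 x0 g1 gl.
  have -> : (fun M => \sum_(m < M) pois x m * Ex q m (fun s => f y * \prod_(i | i \notin [::]) g i (cnt i s))) =
     (fun M => f y * \sum_(m < M) pois x m * Ex q m (fun s => \prod_i g i (cnt i s))).
    apply/funext => M; rewrite big_distrr/=; apply: eq_bigr => m _.
    by rewrite ExZ mulrCA.
  exact: cvgMr.
move=> /= /andP[jr ur] g1 gl.
pose gb (b : bool) i a : R := if i == j then (h j a == b)%:R else g i a.
pose lb (b : bool) i : R := if i == j then (if b then e j else 1 - e j) else l i.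
have gb1 b i a : `|gb b i a| <= 1.
  by rewrite /gb; case: eqP => // _; case: eqP; rewrite ?normr1 ?normr0.
have gbl b i : \sum_(a < M) pois (x * q i) a * gb b i a @[M --> \oo] --> lb b i.
  rewrite /gb /lb; case: eqP => [->|_]; last exact: gl.
  case: b.
    have := @he j; apply: cvg_trans; apply: near_eq_cvg; near=> M.
    by apply: eq_bigr => a _; case: (h j a).
  apply: cvg_trans (@cvgB R R nat \oo FF _ _ _ _ (@sum_pois_cvg R (x * q j)) (@he j)).
  apply: near_eq_cvg; near=> M; rewrite fctE -sumrB; apply: eq_bigr => a _.
  by case: (h j a) => /=; ring.
have c1 := IH f y _ _ ur (gb1 false) (gbl false).
have c2 := IH f (y + 1) _ _ ur (gb1 true) (gbl true).
have prE (G : I -> R) (v : R) :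
    \prod_(i | i \notin r) (if i == j then v else G i) =
    v * \prod_(i | i \notin j :: r) G i.
  rewrite (bigD1 j)//= eqxx; congr (_ * _).
  have -> : \prod_(i | (i \notin r) && (i != j)) (if i == j then v else G i) =
     \prod_(i | (i \notin r) && (i != j)) G i.
    by apply: eq_bigr => i /andP[_ /negbTE ->].
  by apply: eq_bigl => i; rewrite inE negb_or andbC.
suff : \sum_(m < M) pois x m * Ex q m (fun s =>
    f (y + \sum_(i <- j :: r) (h i (cnt i s))%:R) *
    \prod_(i | i \notin j :: r) g i (cnt i s)) @[M --> \oo] -->
    bern (map e r) f y * \prod_(i | i \notin r) lb false i +
    bern (map e r) f (y + 1) * \prod_(i | i \notin r) lb true i.
  rewrite /lb !prE => c.
  have -> : bern (map e (j :: r)) f y * \prod_(i | i \notin j :: r) l i =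
    bern (map e r) f y * ((1 - e j) * \prod_(i | i \notin j :: r) l i) +
    bern (map e r) f (y + 1) * (e j * \prod_(i | i \notin j :: r) l i).
    by rewrite /=; ring.
  exact: c.
apply: cvg_trans (@cvgD R R nat \oo FF _ _ _ _ c1 c2).
apply: near_eq_cvg; near=> M.
rewrite fctE -big_split/=; apply: eq_bigr => m _; rewrite -mulrDr -ExD.
congr (_ * _); apply: eq_Ex => s _.
have gE b : \prod_(i | i \notin r) gb b i (cnt i s) =
    (h j (cnt j s) == b)%:R * \prod_(i | i \notin j :: r) g i (cnt i s).
  rewrite -prE//; apply: eq_bigr => i _; rewrite /gb.
  by case: eqP => // ->.
rewrite !gE big_cons; case: (h j (cnt j s)) => /=.
  by rewrite mul0r mulr0 add0r mul1r addrA.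
by rewrite mul0r mulr0 addr0 mul1r add0r.
Unshelve. all: by end_near. Qed.

Lemma poissonized_stat (f : R -> R) :
  \sum_(m < M) pois x m * Ex q m (fun s => f (stat s)%:R) @[M --> \oo] -->
  bern (map e (enum I)) f 0.
Proof.
have c := @poissonized_partial (enum I) f 0 (fun _ _ => 1) (fun=> 1) (enum_uniq _).
have {}c := c (fun _ _ => ltac:(by rewrite normr1)).
have : forall i : I, \sum_(a < M) pois (x * q i) a * 1 @[M --> \oo] --> (1 : R).
  by move=> i; under eq_fun do under eq_bigr do rewrite mulr1; exact: sum_pois_cvg.
move=> /c; rewrite [X in _ * X]big_pred0; last by move=> i; rewrite mem_enum.
rewrite mulr1; apply: cvg_trans; apply: near_eq_cvg; near=> M.
apply: eq_bigr => m _; congr (_ * _); apply: eq_Ex => s _.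
rewrite big_pred0; last by move=> i; rewrite mem_enum.
rewrite mulr1 add0r; congr f; rewrite /stat natr_sum big_enum//=.
Unshelve. all: by end_near. Qed.

Lemma stat_step i s : `|(stat (i :: s))%:R - (stat s)%:R : R| <= 1.
Proof.
rewrite /stat !natr_sum -sumrB (bigD1 i)//= big1 ?addr0; last first.
  by move=> j ji; rewrite eq_sym (negbTE ji) subrr.
by rewrite eqxx; case: h; case: h; rewrite /= ?subrr ?subr0 ?sub0r ?normrN ?normr0 ?normr1.
Qed.

Lemma stat_perm s t : perm_eq s t -> stat s = stat t.
Proof. by move=> /permP st; apply: eq_bigr => i _; rewrite /cnt st. Qed.

Lemma stat_cat_le s t : `|(stat (s ++ t))%:R - (stat s)%:R : R| <= (size t)%:R.
Proof.
elim: t => [|i t IH]; first by rewrite cats0 subrr normr0.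
rewrite (stat_perm (_ : perm_eq (s ++ i :: t) (i :: s ++ t))); last first.
  by rewrite perm_catC/= perm_cons perm_catC.
have -> : (stat (i :: s ++ t))%:R - (stat s)%:R =
  (stat (i :: s ++ t))%:R - (stat (s ++ t))%:R + ((stat (s ++ t))%:R - (stat s)%:R) :> R by ring.
apply: le_trans (ler_normD _ _) _; rewrite -nat1r.
by apply: lerD => //; exact: stat_step.
Qed.

Definition increment (l r : nat) : R := Ex q l (fun s => Ex q r (fun t =>
  `|(stat (s ++ t))%:R - (stat s)%:R|)).

Lemma increment_le l r : increment l r <= r%:R.
Proof.
rewrite -[leRHS](Ex_cst q1 l); apply: le_Ex => // s _.
rewrite -[leRHS](Ex_cst q1 r); apply: le_Ex => // t <-.
exact: stat_cat_le.
Qed.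

Lemma Ex_lipschitz (f : R -> R) (L : R) l r :
  (forall a b, `|f a - f b| <= L * `|a - b|) ->
  `|Ex q (l + r) (fun s => f (stat s)%:R) - Ex q l (fun s => f (stat s)%:R)| <=
  L * increment l r.
Proof.
move=> fL; have L0 : 0 <= L.
  by have := le_trans (normr_ge0 _) (fL 1 0); rewrite subr0 normr1 mulr1.
rewrite Ex_cat -ExB; apply: le_trans (le_norm_Ex q0 _ _) _.
rewrite -ExZ; apply: le_Ex => // s _.
rewrite -[X in _ - X](Ex_cst q1 r) -ExB.
apply: le_trans (le_norm_Ex q0 _ _) _; rewrite -ExZ.
by apply: le_Ex.
Qed.

End PoissonizedStatistic.

Section DePoissonization.
Context {R : realType} {I : finType} (q : I -> R).
Hypothesis q0 : forall i, 0 <= q i.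
Hypothesis q1 : \sum_i q i = 1.
Variable h : I -> nat -> bool.

(* Fewer than [n / 2] balls are so unlikely under the Poisson law that the
   trivial bound on the increment suffices there. *)
Theorem depoissonization (n : nat) (e : I -> R) (f : R -> R) (L M tau : R) :
  (0 < n)%N -> lipschitz_bounded f L M -> 0 <= tau ->
  (forall i, \sum_(a < M) pois (n%:R * q i) a * (h i a)%:R @[M --> \oo] --> e i) ->
  (forall l r, (n <= 2 * l)%N -> increment q h l r <= tau * (1 + r%:R ^+ 2 / n%:R)) ->
  `|Ex q n (fun s => f (stat h s)%:R) - bern (map e (enum I)) f 0| <=
  L * (2 * tau + 2).
Proof.
move=> n0 fLM tau0 he inc; have [L0 M0] := lipschitz_bounded_ge0 fLM.
have [fL fM] := fLM.
have nR : 0 < n%:R :> R by rewrite ltr0n.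
pose E m := Ex q m (fun s => f (stat h s)%:R).
pose sq m : R := (m%:R - n%:R) ^+ 2.
have key m : `|E n - E m| <= L * (tau * (1 + sq m / n%:R) + 2 * sq m / n%:R).
  have sq0 : 0 <= sq m by rewrite sqr_ge0.
  have sn0 : 0 <= sq m / n%:R by rewrite divr_ge0// ltW.
  have [mn|nm] := leqP m n.
    have e1 : (n - m)%:R ^+ 2 = sq m by rewrite natrB// /sq -sqrrN opprB.
    rewrite -{1}(subnKC mn); apply: le_trans (Ex_lipschitz q0 q1 _ _ _ fL) _.
    rewrite ler_wpM2l//; have [n2|n2] := leqP n (2 * m).
      apply: le_trans (inc _ _ n2) _; rewrite e1 lerDl -mulrA.
      by rewrite mulr_ge0.
    apply: le_trans (increment_le q0 q1 _ _ _) _.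
    (* Here [n - m] exceeds n / 2, hence is at most 2 (n - m)^2 / n. *)
    apply: (@le_trans _ _ (2 * sq m / n%:R)); last first.
      by rewrite lerDr mulr_ge0// addr_ge0.
    rewrite ler_pdivlMr// -e1 expr2 mulrCA ler_wpM2l// -!natrM ler_nat.
    by rewrite mulnBr; lia.
  have e1 : (m - n)%:R ^+ 2 = sq m by rewrite natrB ?(ltnW nm).
  rewrite distrC -{1}(subnKC (ltnW nm)).
  apply: le_trans (Ex_lipschitz q0 q1 _ _ _ fL) _.
  rewrite ler_wpM2l//; apply: le_trans (inc _ _ _) _; first by lia.
  by rewrite e1 lerDl -mulrA mulr_ge0.
have c1 := @poissonized_stat R I q q0 q1 h n%:R e (ltW nR) he f.
have c2 : E n * \sum_(m < M) pois n%:R m @[M --> \oo] --> E n * 1.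
  by apply: cvgMr; exact: sum_pois_cvg.
rewrite mulr1 in c2; have FF : Filter (\oo : set_system nat) by exact _.
have c3 : `|E n * (\sum_(m < k) pois n%:R m) - \sum_(m < k) pois n%:R m * E m|
    @[k --> \oo] --> `|E n - bern (map e (enum I)) f 0|.
  by apply: cvg_norm; exact: (@cvgB R R nat \oo FF _ _ _ _ c2 c1).
have c4 : (fun=> L * (2 * tau + 2)) @ \oo --> L * (2 * tau + 2) by exact: cvg_cst.
apply: (ler_cvg_to c3 c4); near=> k.
rewrite big_distrr/= -sumrB.
under eq_bigr => m _ do rewrite mulrC -mulrBr.
apply: le_trans (ler_norm_sum _ _ _) _.
apply: (@le_trans _ _ (\sum_(m < k) pois n%:R m * (L * (tau * (1 + sq m / n%:R) + 2 * sq m / n%:R)))).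
  apply: ler_sum => m _; rewrite normrM ger0_norm ?pois_ge0 ?(ltW nR)//.
  by rewrite ler_wpM2l ?pois_ge0 ?(ltW nR).
have -> : \sum_(m < k) pois n%:R m * (L * (tau * (1 + sq m / n%:R) + 2 * sq m / n%:R)) =
  L * (tau * \sum_(m < k) pois n%:R m + ((tau + 2) / n%:R) * \sum_(m < k) pois n%:R m * sq m).
  rewrite !big_distrr/= -big_split/= big_distrr/=; apply: eq_bigr => m _.
  by field; rewrite gt_eqF.
rewrite ler_wpM2l//.
have b1 := @sum_pois_le1 R n%:R k (ltW nR).
have b2 : \sum_(m < k) pois n%:R m * sq m <= n%:R := @pois_second_moment_le R n%:R k (ltW nR).
apply: (@le_trans _ _ (tau * 1 + (tau + 2) / n%:R * n%:R)).
  by apply: lerD; rewrite ler_wpM2l// divr_ge0 ?addr_ge0 ?(ltW nR).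
by rewrite divfK ?gt_eqF//; lra.
Unshelve. all: by end_near. Qed.

End DePoissonization.

(** * The effect of additional balls *)

Section Increments.
Context {R : realType} {I : finType} (q : I -> R).
Hypothesis q0 : forall i, 0 <= q i.
Hypothesis q1 : \sum_i q i = 1.
Implicit Types (s t : seq I).

Lemma q_le1 i : q i <= 1.
Proof. by rewrite -q1 (bigD1 i)//= lerDl sumr_ge0. Qed.

Lemma q_le1D i j : i != j -> q i + q j <= 1.
Proof.
move=> ij; rewrite -q1 (bigD1 i)//= (bigD1 j) 1?eq_sym//= addrA lerDl.
by rewrite sumr_ge0.
Qed.

(** The generating function of a binomial count; it serves at z = 1/2 and at z = -1. *)
Lemma Ex_pow_cnt m i (z : R) :
  Ex q m (fun s => z ^+ cnt i s) = (1 + (z - 1) * q i) ^+ m.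
Proof.
transitivity (Ex q m (fun s => \prod_(x <- s) (if x == i then z else 1))).
  apply: eq_Ex => s _; elim: s => [|x s IH]; first by rewrite big_nil expr0.
  by rewrite big_cons -IH /cnt/=; case: eqP => _; rewrite ?mul1r// add1n exprS.
rewrite Ex_prod//; congr (_ ^+ _); rewrite (bigD1 i)//= eqxx.
rewrite (eq_bigr q) => [|j /negbTE ->]; last by rewrite mulr1.
have : \sum_(j | j != i) q j = 1 - q i by have := q1; rewrite (bigD1 i)//=; lra.
by move=> ->; ring.
Qed.

Lemma Ex_sign2_cnt m i j : i != j ->
  Ex q m (fun s => (-1) ^+ cnt i s * (-1) ^+ cnt j s : R) =
  (1 - 2 * q i - 2 * q j) ^+ m.
Proof.
move=> ij.
transitivity (Ex q m (fun s => \prod_(x <- s) (if (x == i) || (x == j) then -1 else 1 : R))).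
  apply: eq_Ex => s _; elim: s => [|x s IH]; first by rewrite big_nil expr0 mulr1.
  rewrite big_cons -IH /cnt/=; case: (eqVneq x i) => [->|xi] /=.
    by rewrite (negbTE ij) add1n add0n exprS; ring.
  by case: eqP => _; rewrite ?add1n ?add0n ?exprS; ring.
rewrite Ex_prod//; congr (_ ^+ _).
rewrite (bigD1 i)//= eqxx/= (bigD1 j) 1?eq_sym//= eqxx orbT.
rewrite (eq_bigr q) => [|k /andP[/negbTE -> /negbTE ->]]; last by rewrite mulr1.
have : \sum_(k | (k != i) && (k != j)) q k = 1 - q i - q j.
  by have := q1; rewrite (bigD1 i)//= (bigD1 j) 1?eq_sym//=; lra.
by move=> ->; ring.
Qed.

Lemma Ex_mul l r (A B : seq I -> R) :
  Ex q l (fun s => Ex q r (fun t => A s * B t)) = Ex q l A * Ex q r B.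
Proof.
rewrite mulrC -ExZ; apply: eq_Ex => s _.
by rewrite ExZ mulrC.
Qed.

(** A new ball acts only through its own urn, and by at most c_i 2^(-a) if that urn holds [a] balls.
    The mean of 2^(-a) is (1 - q_i / 2)^m by [Ex_pow_cnt]. It decreases with the number of balls, so
    each of the [r] balls costs at most the bound at [l]. *)
Lemma increment_exp (h : I -> nat -> bool) (c : I -> R) l r :
  (forall i, 0 <= c i) ->
  (forall i a, `|(h i a.+1)%:R - (h i a)%:R| <= c i * 2^-1 ^+ a) ->
  increment q h l r <= r%:R * \sum_i c i * (q i * (1 - q i / 2) ^+ l).
Proof.
move=> c0 hc; set A := \sum_i _.
have q2 i : 0 <= 1 - q i / 2 <= 1.
  by have := q_le1 i; have := q0 i => *; apply/andP; split; lra.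
have step m : (l <= m)%N ->
    Ex q m (fun s => \sum_i q i * `|(stat h (i :: s))%:R - (stat h s)%:R|) <= A.
  move=> lm; rewrite Ex_sum; apply: ler_sum => i _; rewrite ExZ mulrCA.
  rewrite ler_wpM2l//.
  apply: (@le_trans _ _ (c i * (1 - q i / 2) ^+ m)); last first.
    rewrite ler_wpM2l// -(subnKC lm) exprD ler_piMr ?exprn_ge0//.
      by case/andP: (q2 i).
    by rewrite exprn_ile1//; case/andP: (q2 i).
  have -> : 1 - q i / 2 = 1 + (2^-1 - 1) * q i by field.
  rewrite -Ex_pow_cnt -ExZ; apply: le_Ex => // s _.
  rewrite /stat !natr_sum -sumrB (bigD1 i)//= big1 ?addr0; last first.
    by move=> j ji; rewrite eq_sym (negbTE ji) subrr.
  by rewrite eqxx; exact: hc.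
elim: r => [|r IH].
  rewrite mul0r /increment /=; apply: le_trans (_ : Ex q l (fun=> 0) <= _).
    by apply: le_Ex => // s _; rewrite cats0 subrr normr0.
  by rewrite Ex_cst.
rewrite -nat1r mulrDl mul1r.
apply: le_trans (lerD (step (l + r)%N (leq_addr _ _)) IH).
rewrite Ex_cat /increment -ExD; apply: le_Ex => // s _.
pose A1 i t : R := `|(stat h (i :: s ++ t))%:R - (stat h (s ++ t))%:R|.
pose B1 t : R := `|(stat h (s ++ t))%:R - (stat h s)%:R|.
have -> : Ex q r (fun t => \sum_i q i * A1 i t) + Ex q r B1 =
    \sum_i q i * Ex q r (fun t => A1 i t + B1 t).
  under [RHS]eq_bigr do rewrite ExD mulrDr.
  rewrite big_split/= -[X in _ = _ + X]big_distrl/= q1 mul1r Ex_sum.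
  by congr (_ + _); apply: eq_bigr => i _; rewrite ExZ.
apply: ler_sum => i _; rewrite ler_wpM2l//.
apply: le_Ex => // t _.
rewrite (stat_perm h (_ : perm_eq (s ++ i :: t) (i :: s ++ t))); last first.
  by rewrite perm_catC/= perm_cons perm_catC.
rewrite /A1 /B1; apply: le_trans (ler_normD _ _).
by rewrite addrA subrK.
Qed.

(** A mixed second difference: it vanishes when x = 0 or y = 0, whence the product x y. It is the
    form taken by the mean of (1 - sg i) (1 - sg j) in [parity_increment]. *)
Lemma mixed_difference (x y : R) r :
  `|1 - x| <= 1 -> `|1 - y| <= 1 -> `|1 - x - y| <= 1 -> 0 <= x -> 0 <= y ->
  `|(1 - x - y) ^+ r - (1 - x) ^+ r - (1 - y) ^+ r + 1| <= r%:R ^+ 2 * (x * y).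
Proof.
move=> x1 y1 xy1 x0 y0.
have pow_dist (a b : R) n : `|a| <= 1 -> `|b| <= 1 -> `|a ^+ n - b ^+ n| <= n%:R * `|a - b|.
  move=> a1 b1; elim: n => [|n IH]; first by rewrite !expr0 subrr normr0 mul0r.
  have -> : a ^+ n.+1 - b ^+ n.+1 = a * (a ^+ n - b ^+ n) + (a - b) * b ^+ n.
    by rewrite !exprS; ring.
  apply: le_trans (ler_normD _ _) _; rewrite !normrM -natr1 mulrDl mul1r.
  have h1 : `|a| * `|a ^+ n - b ^+ n| <= 1 * `|a ^+ n - b ^+ n| by rewrite ler_wpM2r.
  have h2 : `|a - b| * `|b ^+ n| <= `|a - b| * 1.
    by rewrite ler_wpM2l// normrX exprn_ile1.
  lra.
elim: r => [|r IH].
  by rewrite !expr0 expr0n/= mul0r (_ : 1 - 1 - 1 + 1 = 0) ?normr0//; ring.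
have -> : (1 - x - y) ^+ r.+1 - (1 - x) ^+ r.+1 - (1 - y) ^+ r.+1 + 1 =
  ((1 - x - y) ^+ r - (1 - x) ^+ r - (1 - y) ^+ r + 1) -
  x * ((1 - x - y) ^+ r - (1 - x) ^+ r) - y * ((1 - x - y) ^+ r - (1 - y) ^+ r).
  by rewrite !exprS; ring.
have h1 := pow_dist (1 - x - y) (1 - x) r xy1 x1.
have h2 := pow_dist (1 - x - y) (1 - y) r xy1 y1.
have e1 : `|1 - x - y - (1 - x)| = y.
  by rewrite (_ : _ - _ = - y) ?normrN ?ger0_norm//; ring.
have e2 : `|1 - x - y - (1 - y)| = x.
  by rewrite (_ : _ - _ = - x) ?normrN ?ger0_norm//; ring.
rewrite e1 in h1; rewrite e2 in h2.
apply: le_trans (ler_normB _ _) _.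
apply: le_trans (lerD (ler_normB _ _) (lexx _)) _.
rewrite !normrM (ger0_norm x0) (ger0_norm y0).
have h3 := ler_wpM2l x0 h1; have h4 := ler_wpM2l y0 h2.
have -> : r.+1%:R ^+ 2 * (x * y) = r%:R ^+ 2 * (x * y) + 2 * (r%:R * (x * y)) + x * y.
  by rewrite -natr1; ring.
have : 0 <= x * y by rewrite mulr_ge0.
move: IH h3 h4; set a := `|_|; set b := x * `|_|; set d := y * `|_|.
by lra.
Qed.

(* The sign [(-1) ^+ J] of an urn is multiplicative over the balls, so that the
   second moment of the increment of the sum of the signs is explicit. *)
Lemma parity_increment (b : I -> bool) (dl eta : R) l r :
  0 < eta ->
  (forall i j, b i -> b j -> i != j ->
     `|1 - 2 * q i - 2 * q j| <= expR (- (dl * (q i + q j)))) ->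
  increment q (fun i a => b i && odd a) l r <=
  (eta + (\sum_(i | b i) Num.min 1 (r%:R * q i) +
    r%:R ^+ 2 * (\sum_(i | b i) q i * expR (- (dl * (l%:R * q i)))) ^+ 2) / eta) / 2.
Proof.
move=> eta0 hdl; set h := fun i a => _.
pose sg i s : R := (-1) ^+ cnt i s.
have sgD i s t : sg i (s ++ t) = sg i s * sg i t.
  by rewrite /sg /cnt count_cat exprD.
have sg2 i s : sg i s * sg i s = 1 by rewrite /sg -exprD addnn -signr_odd odd_double.
have statE s t : (stat h (s ++ t))%:R - (stat h s)%:R =
    \sum_(i | b i) sg i s * (1 - sg i t) / 2 :> R.
  have hE i u : (h i (cnt i u))%:R = (if b i then (1 - sg i u) / 2 else 0) :> R.
    rewrite /h /sg; case: (b i) => //=; rewrite -signr_odd.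
    by case: (odd _) => /=; rewrite ?expr0 ?expr1; field.
  rewrite /stat !natr_sum -sumrB [RHS]big_mkcond/=; apply: eq_bigr => i _.
  rewrite !hE; case: (b i); last by rewrite subrr.
  by rewrite sgD; field.
pose M2 := Ex q l (fun s => Ex q r (fun t => ((stat h (s ++ t))%:R - (stat h s)%:R) ^+ 2)).
have M2E : M2 = \sum_(i | b i) \sum_(j | b j)
    Ex q l (fun s => sg i s * sg j s) * Ex q r (fun t => (1 - sg i t) * (1 - sg j t)) / 4.
  rewrite /M2.
  transitivity (Ex q l (fun s => Ex q r (fun t => \sum_(i | b i) \sum_(j | b j)
     (sg i s * sg j s / 4) * ((1 - sg i t) * (1 - sg j t))))).
    apply: eq_Ex => s _; apply: eq_Ex => t _; rewrite statE expr2 big_distrl/=.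
    apply: eq_bigr => i _; rewrite big_distrr/=; apply: eq_bigr => j _.
    by field.
  transitivity (Ex q l (fun s => \sum_(i | b i) \sum_(j | b j)
     Ex q r (fun t => (sg i s * sg j s / 4) * ((1 - sg i t) * (1 - sg j t))))).
    by apply: eq_Ex => s _; rewrite Ex_sum; apply: eq_bigr => i _; rewrite Ex_sum.
  rewrite Ex_sum; apply: eq_bigr => i _; rewrite Ex_sum; apply: eq_bigr => j _.
  rewrite Ex_mul mulrAC; congr (_ * _).
  by rewrite mulrC -ExZ; apply: eq_Ex => s _; rewrite mulrC.
have pow1 i : `|1 - 2 * q i| <= 1.
  by rewrite ler_norml; have := q0 i; have := q_le1 i => *; apply/andP; split; lra.
have sgE m i : Ex q m (sg i) = (1 - 2 * q i) ^+ m.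
  by rewrite /sg Ex_pow_cnt; congr (_ ^+ _); ring.
(* The two bounds come from |(1 - 2 q_i)^r| <= 1 and from Bernoulli's inequality. *)
have diag i : Ex q l (fun s => sg i s * sg i s) *
     Ex q r (fun t => (1 - sg i t) * (1 - sg i t)) / 4 <= Num.min 1 (r%:R * q i).
  rewrite (_ : Ex q l _ = 1); last first.
    by rewrite -[RHS](Ex_cst q1 l 1); apply: eq_Ex => s _; rewrite sg2.
  rewrite mul1r (_ : Ex q r _ = 2 * (1 - (1 - 2 * q i) ^+ r)); last first.
    transitivity (Ex q r (fun t => 2 * (1 - sg i t))).
      by apply: eq_Ex => t _; move: (sg2 i t) => e; rewrite mulrBl !mulrBr e; ring.
    by rewrite ExZ ExB Ex_cst// sgE.
  have : `|(1 - 2 * q i) ^+ r| <= 1 by rewrite normrX exprn_ile1.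
  rewrite ler_norml => /andP[p1 p2].
  have : 1 - r%:R * (2 * q i) <= (1 - 2 * q i) ^+ r.
    elim: (r) => [|n IH]; first by rewrite mul0r expr0 subr0.
    have : `|(1 - 2 * q i) ^+ n| <= 1 by rewrite normrX exprn_ile1.
    rewrite exprS ler_norml -natr1 => /andP[oa ob].
    by have := q0 i; nra.
  by move=> p3; rewrite le_min; apply/andP; split; lra.
(* The [l] old balls give the exponential decay, through [hdl]. The [r] new ones give r^2 (2 q_i) (2
   q_j), and the 4 cancels. *)
have offdiag i j : b i -> b j -> i != j -> Ex q l (fun s => sg i s * sg j s) *
     Ex q r (fun t => (1 - sg i t) * (1 - sg j t)) / 4 <=
     r%:R ^+ 2 * ((q i * expR (- (dl * (l%:R * q i)))) * (q j * expR (- (dl * (l%:R * q j))))).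
  move=> bi bj ij; rewrite Ex_sign2_cnt//.
  have -> : Ex q r (fun t => (1 - sg i t) * (1 - sg j t)) =
    (1 - 2 * q i - 2 * q j) ^+ r - (1 - 2 * q i) ^+ r - (1 - 2 * q j) ^+ r + 1.
    transitivity (Ex q r (fun t => sg i t * sg j t - sg i t - sg j t + 1)).
      by apply: eq_Ex => t _; ring.
    by rewrite ExD !ExB Ex_cst// Ex_sign2_cnt// !sgE.
  have q2 : `|1 - 2 * q i - 2 * q j| <= 1.
    rewrite ler_norml; have := q0 i; have := q0 j; have := q_le1D ij => *.
    by apply/andP; split; lra.
  have q20 k : 0 <= 2 * q k by rewrite mulr_ge0.
  have := mixed_difference r (pow1 i) (pow1 j) q2 (q20 i) (q20 j).
  set D := _ + 1 => HD.
  have HE : `|(1 - 2 * q i - 2 * q j) ^+ l| <=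
     expR (- (dl * (l%:R * q i))) * expR (- (dl * (l%:R * q j))).
    rewrite normrX -expRD; apply: le_trans (_ : expR (- (dl * (q i + q j))) ^+ l <= _).
      by rewrite lerXn2r ?nnegrE ?expR_ge0 ?hdl.
    by rewrite -expRM_natl ler_expR le_eqVlt; apply/orP; left; apply/eqP; ring.
  apply: le_trans (ler_norm _) _; rewrite !normrM (ger0_norm (x := 4^-1)) ?invr_ge0//.
  have := ler_pM (normr_ge0 _) (normr_ge0 _) HE HD; lra.
have M2le : M2 <= \sum_(i | b i) Num.min 1 (r%:R * q i) +
    r%:R ^+ 2 * (\sum_(i | b i) q i * expR (- (dl * (l%:R * q i)))) ^+ 2.
  rewrite M2E [(\sum_(i | b i) _) ^+ 2]expr2 big_distrl/= big_distrr/= -big_split/=.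
  apply: ler_sum => i bi; rewrite (bigD1 i)//=; apply: lerD; first exact: diag.
  rewrite big_distrr/= big_distrr/= [X in _ <= X](bigD1 i)//=.
  rewrite -[leLHS]add0r; apply: lerD.
    by rewrite !mulr_ge0 ?sqr_ge0 ?expR_ge0.
  by apply: ler_sum => j /andP[bj ji]; apply: offdiag => //; rewrite eq_sym.
apply: (@le_trans _ _ ((eta + M2 / eta) / 2)); last first.
  by rewrite ler_pM2r ?invr_gt0// lerD2l ler_pM2r ?invr_gt0.
have -> : (eta + M2 / eta) / 2 = Ex q l (fun s => Ex q r (fun t =>
    2^-1 * eta + 2^-1 * eta^-1 * ((stat h (s ++ t))%:R - (stat h s)%:R) ^+ 2)).
  transitivity (Ex q l (fun=> 2^-1 * eta) + 2^-1 * eta^-1 * M2).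
    by rewrite Ex_cst//; field; lra.
  rewrite /M2 -ExZ -ExD; apply: eq_Ex => s _.
  by rewrite ExD Ex_cst// ExZ.
apply: le_Ex => // s _; apply: le_Ex => // t _.
(* The inequality |D| <= (eta + D^2 / eta) / 2 replaces the square root of the second moment; [eta]
   is left to the caller. *)
set D := _ - _.
have := sqr_ge0 (`|D| - eta); rewrite -(real_normK (num_real D)) => H.
rewrite (_ : 2^-1 * eta + 2^-1 * eta^-1 * `|D| ^+ 2 = (eta ^+ 2 + `|D| ^+ 2) / (2 * eta)).
  by rewrite ler_pdivlMr ?mulr_gt0//; nra.
by field; lra.
Qed.

End Increments.

(** * The Gamma function *)

Section GammaFunction.
Context {R : realType}.
Local Notation mu := (@lebesgue_measure R).
Local Notation D := (`]0, +oo[%classic : set (measurableTypeR R)).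
Implicit Types (x y t : R).

Lemma measurable_pos : measurable D.
Proof. exact: measurable_itv. Qed.

Lemma powR_add t x y : 0 < t -> t `^ (x + y) = t `^ x * t `^ y.
Proof. by move=> t0; apply: powRD; apply/implyP => _; rewrite gt_eqF. Qed.

Lemma bigcup_itv_inv : \bigcup_n `[n.+1%:R^-1, +oo[%classic = D.
Proof.
apply/seteqP; split=> t /=.
  move=> [n _] /=; rewrite !in_itv/= !andbT; apply: lt_le_trans.
  by rewrite invr_gt0.
rewrite in_itv/= andbT => t0.
have [n _ /(_ n (leqnn n))] := @nbhs_infty_ger R t^-1.
move=> /= tn; exists n => //=; rewrite in_itv/= andbT.
rewrite -[t]invrK lef_pV2 ?posrE ?invr_gt0//.
by apply: le_trans tn _; rewrite ler_nat.
Qed.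

(** The fundamental theorem on the open half-line, by exhaustion with [1 / (n + 1), +oo[. The powers
    of [t] used below need not be differentiable at 0, so only a limit of the primitive is assumed
    there. *)
Lemma integral_derive_pos (f F : R -> R) (l0 l : R) :
  (forall t, 0 < t -> 0 <= f t) ->
  (forall t, 0 < t -> {for t, continuous f}) ->
  (forall t, 0 < t -> is_derive t 1 F (f t)) ->
  F t @[t --> +oo] --> l -> F t @[t --> 0^'+] --> l0 ->
  (\int[mu]_(t in D) (f t)%:E = (l - l0)%:E)%E.
Proof.
move=> f0 fc dF Fl Fl0.
pose A (n : nat) : set (measurableTypeR R) := `[n.+1%:R^-1, +oo[%classic.
have A0 n : 0 < n.+1%:R^-1 :> R by rewrite invr_gt0.
have mf n : measurable_fun (A n) f.
  apply: subspace_continuous_measurable_fun; first exact: measurable_itv.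
  apply: continuous_in_subspaceT => t; rewrite inE /A/= in_itv/= andbT => At.
  by apply: fc; apply: lt_le_trans At.
have FTC n : (\int[mu]_(t in A n) (f t)%:E = l%:E - (F n.+1%:R^-1)%:E)%E.
  apply: ge0_continuous_FTC2y => //.
  - by move=> t At; apply: f0; apply: lt_le_trans At.
  - apply: continuous_in_subspaceT => t; rewrite inE /A/= in_itv/= andbT => At.
    by apply: fc; apply: lt_le_trans At.
  - by move=> t At; have d := dF t (lt_trans (A0 n) At).
  - have d := dF _ (A0 n); apply: cvg_at_right_filter.
    by apply/differentiable_continuous/derivable1_diffP.
  - move=> t; rewrite in_itv/= andbT => At.
    by have d := dF t (lt_trans (A0 n) At); rewrite derive1E derive_val.
have c1 : (\int[mu]_(t in A n) (f t)%:E)%E @[n --> \oo] -->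
    (\int[mu]_(t in D) (f t)%:E)%E.
  rewrite -bigcup_itv_inv; apply: ge0_nondecreasing_set_cvg_integral.
  - move=> n m nm; apply/subsetPset => t; rewrite /A/= !in_itv/= !andbT.
    by apply: le_trans; rewrite lef_pV2 ?posrE// ler_nat.
  - by move=> n; exact: measurable_itv.
  - by move=> n; apply/measurable_EFinP.
  - move=> n t; rewrite /A/= in_itv/= andbT => At.
    by rewrite lee_fin f0//; apply: lt_le_trans At.
have c2 : (\int[mu]_(t in A n) (f t)%:E)%E @[n --> \oo] --> (l - l0)%:E.
  under eq_fun do rewrite FTC -EFinB.
  apply: cvg_EFin; first by near=> n.
  apply: cvgB; first exact: cvg_cst.
  move/cvg_at_rightP: Fl0; apply; split=> // .
  exact: cvg_harmonic.
exact: (cvg_unique _ c1 c2).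
Unshelve. all: by end_near. Qed.

(** The exponent in the constant is the maximum of y ln t - t, reached at t = y. *)
Lemma powR_le_expR (y t : R) : 0 < y -> 0 < t ->
  t `^ y <= expR (y * ln y - y) * expR t.
Proof.
move=> y0 t0; rewrite /powR gt_eqF// -expRD ler_expR.
have : ln (t / y) <= t / y - 1.
  have := @le_ln1Dx R (t / y - 1); rewrite (_ : 1 + (t / y - 1) = t / y); last by ring.
  by apply; have := divr_gt0 t0 y0; lra.
rewrite lnM ?posrE ?invr_gt0// lnV ?posrE// => h.
have : y * (ln t - ln y) <= y * (t / y - 1) by rewrite ler_pM2l.
have -> : y * (t / y - 1) = t - y by field; lra.
by lra.
Qed.

Definition gamma_fun x t : R := t `^ (x - 1) * expR (- t).

Lemma gamma_fun_ge0 x t : 0 <= gamma_fun x t.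
Proof. by rewrite mulr_ge0 ?powR_ge0 ?expR_ge0. Qed.

Lemma measurable_gamma_fun x : measurable_fun D (gamma_fun x).
Proof.
apply: measurable_funTS; apply: measurable_funM; first exact: measurable_powR.
by apply: measurableT_comp => //; exact: measurable_funN.
Qed.

(* The derivative of [t `^ x / (1 + t `^ x)], a primitive bounded by 1. *)
Definition gamma_bound x t : R := x * t `^ (x - 1) / (1 + t `^ x) ^+ 2.

Lemma continuous_powR x t : 0 < t -> {for t, continuous (@powR R ^~ x)}.
Proof.
move=> t0; have d := is_derive1_powR x t0.
by apply/differentiable_continuous/derivable1_diffP.
Qed.

Lemma is_derive_gamma_bound x t : 0 < x -> 0 < t ->
  is_derive t 1 (fun t => - (1 + t `^ x)^-1) (gamma_bound x t).
Proof.
move=> x0 t0; have d := is_derive1_powR x t0.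
have h : 1 + t `^ x != 0 by rewrite gt_eqF// ltr_wpDr ?powR_ge0.
apply: is_derive_eq; rewrite /gamma_bound /GRing.scale/=.
by field.
Qed.

Lemma cvg_powRy x : 0 < x -> t `^ x @[t --> +oo] --> +oo.
Proof.
move=> x0; apply/cvgryPge => A; near=> t.
have [A0|A0] := leP A 0; first by apply: le_trans A0 _; exact: powR_ge0.
have At : A `^ x^-1 <= t.
  by near: t; apply: nbhs_pinfty_ge; exact: num_real.
have -> : A = (A `^ x^-1) `^ x by rewrite -powRrM mulVf ?gt_eqF// powRr1 ?ltW.
apply: ge0_ler_powR => //; rewrite ?nnegrE ?powR_ge0 ?(ltW x0)//.
Unshelve. all: by end_near. Qed.

Lemma cvg_gamma_primitive x : 0 < x ->
  (- (1 + t `^ x)^-1 @[t --> +oo] --> (0 : R)) /\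
  (- (1 + t `^ x)^-1 @[t --> 0^'+] --> (-1 : R)).
Proof.
move=> x0; split.
  apply/cvgrPdist_le => e e0; near=> t.
  have h : 0 < 1 + t `^ x by rewrite ltr_wpDr ?powR_ge0.
  rewrite sub0r !normrN ger0_norm ?invr_ge0 ?(ltW h)//.
  rewrite -[e]invrK lef_pV2 ?posrE ?invr_gt0//.
  apply: le_trans (_ : t `^ x <= _); last by rewrite lerDr.
  by near: t; move/cvgryPge: (cvg_powRy x0); apply.
apply: cvgN; rewrite -[X in _ --> X]invr1; apply: cvgV => //.
rewrite -[X in _ --> X]addr0; apply: cvgD; first exact: cvg_cst.
exact: powR_cvg0.
Unshelve. all: by end_near. Qed.

Lemma cvg_powR_expRN x : 0 < x ->
  (t `^ x * expR (- t) @[t --> +oo] --> (0 : R)) /\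
  (t `^ x * expR (- t) @[t --> 0^'+] --> (0 : R)).
Proof.
move=> x0; split.
  pose c := expR ((x + 1) * ln (x + 1) - (x + 1)).
  have c0 : 0 < c by exact: expR_gt0.
  apply/cvgrPdist_le => e e0; near=> t.
  have t0 : 0 < t by near: t; apply: nbhs_pinfty_gt; exact: num_real.
  have tc : c / e <= t by near: t; apply: nbhs_pinfty_ge; exact: num_real.
  rewrite sub0r normrN ger0_norm ?mulr_ge0 ?powR_ge0 ?expR_ge0//.
  have x10 : 0 < x + 1 by rewrite addr_gt0.
  have := powR_le_expR x10 t0; rewrite -/c powR_add// powRr1 ?(ltW t0)// => h.
  have E : expR (- t) * expR t = 1 by rewrite -expRD addNr expR0.
  have E0 : 0 < expR (- t) by exact: expR_gt0.
  rewrite ler_pdivrMr// in tc.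
  rewrite -(ler_pM2r t0); apply: le_trans (_ : c <= _); last by rewrite mulrC.
  have := ler_wpM2l (ltW E0) h; rewrite [X in _ <= X]mulrCA E mulr1.
  by apply: le_trans; rewrite le_eqVlt; apply/orP; left; apply/eqP; ring.
rewrite -[X in _ --> X](mul0r (expR (- 0))); apply: cvgM; first exact: powR_cvg0.
apply: cvg_at_right_filter; apply: (cvg_comp _ expR); last exact: continuous_expR.
by apply: cvgN; exact: cvg_id.
Unshelve. all: by end_near. Qed.

Lemma continuous_gamma_bound x t : 0 < t -> {for t, continuous (gamma_bound x)}.
Proof.
move=> t0; apply: cvgM.
  by apply: cvgMr; exact: continuous_powR.
apply: cvgV; first by rewrite expf_neq0// gt_eqF// ltr_wpDr ?powR_ge0.
have c : (1 + t0 `^ x) @[t0 --> t] --> 1 + t `^ x.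
  by apply: cvgD; [exact: cvg_cst|exact: continuous_powR].
rewrite expr2; under eq_fun do rewrite expr2.
exact: cvgM.
Qed.

Lemma integral_gamma_bound x : 0 < x ->
  (\int[mu]_(t in D) (gamma_bound x t)%:E = 1%:E)%E.
Proof.
move=> x0; have [l1 l2] := cvg_gamma_primitive x0.
have -> : 1 = 0 - -1 :> R by rewrite sub0r opprK.
apply: (integral_derive_pos (F := fun t => - (1 + t `^ x)^-1)) => //.
- move=> t t0; rewrite /gamma_bound divr_ge0 ?sqr_ge0// mulr_ge0 ?powR_ge0//.
  exact: ltW.
- by move=> t; exact: continuous_gamma_bound.
- by move=> t; exact: is_derive_gamma_bound.
Qed.

Lemma integrable_gamma_bound x : 0 < x -> mu.-integrable D (EFin \o gamma_bound x).
Proof.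
move=> x0; apply/integrableP; split.
  apply/measurable_EFinP; apply: subspace_continuous_measurable_fun => //.
  apply: continuous_in_subspaceT => t; rewrite inE/= in_itv/= andbT => t0.
  exact: continuous_gamma_bound.
have -> : (\int[mu]_(t in D) `|(EFin \o gamma_bound x) t| =
    \int[mu]_(t in D) (gamma_bound x t)%:E)%E.
  apply: eq_integral => t; rewrite inE/= in_itv/= andbT => t0; rewrite ger0_norm//.
  by rewrite divr_ge0 ?sqr_ge0// mulr_ge0 ?powR_ge0// ltW.
by rewrite integral_gamma_bound// ltry.
Qed.

(** Near 0 the bound behaves like t^(x - 1); at infinity the exponential wins over any power. The
    factor t^m with m = 1 serves the functional equation. *)
Lemma gamma_fun_le x (m : nat) : 0 < x -> exists2 C, 0 < C &
  forall t, 0 < t -> t ^+ m * gamma_fun x t <= C * gamma_bound x t.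
Proof.
move=> x0.
pose c (y : R) := expR (y * ln y - y).
(* Expanding (1 + t^x)^2 gives three powers of [t], one per group of terms. For t^m the exponent
   [m.+1] is used beyond t = 1, as [powR_le_expR] wants a positive one. *)
pose K := c m.+1%:R + 1 + 2 * c (m%:R + x) + c (m%:R + 2 * x).
have c0 y : 0 < c y by exact: expR_gt0.
have K0 : 0 < K.
  by have := c0 m.+1%:R; have := c0 (m%:R + x); have := c0 (m%:R + 2 * x); rewrite /K; lra.
exists (K / x); first by rewrite divr_gt0.
move=> t t0; rewrite /gamma_fun /gamma_bound.
have p0 : 0 < 1 + t `^ x by rewrite ltr_wpDr ?powR_ge0.
have -> : K / x * (x * t `^ (x - 1) / (1 + t `^ x) ^+ 2) =
  t `^ (x - 1) * (K / (1 + t `^ x) ^+ 2) by field; rewrite !gt_eqF.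
rewrite mulrCA ler_wpM2l ?powR_ge0// ler_pdivlMr ?exprn_gt0//.
have pm : t ^+ m = t `^ m%:R by rewrite powR_mulrn// ltW.
have e1 : t ^+ m * t `^ x = t `^ (m%:R + x).
  by rewrite pm -powR_add.
have e2 : t ^+ m * t `^ x * t `^ x = t `^ (m%:R + 2 * x).
  by rewrite pm -!powR_add//; congr (_ `^ _); ring.
have E : expR (- t) * expR t = 1 by rewrite -expRD addNr expR0.
have E0 : 0 < expR (- t) by exact: expR_gt0.
have b0 : t ^+ m <= (c m.+1%:R + 1) * expR t.
  have [t1|t1] := leP t 1.
    apply: le_trans (_ : 1 <= _); first by rewrite exprn_ile1// ltW.
    have := expR_ge1Dx t; have := c0 m.+1%:R; nra.
  apply: le_trans (_ : t ^+ m.+1 <= _); first by rewrite exprS ler_peMl ?exprn_ge0 ?ltW.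
  rewrite -powR_mulrn ?(ltW t0)//.
  apply: le_trans (powR_le_expR (ltr0Sn _ m) t0) _.
  by rewrite ler_wpM2r ?expR_ge0// lerDl.
have b1 : t `^ (m%:R + x) <= c (m%:R + x) * expR t by apply: powR_le_expR => //; rewrite ltr_wpDl.
have b2 : t `^ (m%:R + 2 * x) <= c (m%:R + 2 * x) * expR t by apply: powR_le_expR => //; rewrite ltr_wpDl// mulr_gt0.
have -> : t ^+ m * expR (- t) * (1 + t `^ x) ^+ 2 =
  expR (- t) * (t ^+ m + 2 * (t ^+ m * t `^ x) + t ^+ m * t `^ x * t `^ x) by ring.
rewrite e2 e1.
apply: le_trans (_ : expR (- t) * (K * expR t) <= _).
  by rewrite ler_wpM2l ?(ltW E0)// /K; lra.
by rewrite mulrCA E mulr1.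
Qed.

Lemma integrable_gamma_fun_pow x (m : nat) : 0 < x ->
  mu.-integrable D (EFin \o (fun t => t ^+ m * gamma_fun x t)).
Proof.
move=> x0; have [C C0 H] := gamma_fun_le m x0.
have ib := integrableZl measurable_pos C (integrable_gamma_bound x0).
apply: (le_integrable _ _ _ ib) => //.
  apply/measurable_EFinP; apply: measurable_funM; last exact: measurable_gamma_fun.
  by apply: measurable_funTS; exact: measurable_funX.
move=> t /=; rewrite in_itv/= andbT => t0; rewrite lee_fin !ger0_norm ?H//.
- by rewrite (le_trans _ (H t t0))// mulr_ge0 ?gamma_fun_ge0 ?exprn_ge0 ?ltW.
- by rewrite mulr_ge0 ?gamma_fun_ge0 ?exprn_ge0 ?ltW.
Qed.

Lemma integrable_gamma_fun x : 0 < x -> mu.-integrable D (EFin \o gamma_fun x).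
Proof.
move=> x0; have := integrable_gamma_fun_pow 0 x0.
by congr (is_true (_.-integrable _ (EFin \o _))); apply/funext => t; rewrite expr0 mul1r.
Qed.

Lemma gamma_funS x t : 0 < t -> gamma_fun (x + 1) t = t * gamma_fun x t.
Proof.
move=> t0; rewrite /gamma_fun mulrA (_ : x + 1 - 1 = 1 + (x - 1)); last by ring.
by rewrite (powR_add 1 _ t0) powRr1 ?ltW.
Qed.

(** Integration by parts: t^x exp(-t) is a primitive of x gamma_fun x - gamma_fun (x + 1) and
    vanishes at both ends. This integrand changes sign, while [integral_derive_pos] wants a
    nonnegative one, so a multiple of [gamma_bound], whose integral is known, is added. *)
Lemma GammaS x : 0 < x -> Gamma (x + 1) = x * Gamma x.
Proof.
move=> x0; have [C C0 H] := gamma_fun_le 1 x0.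
have mD := measurable_pos.
have i0 := integrable_gamma_fun x0.
have i1 : mu.-integrable D (EFin \o gamma_fun (x + 1)).
  by apply: integrable_gamma_fun; rewrite addr_gt0.
have ib := integrable_gamma_bound x0.
have ibC : mu.-integrable D (EFin \o (fun t => C * gamma_bound x t)).
  exact: (integrableZl mD C ib).
have ix : mu.-integrable D (EFin \o (fun t => x * gamma_fun x t)).
  exact: (integrableZl mD x i0).
have id : mu.-integrable D (EFin \o (fun t => x * gamma_fun x t - gamma_fun (x + 1) t)).
  exact: (integrableB mD ix i1).
pose f t := x * gamma_fun x t - gamma_fun (x + 1) t + C * gamma_bound x t.
pose F t := t `^ x * expR (- t) + C * - (1 + t `^ x)^-1.
have [l1 l2] := cvg_gamma_primitive x0; have [k1 k2] := cvg_powR_expRN x0.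
have e1 : \int[mu]_(t in D) f t = C.
  rewrite -[RHS]opprK -[RHS]sub0r; apply: (congr1 fine (y := (0 - - C)%:E)).
  apply: (integral_derive_pos (F := F)).
  - move=> t t0; rewrite /f gamma_funS//; have := H t t0; rewrite expr1.
    by have := gamma_fun_ge0 x t; nra.
  - move=> t t0; apply: cvgD; last by apply: cvgMr; exact: continuous_gamma_bound.
    have ce : {for t, continuous (fun t : R => expR (- t))}.
      by apply: (cvg_comp _ expR); [apply: cvgN; exact: cvg_id|exact: continuous_expR].
    apply: cvgB; first by apply: cvgMr; apply: cvgM => //; exact: continuous_powR.
    by apply: cvgM => //; exact: continuous_powR.
  - move=> t t0; have d1 := is_derive1_powR x t0.
    have d2 := is_derive_gamma_bound x0 t0.
    apply: is_derive_eq; rewrite /f /gamma_fun /GRing.scale/= addrK.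
    ring.
  - rewrite -[X in _ --> X](addr0 0); apply: cvgD; first exact: k1.
    by rewrite -[X in _ --> X](mulr0 C); apply: cvgMr.
  - rewrite -[X in _ --> X]add0r; apply: cvgD; first exact: k2.
    by rewrite -(mulrN1 C); apply: cvgMr.
have e2 : \int[mu]_(t in D) f t = x * Gamma x - Gamma (x + 1) + C * 1.
  rewrite RintegralD// RintegralB// !RintegralZl//.
  by congr (_ + _ * _); rewrite /Rintegral integral_gamma_bound.
move: e2; rewrite e1 mulr1 => /eqP; rewrite -subr_eq subrr eq_sym subr_eq0.
by move=> /eqP.
Qed.

End GammaFunction.

Section GammaProperties.
Context {R : realType}.
Local Notation mu := (@lebesgue_measure R).
Local Notation D := (`]0, +oo[%classic : set (measurableTypeR R)).
Implicit Types (x y t : R).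

Lemma Gamma_ge0 x : 0 <= Gamma x.
Proof. by apply: Rintegral_ge0 => t _; exact: gamma_fun_ge0. Qed.

Lemma Gamma_gt0 x : 0 < x -> 0 < Gamma x.
Proof.
move=> x0; rewrite lt_neqAle Gamma_ge0 andbT eq_sym; apply/eqP => G0.
have ig := integrable_gamma_fun x0.
have : (\int[mu]_(t in D) `|(gamma_fun x t)%:E| = 0)%E.
  have -> : (\int[mu]_(t in D) `|(gamma_fun x t)%:E| = \int[mu]_(t in D) (gamma_fun x t)%:E)%E.
    by apply: eq_integral => t _; rewrite gee0_abs// lee_fin gamma_fun_ge0.
  rewrite -[LHS]fineK; last exact: (integrable_fin_num measurable_pos ig).
  by rewrite -/(Rintegral mu D (gamma_fun x)) -/(Gamma x) G0.
move/(ae_eq_integral_abs mu measurable_pos (measurable_int _ ig)) => [N [mN N0 H]].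
have : (mu D <= mu N)%E.
  apply: (@le_measure _ R _ mu); [exact: (mem_set (@measurable_pos R))|exact: (mem_set mN)|].
  move=> t Dt; apply: H => /= /(_ Dt) []; apply/eqP.
  rewrite gt_eqF// /gamma_fun mulr_gt0 ?expR_gt0// powR_gt0//.
  by move: Dt; rewrite /= in_itv/= andbT.
by rewrite N0 lebesgue_measure_itv/= ltry.
Qed.

(* [`|ln t|] is at most [t] for [t >= 1] and [t `^ (- a / 2) * (2 / a)] for
   [t <= 1]. *)
Lemma Gamma_lipschitz (a b : R) : 0 < a -> exists2 L, 0 < L & forall x y,
  a <= x <= b -> a <= y <= b -> `|Gamma x - Gamma y| <= L * `|x - y|.
Proof.
move=> a0.
pose L := Gamma (`|b| + 1) + 2 / a * Gamma (a / 2).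
have a20 : 0 < a / 2 by lra. have b10 : 0 < `|b| + 1 by rewrite ltr_wpDl.
have g1 := Gamma_gt0 b10; have g2 := Gamma_gt0 a20.
have a2i : 0 < 2 / a by rewrite divr_gt0.
exists L; first by rewrite /L addr_gt0// mulr_gt0.
move=> x y; wlog xy : x y / x <= y => [H xab yab|].
  have [/H|/ltW /H] := leP x y; first by apply.
  by rewrite distrC (distrC x); apply.
move=> /andP[ax xb] /andP[ay yb].
have x0 : 0 < x by lra. have y0 : 0 < y by lra.
have mD := @measurable_pos R.
have i1 := integrable_gamma_fun b10; have i2 := integrable_gamma_fun a20.
have ix := integrable_gamma_fun x0; have iy := integrable_gamma_fun y0.
have id : mu.-integrable D (EFin \o (fun t => gamma_fun x t - gamma_fun y t)).
  exact: (integrableB mD ix iy).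
have i2' : mu.-integrable D (EFin \o (fun t => 2 / a * gamma_fun (a / 2) t)).
  exact: (integrableZl mD (2 / a) i2).
have is2 : mu.-integrable D (EFin \o (fun t => gamma_fun (`|b| + 1) t + 2 / a * gamma_fun (a / 2) t)).
  exact: (integrableD mD i1 i2').
have is3 : mu.-integrable D (EFin \o (fun t => `|x - y| * (gamma_fun (`|b| + 1) t + 2 / a * gamma_fun (a / 2) t))).
  exact: (integrableZl mD `|x - y| is2).
have -> : Gamma x - Gamma y = \int[mu]_(t in D) (gamma_fun x t - gamma_fun y t).
  by rewrite RintegralB.
apply: le_trans (le_normr_Rintegral mD id) _.
have -> : L * `|x - y| = \int[mu]_(t in D)
    (`|x - y| * (gamma_fun (`|b| + 1) t + 2 / a * gamma_fun (a / 2) t)).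
  by rewrite RintegralZl// RintegralD// RintegralZl// mulrC.
apply: le_Rintegral => //; first exact: integrable_norm id.
move=> t /=; rewrite in_itv/= andbT => t0; clear i1 i2 ix iy id i2' is2 is3 mD L g1 g2.
rewrite /gamma_fun -mulrBl normrM (ger0_norm (expR_ge0 _)).
rewrite [2 / a * _]mulrA -mulrDl mulrA ler_wpM2r ?expR_ge0//.
have ex z : t `^ z = expR (z * ln t) by rewrite /powR gt_eqF.
(* In both cases below the difference of the powers is at most the larger one times |u|, as 1 -
   exp(-|u|) <= |u|. *)
pose u := (y - x) * ln t.
have exy : t `^ (y - 1) = t `^ (x - 1) * expR u.
  by rewrite !ex -expRD; congr expR; rewrite /u; ring.
have eyx : t `^ (x - 1) = t `^ (y - 1) * expR (- u).
  by rewrite !ex -expRD; congr expR; rewrite /u; ring.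
have px : 0 < t `^ (x - 1) by rewrite powR_gt0.
have py : 0 < t `^ (y - 1) by rewrite powR_gt0.
have nxy : `|x - y| = y - x by rewrite ler0_norm ?opprB// subr_le0.
have yx0 : 0 <= y - x by rewrite subr_ge0.
have e1 := expR_ge1Dx (- u); have e2 := expR_ge1Dx u.
have p1 : 0 < t `^ (`|b| + 1 - 1) by rewrite powR_gt0.
have p2 : 0 < t `^ (a / 2 - 1) by rewrite powR_gt0.
have [t1|t1] := leP 1 t.
  have lt0 : 0 <= ln t by rewrite ln_ge0.
  have u0 : 0 <= u by rewrite mulr_ge0.
  have lt1 : ln t <= t by apply/ltW/ln_sublinear.
  have d0 : t `^ (x - 1) <= t `^ (y - 1) by rewrite ler_powR// lerD2r.
  rewrite ler0_norm ?subr_le0// opprB nxy.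
  have h1 : t `^ (y - 1) - t `^ (x - 1) <= t `^ (y - 1) * u.
    rewrite eyx -[X in X - _]mulr1 -mulrBr ler_wpM2l ?(ltW py)//.
    by rewrite lerBlDr -lerBlDl.
  apply: le_trans h1 _; rewrite /u mulrCA ler_wpM2l//.
  apply: le_trans (_ : t `^ (y - 1) * t <= _); first by rewrite ler_wpM2l ?(ltW py).
  apply: le_trans (_ : t `^ (`|b| + 1 - 1) <= _); last by rewrite lerDl mulr_ge0 ?(ltW a2i) ?(ltW p2).
  rewrite -{2}[t]powRr1 ?(ltW t0)// -powR_add// subrK addrK ler_powR//.
  by apply: le_trans yb _; exact: ler_norm.
have lt0 : ln t < 0 by rewrite ln_lt0// t0.
have u0 : u <= 0 by rewrite mulr_ge0_le0 ?(ltW lt0).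
have d0 : t `^ (y - 1) <= t `^ (x - 1).
  by rewrite !ex ler_expR; nra.
rewrite ger0_norm ?subr_ge0// nxy.
have h1 : t `^ (x - 1) - t `^ (y - 1) <= t `^ (x - 1) * - u.
  rewrite exy -[X in X - _]mulr1 -mulrBr ler_wpM2l ?(ltW px)//.
  by rewrite lerBlDr addrC -lerBlDr opprK.
apply: le_trans h1 _; rewrite /u -mulrN mulrCA ler_wpM2l//.
apply: le_trans (_ : 2 / a * t `^ (a / 2 - 1) <= _); last by rewrite lerDr ltW.
have lnb : - ln t <= 2 / a * t `^ (- (a / 2)).
  have := expR_ge1Dx (- (a / 2) * ln t); rewrite -ex => h.
  have -> : - ln t = 2 / a * (- (a / 2) * ln t) by field; lra.
  by rewrite ler_pM2l//; lra.
apply: le_trans (_ : t `^ (x - 1) * (2 / a * t `^ (- (a / 2))) <= _).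
  by rewrite ler_wpM2l ?(ltW px).
rewrite mulrCA ler_pM2l// -powR_add// !ex ler_expR ler_wnM2r ?(ltW lt0)//.
by lra.
Qed.

End GammaProperties.

(** * Poisson tails as integrals *)

Section PoissonTail.
Context {R : realType}.
Local Notation mu := (@lebesgue_measure R).
Local Notation D := (`]0, +oo[%classic : set (measurableTypeR R)).
Implicit Types (x y t : R).

Definition pois_tail (k : nat) x : R := 1 - \sum_(j < k) pois x j.

Lemma is_derive_pois0 x : is_derive x 1 (@pois R ^~ 0) (- pois x 0).
Proof.
rewrite (_ : pois ^~ 0 = fun y : R => expR (- y)); last first.
  by apply/funext => y; rewrite /pois expr0 fact0 divr1 mulr1.
by apply: is_derive_eq; rewrite /GRing.scale/= /pois expr0 fact0 divr1; ring.
Qed.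

Lemma is_derive_poisS k x :
  is_derive x 1 (@pois R ^~ k.+1) (pois x k - pois x k.+1).
Proof.
have a1 : k.+1%:R != 0 :> R by rewrite pnatr_eq0.
have af : k`!%:R != 0 :> R by rewrite pnatr_eq0 -lt0n fact_gt0.
have -> : pois x k - pois x k.+1 =
    expR (- x) * (k.+1%:R * x ^+ k - x ^+ k.+1) * (k.+1)`!%:R^-1.
  by rewrite /pois factS natrM; field; rewrite nat1r a1 af.
rewrite /pois; move: ((k.+1)`!%:R^-1) => f.
rewrite (_ : (fun y : R => _) = fun y => f * (expR (- y) * y ^+ k.+1)); last first.
  by apply/funext => y; ring.
have dX : is_derive x 1 (fun y : R => y ^+ k.+1) (k.+1%:R * x ^+ k).
  have := is_deriveX k.+1 (@is_derive_id _ R^o x 1).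
  by rewrite exprfctE /GRing.scale/= mulr1.
have dE : is_derive x 1 (fun y : R => expR (- y)) (- expR (- x)).
  by apply: is_derive_eq; rewrite /GRing.scale/=; ring.
have := is_deriveZ f (is_deriveM dE dX).
by congr is_derive; rewrite /GRing.scale/=; ring.
Qed.

(** The derivatives of the successive weights telescope. *)
Lemma is_derive_pois_tail k x : is_derive x 1 (pois_tail k.+1) (pois x k).
Proof.
elim: k => [|k IH].
  rewrite (_ : pois_tail 1 = fun x => 1 - pois x 0).
    have := is_deriveB (is_derive_cst (1 : R) x 1) (is_derive_pois0 x).
    by rewrite sub0r opprK.
  by apply/funext => y; rewrite /pois_tail big_ord_recl big_ord0 addr0.
rewrite (_ : pois_tail k.+2 = fun x => pois_tail k.+1 x - pois x k.+1).
  have := is_deriveB IH (is_derive_poisS k x).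
  by rewrite opprB addrCA subrr addr0.
by apply/funext => y; rewrite /pois_tail big_ord_recr/=; ring.
Qed.

Lemma continuous_pois k : continuous (@pois R ^~ k).
Proof.
move=> x; apply/differentiable_continuous/derivable1_diffP.
case: k => [|k]; first by have d := is_derive_pois0 x.
by have d := is_derive_poisS k x.
Qed.

Lemma pois_tail0 k : pois_tail k.+1 0 = 0.
Proof.
rewrite /pois_tail big_ord_recl big1 /pois/=.
  by rewrite oppr0 expR0 fact0 expr0 invr1 !mul1r addr0 subrr.
by move=> i _; rewrite exprS !mul0r mulr0.
Qed.

Lemma pois_gamma_fun k t : 0 < t -> pois t k = k`!%:R^-1 * gamma_fun k.+1%:R t.
Proof.
move=> t0; rewrite /pois /gamma_fun -natr1 addrK powR_mulrn ?(ltW t0)//.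
by ring.
Qed.

Lemma integrable_pois k : mu.-integrable D (EFin \o (@pois R ^~ k)).
Proof.
have i := integrableZl (@measurable_pos R) k`!%:R^-1
  (integrable_gamma_fun (ltr0Sn R k)).
apply: (eq_integrable (@measurable_pos R)) i => t.
by rewrite inE/= in_itv/= andbT => t0; rewrite pois_gamma_fun// EFinM.
Qed.

(** The tail is a primitive of [pois t k]. The upper limit is written as an indicator so that
    summing over the urns counts those with intensity above [t]. *)
Lemma pois_tail_integral k x : 0 < x ->
  pois_tail k.+1 x = \int[mu]_(t in D) (pois t k * ((t : R) < x)%R%:R).
Proof.
move=> x0.
have e : (\int[mu]_(t in `[0%R, x]) (pois t k)%:E)%E = (pois_tail k.+1 x - pois_tail k.+1 0)%:E.
  rewrite EFinB; apply: continuous_FTC2 => //.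
  - by apply: continuous_subspaceT; exact: continuous_pois.
  - have c y : {for y, continuous (pois_tail k.+1)}.
      apply/differentiable_continuous/derivable1_diffP.
      by have d := is_derive_pois_tail k y.
    split.
    + by move=> y _; have d := is_derive_pois_tail k y.
    + by apply: cvg_at_right_filter; exact: c.
    + by apply: cvg_at_left_filter; exact: c.
  - by move=> y _; have d := is_derive_pois_tail k y; rewrite derive1E derive_val.
rewrite pois_tail0 subr0 in e.
have -> : pois_tail k.+1 x = \int[mu]_(t in `[0%R, x]) (pois t k) by rewrite /Rintegral e.
have mp : measurable_fun [set: measurableTypeR R] (@pois R ^~ k).
  by apply: continuous_measurable_fun; exact: continuous_pois.
have ip : mu.-integrable `[0, x] (EFin \o @pois R ^~ k).
  apply: continuous_compact_integrable; first exact: segment_compact.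
  by apply: continuous_subspaceT; exact: continuous_pois.
rewrite -Rintegral_itv_bndo_bndc; last first.
  by apply: (integrableS _ _ _ ip) => //; apply: subset_itvl; rewrite bnd_simp.
rewrite -Rintegral_itv_obnd_cbnd; last first.
  by apply: (integrableS _ _ _ ip) => //; apply: subset_itv; rewrite bnd_simp.
rewrite [LHS]Rintegral_mkcond [RHS]Rintegral_mkcond; apply: eq_Rintegral => t _.
rewrite !patchE; case: (boolP (t \in D)) => tD.
  rewrite mem_setE in_itv/=; move: tD; rewrite mem_setE in_itv/= andbT => ->/=.
  by case: (t < x); rewrite ?mulr1 ?mulr0.
rewrite ifF//; apply/negbTE; apply: contraNN tD; rewrite !mem_setE !in_itv/= andbT.
by case/andP.
Qed.

(** In each minimum one term is the cutoff and the other the count up to rounding. The loss of at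
    most one is what keeps the later errors bounded uniformly in the intensity. *)
Lemma count_lt (u : R) (K : nat) : 0 <= u ->
  Num.min K%:R (u - 1) <= \sum_(i < K) ((i.+1%:R < u)%R%:R : R) <= Num.min K%:R u.
Proof.
move=> u0; elim: K => [|K /andP[lo hi]].
  by rewrite big_ord0 ge_min lexx/= le_min lexx u0.
rewrite big_ord_recr/=; set S := \sum_(i < K) _ in lo hi *.
have K1 : K.+1%:R = K%:R + 1 :> R by rewrite -natr1.
move: hi; rewrite le_min => /andP[hi1 hi2].
have [h|h] := ltP K.+1%:R u; rewrite !(ge_min, le_min) K1 ?mulr1n ?mulr0n in h *.
  move: lo; rewrite ge_min => /orP[lo|lo]; lra.
rewrite addr0 hi2 andbT; move: lo; rewrite ge_min => /orP[lo|lo].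
  by apply/orP; right; lra.
by apply/orP; right; lra.
Qed.

End PoissonTail.

(** * Sums over urns with power-law probabilities *)

Section PowerLaw.
Context {R : realType}.
Local Notation mu := (@lebesgue_measure R).
Local Notation D := (`]0, +oo[%classic : set (measurableTypeR R)).
Variable theta : R.
Hypothesis theta01 : 0 < theta < 1.

Let theta0 : 0 < theta. Proof. by case/andP: theta01. Qed.
Let theta1 : theta < 1. Proof. by case/andP: theta01. Qed.
Let shape_gt0 (k : nat) : 0 < k.+1%:R - theta.
Proof. by rewrite subr_gt0 (lt_le_trans theta1)// ler1n. Qed.

Definition power_seq (a : R) (i : nat) : R := a * i.+1%:R `^ (- theta^-1).

(** The solution u of a u^(-1/theta) = t: up to rounding, the number of urns with intensity above
    [t]. *)
Definition rate (a t : R) : R := a `^ theta * t `^ (- theta).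

Lemma power_seq_gt0 a i : 0 < a -> 0 < power_seq a i.
Proof. by move=> a0; rewrite mulr_gt0// powR_gt0. Qed.

Lemma power_seq_scale a b i : power_seq (a * b) i = a * power_seq b i.
Proof. by rewrite /power_seq mulrA. Qed.

Lemma lt_power_seq (a t : R) i : 0 < a -> 0 < t ->
  (t < power_seq a i) = (i.+1%:R < rate a t).
Proof.
move=> a0 t0; have i0 : 0 < i.+1%:R :> R by [].
rewrite -ltr_ln ?posrE ?power_seq_gt0//.
rewrite -[RHS]ltr_ln ?posrE ?mulr_gt0 ?powR_gt0//.
rewrite !lnM ?posrE ?powR_gt0// !ln_powR.
rewrite -(ltr_pM2l theta0 (ln t)); apply/idP/idP; rewrite mulrDr mulrA mulrN mulfV ?gt_eqF//; lra.
Qed.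

Lemma pois_rate k a t : 0 < t ->
  pois t k * rate a t = a `^ theta / k`!%:R * gamma_fun (k.+1%:R - theta) t.
Proof.
move=> t0; rewrite pois_gamma_fun// /rate /gamma_fun.
rewrite (_ : k.+1%:R - theta - 1 = (k.+1%:R - 1) + - theta); last by ring.
by rewrite [t `^ (_ + - theta)]powR_add//; ring.
Qed.

Lemma integrable_pois_rate k a : mu.-integrable D (EFin \o (fun t => pois t k * rate a t)).
Proof.
have i := integrableZl (@measurable_pos R) (a `^ theta / k`!%:R)
  (integrable_gamma_fun (shape_gt0 k)).
apply: (eq_integrable (@measurable_pos R)) i => t.
by rewrite inE/= in_itv/= andbT => t0; rewrite pois_rate// EFinM.
Qed.

Lemma Rintegral_pois_rate k a :
  \int[mu]_(t in D) (pois t k * rate a t) = a `^ theta * (Gamma (k.+1%:R - theta) / k`!%:R).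
Proof.
have mD := @measurable_pos R; have i := integrable_gamma_fun (shape_gt0 k).
transitivity (\int[mu]_(t in D) (a `^ theta / k`!%:R * gamma_fun (k.+1%:R - theta) t)).
  apply: eq_Rintegral => t; rewrite inE/= in_itv/= andbT => t0.
  exact: pois_rate.
by rewrite RintegralZl// mulrA mulrAC.
Qed.

Lemma measurable_pois k : measurable_fun D (@pois R ^~ k).
Proof.
by apply: measurable_funTS; apply: continuous_measurable_fun; exact: continuous_pois.
Qed.

Lemma measurable_rate a : measurable_fun D (rate a).
Proof.
by apply: measurable_funTS; apply: measurable_funM => //; exact: measurable_powR.
Qed.

Lemma integrable_pois_dominated k (a M : R) (g : R -> R) : measurable_fun D g ->
  (forall t, 0 < t -> `|g t| <= rate a t + M) ->
  mu.-integrable D (EFin \o (fun t => pois t k * g t)).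
Proof.
move=> mg gM; have mD := @measurable_pos R.
have i1 := integrableZl mD M (@integrable_pois R k).
have i : mu.-integrable D (EFin \o (fun t => pois t k * rate a t + M * pois t k)).
  exact: (integrableD mD (integrable_pois_rate k a) i1).
apply: (le_integrable _ _ _ i) => //.
  by apply/measurable_EFinP; apply: measurable_funM => //; exact: measurable_pois.
move=> t /=; rewrite in_itv/= andbT => t0.
rewrite lee_fin normrM (ger0_norm (pois_ge0 _ (ltW t0))).
apply: le_trans (ler_norm _); rewrite [M * _]mulrC -mulrDr ler_wpM2l ?gM//.
by rewrite pois_ge0// ltW.
Qed.

Definition count_rate (a : R) (K : nat) (t : R) : R := \sum_(i < K) (i.+1%:R < rate a t)%R%:R.

Lemma rate_ge0 a t : 0 <= rate a t.
Proof. by rewrite mulr_ge0 ?powR_ge0. Qed.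

Lemma count_rateP a K t : Num.min K%:R (rate a t - 1) <= count_rate a K t <= Num.min K%:R (rate a t).
Proof. exact: count_lt (rate_ge0 a t). Qed.

Lemma count_rate_le a K t : 0 <= count_rate a K t <= rate a t.
Proof.
have /andP[_] := count_rateP a K t; rewrite le_min => /andP[_ ->]; rewrite andbT.
by apply: sumr_ge0 => i _; rewrite ler0n.
Qed.

Lemma measurable_count_rate a K : measurable_fun D (count_rate a K).
Proof.
rewrite (_ : count_rate a K = fun t => \sum_(i < K) \1_(`]i.+1%:R, +oo[%classic : set (measurableTypeR R)) (rate a t)).
  apply: measurable_sum => i; have m : measurable_fun [set: measurableTypeR R] (\1_`]i.+1%:R, +oo[%classic : measurableTypeR R -> R).
    by apply: measurable_indic; exact: measurable_itv.
  exact: (measurableT_comp m (measurable_rate a)).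
by apply/funext => t; apply: eq_bigr => i _; rewrite indicE mem_setE in_itv/= andbT.
Qed.

Lemma integrable_count_rate k a K :
  mu.-integrable D (EFin \o (fun t => pois t k * count_rate a K t)).
Proof.
apply: (@integrable_pois_dominated _ a 0); first exact: measurable_count_rate.
by move=> t t0; have /andP[h1 h2] := count_rate_le a K t; rewrite ger0_norm// addr0.
Qed.

Lemma pois_tail_sum k a K : 0 < a ->
  \sum_(i < K) pois_tail k.+1 (power_seq a i) =
  \int[mu]_(t in D) (pois t k * count_rate a K t).
Proof.
move=> a0; have mD := @measurable_pos R; elim: K => [|K IH].
  rewrite big_ord0; under eq_Rintegral do rewrite /count_rate big_ord0 mulr0.
  by rewrite /Rintegral integral0.
rewrite big_ord_recr IH/= pois_tail_integral ?power_seq_gt0//.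
have e : {in D, (fun t => pois t k * ((t : R) < power_seq a K)%R%:R) =1
    fun t => pois t k * (count_rate a K.+1 t - count_rate a K t)}.
  move=> t; rewrite inE/= in_itv/= andbT => t0.
  by rewrite lt_power_seq// /count_rate big_ord_recr/= [X in X - _]addrC addrK.
rewrite (eq_Rintegral mu e).
have i1 := integrable_count_rate k a K; have i2 := integrable_count_rate k a K.+1.
under [X in _ + X]eq_Rintegral do rewrite mulrBr.
by rewrite RintegralB// addrCA subrr addr0.
Qed.

Lemma pois_tail_sum_le k a K : 0 < a ->
  \sum_(i < K) pois_tail k.+1 (power_seq a i) <= a `^ theta * (Gamma (k.+1%:R - theta) / k`!%:R).
Proof.
move=> a0; have mD := @measurable_pos R; rewrite pois_tail_sum// -Rintegral_pois_rate.
apply: le_Rintegral => //; [exact: integrable_count_rate|exact: integrable_pois_rate|].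
move=> t /=; rewrite in_itv/= andbT => t0; rewrite ler_wpM2l ?pois_ge0 ?(ltW t0)//.
by have /andP[] := count_rate_le a K t.
Qed.

(** The constant does not depend on [a]: rounding costs the integral of [pois t k], and the
    remaining 1 pays for the finite cutoff [K]. *)
Lemma pois_tail_sum_ge k : exists C, forall a, 0 < a ->
  \forall K \near \oo, a `^ theta * (Gamma (k.+1%:R - theta) / k`!%:R) - C
    <= \sum_(i < K) pois_tail k.+1 (power_seq a i).
Proof.
have mD := @measurable_pos R.
pose c := \int[mu]_(t in D) pois t k; exists (c + 1) => a a0.
pose f K t := pois t k * Num.min K%:R (rate a t - 1).
have mmin K : measurable_fun D (fun t => Num.min K%:R (rate a t - 1)).
  apply: measurable_minr => //; apply: measurable_funB => //; exact: measurable_rate.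
have bmin K t : `|Num.min K%:R (rate a t - 1)| <= rate a t + 1.
  have := rate_ge0 a t; have [h r0|h r0] := leP K%:R (rate a t - 1).
    by rewrite ger0_norm//; lra.
  by rewrite ler_norml; apply/andP; split; lra.
have ir := integrable_pois_rate k a; have ip := @integrable_pois R k.
have ifK K : mu.-integrable D (EFin \o f K).
  by apply: (@integrable_pois_dominated _ a 1).
have lim : \int[mu]_(t in D) f K t @[K --> \oo] --> \int[mu]_(t in D) (pois t k * (rate a t - 1)).
  apply: (@Rintegral_cvg_on R _ (measurableTypeR R) mu D f _ (fun t => pois t k * (rate a t + 1))) => //.
  - by move=> K; apply: measurable_funM => //; exact: measurable_pois.
  - move=> t _; apply: cvgMr; apply: (@cvg_near_cst _ _ _ _ _).
    near=> K; apply/min_idPr; near: K; exact: nbhs_infty_ger.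
  - have := @integrable_pois_dominated k a 1 (fun t => rate a t + 1); apply.
      by apply: measurable_funD => //; exact: measurable_rate.
    by move=> t _; rewrite ger0_norm// addr_ge0// rate_ge0.
  - move=> K t /=; rewrite in_itv/= andbT => t0.
    by rewrite normrM (ger0_norm (pois_ge0 _ (ltW t0))) ler_wpM2l ?pois_ge0 ?(ltW t0).
have E : \int[mu]_(t in D) (pois t k * (rate a t - 1)) =
    a `^ theta * (Gamma (k.+1%:R - theta) / k`!%:R) - c.
  under eq_Rintegral do rewrite mulrBr mulr1.
  by rewrite RintegralB// Rintegral_pois_rate.
rewrite E in lim; move/cvgrPdist_le: lim => /(_ 1 ltr01) lim.
near=> K; have : `|a `^ theta * (Gamma (k.+1%:R - theta) / k`!%:R) - c -
  \int[mu]_(t in D) f K t| <= 1 by near: K.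
set I := \int[mu]_(t in D) f K t; set G := a `^ theta * _ => h.
apply: le_trans (_ : I <= _).
  by move: h; rewrite ler_norml => /andP[_]; lra.
rewrite pois_tail_sum//; apply: le_Rintegral => //; first exact: integrable_count_rate.
move=> t /=; rewrite in_itv/= andbT => t0; rewrite ler_wpM2l ?pois_ge0 ?(ltW t0)//.
by have /andP[] := count_rateP a K t.
Unshelve. all: by end_near. Qed.

End PowerLaw.

(** * Poisson means whose total follows a power law *)

Section Profile.
Context {R : realType}.
Variable theta : R.
Hypothesis theta01 : 0 < theta < 1.
Implicit Types (x y a : R) (rho : R -> R).

Lemma pois_le1 k x : 0 <= x -> pois x k <= 1.
Proof.
move=> x0; apply: le_trans (sum_pois_le1 k.+1 x0); rewrite big_ord_recr/= lerDr.
by apply: sumr_ge0 => i _; exact: pois_ge0.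
Qed.

Lemma pois_mul_le k x : 0 <= x -> x * pois x k <= k.+1%:R.
Proof. by move=> x0; rewrite -poisS ler_piMl// pois_le1. Qed.

Lemma pois_tail_ge0 k x : 0 <= x -> 0 <= pois_tail k x.
Proof. by move=> x0; rewrite subr_ge0 sum_pois_le1. Qed.

Lemma pois_tail_le1 k x : 0 <= x -> pois_tail k x <= 1.
Proof. by move=> x0; rewrite gerBl; apply: sumr_ge0 => i _; exact: pois_ge0. Qed.

(* [rho] is the mean of a functional of the number of balls in an urn, as a
   function of the Poisson mean; [G * a `^ theta] is the total mean for the
   urn intensities [a * i `^ (- theta^-1)]. *)
Definition profile rho (G : R) : Prop :=
  [/\ exists M, forall x, 0 < x -> `|rho x| <= M,
      exists C, 0 <= C /\ forall x y, 0 < x -> `|y - x| <= x / 2 ->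
        `|rho y - rho x| <= C * (`|y - x| / x * Num.min 1 x) &
      exists C, forall a, 0 < a -> \forall K \near \oo,
        `|\sum_(i < K) rho (power_seq theta a i) - G * a `^ theta| <= C].

(** The derivative [pois z k] is at most 1 and at most (k + 1) / z; with z >= x / 2 this gives both
    branches of the minimum. *)
Lemma profile_pois_tail k :
  profile (pois_tail k.+1) (Gamma (k.+1%:R - theta) / k`!%:R).
Proof.
split.
- exists 1 => x x0; rewrite ger0_norm ?pois_tail_ge0 ?(ltW x0)//.
  by rewrite pois_tail_le1// ltW.
- have k2 : 1 <= k.+1%:R :> R by rewrite ler1n.
  exists (2 * k.+1%:R); split; first by rewrite mulr_ge0.
  move=> x y x0 yx.
  have df (z : R) : is_derive z 1 (pois_tail k.+1) (pois z k) by exact: is_derive_pois_tail.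
  have zx z : (x <= z <= y) || (y <= z <= x) -> x / 2 <= z.
    by move: yx; rewrite ler_norml => /andP[h1 h2] /orP[]/andP[h3 h4]; lra.
  have b1 : `|pois_tail k.+1 y - pois_tail k.+1 x| <= 1 * `|y - x|.
    apply: mvt_le => z // /zx z2; have z0 : 0 <= z by apply: le_trans z2; lra.
    by rewrite ger0_norm ?pois_ge0 ?pois_le1.
  have b2 : `|pois_tail k.+1 y - pois_tail k.+1 x| <= 2 * k.+1%:R / x * `|y - x|.
    apply: mvt_le => z // /zx z2; have z0 : 0 <= z by apply: le_trans z2; lra.
    rewrite ger0_norm ?pois_ge0// ler_pdivlMr//.
    have := pois_mul_le k z0; have := pois_ge0 k z0; nra.
  have [x1|x1] := leP 1 x.
    apply: le_trans b2 _; rewrite le_eqVlt; apply/orP; left; apply/eqP; ring.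
  apply: le_trans b1 _; rewrite mul1r -mulrA divfK ?gt_eqF//.
  by rewrite mulrA ler_peMl//; lra.
- have [C HC] := pois_tail_sum_ge theta01 k; exists `|C| => a a0.
  have {}HC := HC a a0; near=> K.
  have := pois_tail_sum_le theta01 k K a0.
  have : a `^ theta * (Gamma (k.+1%:R - theta) / k`!%:R) - C <=
    \sum_(i < K) pois_tail k.+1 (power_seq theta a i) by near: K.
  rewrite [_ * a `^ theta]mulrC.
  set S := \sum_(i < K) _; set g := a `^ theta * _ => h1 h2.
  by have := ler_norm C => h3; rewrite ler_norml; apply/andP; split; lra.
Unshelve. all: by end_near. Qed.

Lemma profileZ b rho G : profile rho G -> profile (fun x => b * rho x) (b * G).
Proof.
move=> [[M HM] [C [C0 HC]] [E HE]]; split.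
- exists (`|b| * M) => x x0; rewrite normrM ler_wpM2l ?HM//.
- exists (`|b| * C); split; first by rewrite mulr_ge0.
  by move=> x y x0 yx; rewrite -mulrBr normrM -[_ * C * _]mulrA ler_wpM2l ?HC.
- exists (`|b| * E) => a a0; have {}HE := HE a a0; near=> K.
  rewrite -mulr_sumr -mulrA -mulrBr normrM ler_wpM2l//; near: K; exact: HE.
Unshelve. all: by end_near. Qed.

Lemma profileD rho1 rho2 G1 G2 : profile rho1 G1 -> profile rho2 G2 ->
  profile (fun x => rho1 x + rho2 x) (G1 + G2).
Proof.
move=> [[M1 HM1] [C1 [C10 HC1]] [E1 HE1]] [[M2 HM2] [C2 [C20 HC2]] [E2 HE2]]; split.
- exists (M1 + M2) => x x0; apply: le_trans (ler_normD _ _) _.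
  by rewrite lerD ?HM1 ?HM2.
- exists (C1 + C2); split; first by rewrite addr_ge0.
  move=> x y x0 yx; rewrite opprD addrACA mulrDl.
  by apply: le_trans (ler_normD _ _) _; rewrite lerD ?HC1 ?HC2.
- exists (E1 + E2) => a a0; have {}HE1 := HE1 a a0; have {}HE2 := HE2 a a0; near=> K.
  rewrite big_split/= mulrDl opprD addrACA.
  apply: le_trans (ler_normD _ _) _; apply: lerD; near: K; [exact: HE1|exact: HE2].
Unshelve. all: by end_near. Qed.

Lemma profileB rho1 rho2 G1 G2 : profile rho1 G1 -> profile rho2 G2 ->
  profile (fun x => rho1 x - rho2 x) (G1 - G2).
Proof.
move=> p1 /(profileZ (-1)) p2; have := profileD p1 p2; rewrite mulN1r.
by congr profile; apply/funext => x; rewrite mulN1r.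
Qed.

(** Dilating the argument multiplies all intensities by [b], that is, [a] by [b]. The assumption b
    >= 1 gives min(1, b x) <= b min(1, x). *)
Lemma profile_dilate b rho G : 1 <= b -> profile rho G ->
  profile (fun x => rho (b * x)) (b `^ theta * G).
Proof.
move=> b1 [[M HM] [C [C0 HC]] [E HE]]; have b0 : 0 < b by lra.
split.
- by exists M => x x0; apply: HM; rewrite mulr_gt0.
- exists (C * b); split; first by rewrite mulr_ge0 ?(ltW b0).
  move=> x y x0 yx.
  have e : `|b * y - b * x| = b * `|y - x| by rewrite -mulrBr normrM gtr0_norm.
  have := HC (b * x) (b * y); rewrite mulr_gt0// e => /(_ isT) H.
  apply: le_trans (H _) _; first by rewrite -mulrA ler_pM2l.
  rewrite -[C * b * _]mulrA ler_wpM2l//.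
  rewrite -mulf_div divff ?gt_eqF// mul1r mulrCA ler_wpM2l ?divr_ge0 ?(ltW x0)//.
  have [h|h] := leP 1 x; have [h'|h'] := leP 1 (b * x); nra.
- exists E => a a0; have ba0 : 0 < b * a by rewrite mulr_gt0.
  have {}HE := HE _ ba0; near=> K.
  have -> : \sum_(i < K) rho (b * power_seq theta a i) = \sum_(i < K) rho (power_seq theta (b * a) i).
    by apply: eq_bigr => i _; rewrite power_seq_scale.
  rewrite [b `^ theta * G]mulrC -mulrA -powRM ?(ltW b0) ?(ltW a0)//.
  by near: K; exact: HE.
Unshelve. all: by end_near. Qed.

(** The errors are bounded while a^theta is not, so the constants inherit the pointwise order. This
    yields inequalities between Gamma values without touching the Gamma integral. *)
Lemma profile_le rho1 rho2 G1 G2 : (forall x, 0 < x -> rho1 x <= rho2 x) ->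
  profile rho1 G1 -> profile rho2 G2 -> G1 <= G2.
Proof.
move=> le12 [_ _ [C1 H1]] [_ _ [C2 H2]].
have H a : 0 < a -> (G1 - G2) * a `^ theta <= C1 + C2.
  move=> a0; have {}H1 := H1 a a0; have {}H2 := H2 a a0.
  have [K [h1 h2]] : exists K : nat,
      `|\sum_(i < K) rho1 (power_seq theta a i) - G1 * a `^ theta| <= C1 /\
      `|\sum_(i < K) rho2 (power_seq theta a i) - G2 * a `^ theta| <= C2.
    have [N _ HN] : \forall K \near \oo,
      (`|\sum_(i < K) rho1 (power_seq theta a i) - G1 * a `^ theta| <= C1 /\
      `|\sum_(i < K) rho2 (power_seq theta a i) - G2 * a `^ theta| <= C2).
      by near=> K; split; near: K.
    by exists N; apply: HN => /=.
  have : \sum_(i < K) rho1 (power_seq theta a i) <= \sum_(i < K) rho2 (power_seq theta a i).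
    by apply: ler_sum => i _; rewrite le12// power_seq_gt0.
  by move: h1 h2; rewrite !ler_norml => /andP[? ?] /andP[? ?]; lra.
rewrite leNgt; apply/negP => G21.
have C0 : 0 < `|C1 + C2| + 1 by rewrite ltr_wpDl.
(* Taking a^theta = u makes (G1 - G2) a^theta equal to |C1 + C2| + 1. *)
pose u := (`|C1 + C2| + 1) / (G1 - G2).
have u0 : 0 < u by rewrite divr_gt0// subr_gt0.
have th0 : theta != 0 by case/andP: theta01 => ? _; rewrite gt_eqF.
have := H (u `^ theta^-1); rewrite powR_gt0// => /(_ isT).
rewrite -powRrM mulVf// powRr1 ?(ltW u0)// /u mulrCA divff ?mulr1 ?gt_eqF ?subr_gt0//.
by have := ler_norm (C1 + C2); lra.
Unshelve. all: by end_near. Qed.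

End Profile.

(** * From the exact power law to the urn probabilities *)

Section PowerLawSums.
Context {R : realType}.
Variable theta : R.
Hypothesis theta01 : 0 < theta < 1.
Implicit Types (x y a : R) (rho : R -> R).

Let theta0 : 0 < theta. Proof. by case/andP: theta01. Qed.
Let theta1 : theta < 1. Proof. by case/andP: theta01. Qed.

Lemma near_nat_powR (s A : R) : 0 < s -> \forall n \near \oo, A <= n%:R `^ s.
Proof.
move=> s0; have h := cvg_comp _ _ (@cvgr_idn R) (cvg_powRy s0).
by move/cvgryPge: h; apply.
Qed.

Lemma min1_le_pois_tail x : 0 < x -> Num.min 1 x <= 2 * pois_tail 1 x.
Proof.
move=> x0; rewrite /pois_tail big_ord_recl big_ord0 addr0 /pois/= expr0 fact0 divr1 mulr1.
have e1 := expR_ge1Dx x; have e0 := expR_gt0 (- x).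
have E : expR (- x) * expR x = 1 by rewrite -expRD addNr expR0.
have h : expR (- x) * (1 + x) <= 1 by rewrite -[leRHS]E ler_wpM2l ?(ltW e0).
by have [x1|x1] := leP 1 x; nra.
Qed.

Lemma sum_min1_le : exists2 C, 0 < C & forall a K, 0 < a ->
  \sum_(i < K) Num.min 1 (power_seq theta a i) <= C * a `^ theta.
Proof.
have G0 : 0 < Gamma (1 - theta) by rewrite Gamma_gt0// subr_gt0.
exists (2 * Gamma (1 - theta)); first by rewrite mulr_gt0.
move=> a K a0; apply: le_trans (_ : \sum_(i < K) 2 * pois_tail 1 (power_seq theta a i) <= _).
  by apply: ler_sum => i _; apply: min1_le_pois_tail; exact: power_seq_gt0.
rewrite -mulr_sumr -mulrA ler_pM2l//.
apply: le_trans (pois_tail_sum_le theta01 0 K a0) _.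
by rewrite fact0 divr1 mulrC.
Qed.

Lemma sum_inv_sqrt_le (u : R) K : 0 <= u ->
  \sum_(i < K) (i.+1%:R <= u)%R%:R / Num.sqrt i.+1%:R <= 2 * Num.sqrt u.
Proof.
move=> u0; apply: le_trans (_ : 2 * Num.sqrt (Num.min K%:R u) <= _); last first.
  by rewrite ler_pM2l// ler_sqrt// ge_min lexx orbT.
elim: K => [|K IH]; first by rewrite big_ord0 mulr_ge0 ?sqrtr_ge0.
rewrite big_ord_recr/=; have K1 : K%:R + 1 = K.+1%:R :> R by rewrite natr1.
have [h|h] := leP K.+1%:R u; last first.
  rewrite mul0r addr0; apply: le_trans IH _.
  rewrite ler_pM2l// ler_sqrt ?le_min ?u0 ?ler0n// ge_min.
  by rewrite lexx orbT.
move: IH; rewrite mul1r (min_idPl _); last by apply: le_trans h; rewrite ler_nat.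
set S := \sum_(i < K) _; move=> IH.
have s0 : 0 <= Num.sqrt K%:R :> R by exact: sqrtr_ge0.
have s1 : 0 < Num.sqrt K.+1%:R :> R by rewrite sqrtr_gt0.
have q0 : Num.sqrt K%:R ^+ 2 = K%:R :> R by rewrite sqr_sqrtr.
have q1 : Num.sqrt K.+1%:R ^+ 2 = K%:R + 1 :> R by rewrite sqr_sqrtr// K1.
apply: le_trans (lerD IH (lexx _)) _.
rewrite -(ler_pM2r s1) mulrDl mulVf ?gt_eqF//; nra.
Qed.

(** The cut is at i = a^theta, where the intensity passes 1. Below it the weights i^(-1/2) alone sum
    to O(a^(theta/2)); above it they are at most a^(-theta/2), and [sum_min1_le] applies. *)
Lemma sum_weighted_min1_le : exists2 C, 0 < C & forall a K, 0 < a ->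
  \sum_(i < K) i.+1%:R `^ (- 2^-1) * Num.min 1 (power_seq theta a i) <= C * a `^ (theta / 2).
Proof.
have [C C0 HC] := sum_min1_le; exists (2 + C); first lra.
move=> a K a0; pose s := a `^ (theta / 2).
have s0 : 0 < s by rewrite powR_gt0.
have s2 : s * s = a `^ theta by rewrite -powR_add//; congr (_ `^ _); field.
have su : Num.sqrt (a `^ theta) = s.
  by rewrite -s2 -expr2 sqrtr_sqr gtr0_norm.
apply: le_trans (_ : \sum_(i < K) ((i.+1%:R <= a `^ theta)%R%:R / Num.sqrt i.+1%:R +
   s^-1 * Num.min 1 (power_seq theta a i)) <= _).
  apply: ler_sum => i _.
  have -> : i.+1%:R `^ (- 2^-1) = (Num.sqrt i.+1%:R)^-1 :> R.
    by rewrite powRN powR12_sqrt.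
  have x0 := power_seq_gt0 theta i a0.
  have m0 : 0 <= Num.min 1 (power_seq theta a i) by rewrite le_min ler01 ltW.
  have m1 : Num.min 1 (power_seq theta a i) <= 1 by rewrite ge_min lexx.
  have r0 : 0 < Num.sqrt i.+1%:R :> R by rewrite sqrtr_gt0.
  have [h|h] := leP i.+1%:R (a `^ theta).
    rewrite mul1r; apply: le_trans (_ : (Num.sqrt i.+1%:R)^-1 <= _).
      by rewrite ler_piMr// invr_ge0 ltW.
    by rewrite lerDl mulr_ge0// invr_ge0 ltW.
  rewrite mul0r add0r ler_wpM2r// lef_pV2 ?posrE//.
  by rewrite -su ler_sqrt// ltW.
rewrite big_split/= -mulr_sumr.
have h1 := sum_inv_sqrt_le K (powR_ge0 a theta); rewrite su in h1.
apply: le_trans (_ : 2 * s + C * s <= _); last by rewrite -/s [(2 + C) * s]mulrDl.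
by apply: lerD => //; rewrite ler_pdivrMl// mulrCA s2 HC.
Qed.

Lemma sum_ltn_le (I0 K : nat) : \sum_(i < K) (i < I0)%N%:R <= I0%:R :> R.
Proof.
apply: le_trans (_ : (minn K I0)%:R <= _); last by rewrite ler_nat geq_minr.
elim: K => [|K IH]; first by rewrite big_ord0 min0n.
rewrite big_ord_recr/=; case: (ltnP K I0) => h.
  move: IH; rewrite (minn_idPl (ltnW h)) (minn_idPl h) -natr1 => IH; rewrite lerD2r; exact: IH.
by move: IH; rewrite (minn_idPr h) (minn_idPr (leqW h)) addr0.
Qed.

Variables (p : nat -> R) (c : R) (eps : nat -> R).
Hypothesis p_gt0 : forall i, 0 < p i.
Hypothesis c_gt0 : 0 < c.
Hypothesis eps_o : eps =o_\oo (fun i => i.+1%:R `^ (- 2^-1)).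
Hypothesis p_eq : forall i, p i = power_seq theta c i * (1 + eps i).

Lemma eps_near e : 0 < e -> exists I0 : nat, forall i, (I0 <= i)%N ->
  `|eps i| <= e * i.+1%:R `^ (- 2^-1).
Proof.
move=> e0; have /eqoP /(_ e e0) [I0 _ H] := eps_o; exists I0 => i /H /=.
by rewrite (ger0_norm (powR_ge0 _ _)).
Qed.

Lemma powR_N2_le1 i : i.+1%:R `^ (- 2^-1) <= 1 :> R.
Proof.
rewrite -[leRHS](powRr0 i.+1%:R) ler_powR ?ler1n//; lra.
Qed.

Lemma urn_le : exists2 A, 0 < A & forall i, p i <= power_seq theta A i.
Proof.
have [I0 HI] := eps_near ltr01.
pose A := 2 * c + \sum_(i < I0) p i / i.+1%:R `^ (- theta^-1).
have pos i : 0 < i.+1%:R `^ (- theta^-1) :> R by rewrite powR_gt0.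
have S0 : 0 <= \sum_(i < I0) p i / i.+1%:R `^ (- theta^-1).
  by apply: sumr_ge0 => i _; rewrite divr_ge0 ?(ltW (p_gt0 _)) ?(ltW (pos _)).
exists A; first by rewrite /A ltr_wpDr// mulr_gt0.
move=> i; case: (ltnP i I0) => h.
  rewrite /power_seq -ler_pdivrMr// /A (bigD1 (Ordinal h))//=.
  rewrite addrCA lerDl addr_ge0//; first by rewrite mulr_ge0// ltW.
  by apply: sumr_ge0 => j _; rewrite divr_ge0 ?(ltW (p_gt0 _)) ?(ltW (pos _)).
have e1 : `|eps i| <= 1 by apply: le_trans (HI i h) _; rewrite mul1r powR_N2_le1.
rewrite p_eq /power_seq mulrAC ler_wpM2r ?(ltW (pos i))//.
have := ler_norm (eps i) => e2.
apply: le_trans (_ : c * 2 <= _); first by rewrite ler_pM2l//; lra.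
by rewrite mulrC /A lerDl.
Qed.

Lemma sum_min1_urn_le : exists2 C, 0 < C & forall r K, 0 < r ->
  \sum_(i < K) Num.min 1 (r * p i) <= C * r `^ theta.
Proof.
have [A A0 HA] := urn_le; have [C C0 HC] := sum_min1_le.
exists (C * A `^ theta); first by rewrite mulr_gt0// powR_gt0.
move=> r K r0; rewrite -mulrA -powRM ?(ltW A0) ?(ltW r0)//.
apply: le_trans (HC (A * r) K _); last by rewrite mulr_gt0.
apply: ler_sum => i _; rewrite le_min !ge_min lexx/=; apply/orP; right.
by rewrite [A * r]mulrC power_seq_scale ler_pM2l.
Qed.

(** With x = l p_i, this follows from x exp(-dl x) <= (1 + 1/dl) min(1, x). *)
Lemma sum_expR_urn_le (dl : R) : 0 < dl -> exists2 C, 0 < C & forall l K, 0 < l ->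
  \sum_(i < K) p i * expR (- (dl * (l * p i))) <= C * l `^ (theta - 1).
Proof.
move=> d0; have [C C0 HC] := sum_min1_urn_le.
have d1 : 0 < dl^-1 by rewrite invr_gt0.
exists ((1 + dl^-1) * C); first by rewrite mulr_gt0 ?addr_gt0.
move=> l K l0.
have -> : l `^ (theta - 1) = l^-1 * l `^ theta.
  by rewrite powR_add// powRN powRr1 ?(ltW l0)// mulrC.
apply: le_trans (_ : (1 + dl^-1) * l^-1 * \sum_(i < K) Num.min 1 (l * p i) <= _); last first.
  rewrite -!mulrA ler_pM2l ?addr_gt0// [leRHS]mulrCA ler_pM2l ?invr_gt0//.
  exact: HC.
rewrite mulr_sumr; apply: ler_sum => i _.
rewrite mulrAC ler_pdivlMr// mulrAC.
rewrite [p i * l]mulrC; set x := l * p i.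
have x0 : 0 < x by rewrite mulr_gt0.
have e1 := expR_ge1Dx (dl * x); have e0 := expR_gt0 (- (dl * x)).
have E : expR (- (dl * x)) * expR (dl * x) = 1 by rewrite -expRD addNr expR0.
have dx : 0 < dl * x by rewrite mulr_gt0.
have h : expR (- (dl * x)) * (1 + dl * x) <= 1 by rewrite -[leRHS]E ler_wpM2l ?(ltW e0).
have h1 : expR (- (dl * x)) <= 1 by nra.
have [x1|x1] := leP 1 x; last first.
  by apply: le_trans (_ : x <= _); [rewrite ler_piMr// ltW|rewrite ler_peMl ?(ltW x0)//; lra].
rewrite mulr1; apply: le_trans (_ : dl^-1 <= _); last lra.
rewrite -[dl^-1]mul1r ler_pdivlMr// (_ : _ * dl = expR (- (dl * x)) * (dl * x)); last by ring.
by move: h; rewrite mulrDr mulr1; lra.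
Qed.

(** Beyond [I0], the Lipschitz clause of a profile bounds the change of a term by a multiple of eta
    i^(-1/2) min(1, x_i), which [sum_weighted_min1_le] sums to order eta n^(theta/2). The first [I0]
    urns cost at most 2 M each. The threshold for [K] depends on [n], whence the nested limits. *)
Lemma profile_urn rho G : profile theta rho G -> forall e, 0 < e ->
  \forall n \near \oo, \forall K \near \oo,
    `|\sum_(i < K) rho (n%:R * p i) - G * (c * n%:R) `^ theta| <= e * n%:R `^ (theta / 2).
Proof.
move=> [[M HM] [C [C0 HC]] [E HE]] e e0.
have [D D0 HD] := sum_weighted_min1_le.
pose B := C * D * c `^ (theta / 2) + 1.
have B0 : 0 < B by rewrite ltr_wpDl// mulr_ge0 ?powR_ge0// mulr_ge0 ?(ltW D0).
(* The bound 1/2 keeps the perturbation within the range of the Lipschitz clause; the other one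
   makes the sum at most (e / 2) n^(theta/2). *)
pose eta := Num.min (e / 2 / B) 2^-1.
have eta0 : 0 < eta by rewrite lt_min invr_gt0 ltr0n andbT !divr_gt0.
have [I0 HI] := eps_near eta0.
have M0 : 0 <= M by apply: le_trans (HM 1 ltr01).
have th2 : 0 < theta / 2 by rewrite divr_gt0.
near=> n.
have n0 : 0 < n%:R :> R by rewrite ltr0n; near: n; exists 1%N.
have big : 2 * M * I0%:R + E <= e / 2 * n%:R `^ (theta / 2).
  have : (2 * M * I0%:R + E) / (e / 2) <= n%:R `^ (theta / 2).
    by near: n; exact: near_nat_powR.
  by rewrite ler_pdivrMr ?divr_gt0// [leRHS]mulrC.
have a0 : 0 < c * n%:R by rewrite mulr_gt0.
have {}HE := HE _ a0; near=> K.
have hE : `|\sum_(i < K) rho (power_seq theta (c * n%:R) i) - G * (c * n%:R) `^ theta| <= E.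
  by near: K; exact: HE.
have term i : `|rho (n%:R * p i) - rho (power_seq theta (c * n%:R) i)| <=
  2 * M * (i < I0)%N%:R + C * eta * (i.+1%:R `^ (- 2^-1) * Num.min 1 (power_seq theta (c * n%:R) i)).
  set x := power_seq theta (c * n%:R) i.
  have x0 : 0 < x by exact: power_seq_gt0.
  have y0 : 0 < n%:R * p i by rewrite mulr_gt0.
  have m0 : 0 <= Num.min 1 x by rewrite le_min ler01 ltW.
  case: (ltnP i I0) => h.
    rewrite mulr1; apply: le_trans (_ : 2 * M <= _).
      apply: le_trans (ler_normB _ _) _; have -> : 2 * M = M + M by ring.
      by rewrite lerD ?HM.
    by rewrite lerDl !mulr_ge0 ?(ltW eta0) ?powR_ge0.
  rewrite mulr0 add0r; have he := HI i h.
  have e2 : n%:R * p i - x = x * eps i.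
    by rewrite p_eq mulrA -power_seq_scale [n%:R * c]mulrC -/x; ring.
  have e3 : `|n%:R * p i - x| = x * `|eps i| by rewrite e2 normrM gtr0_norm.
  have hp := powR_N2_le1 i.
  have eh : eta <= 2^-1 by rewrite ge_min lexx orbT.
  apply: le_trans (HC x (n%:R * p i) x0 _) _.
    rewrite e3 ler_pM2l//; apply: le_trans he _.
    apply: le_trans eh; rewrite ler_piMr// ltW//.
  rewrite -[C * eta * _]mulrA ler_wpM2l// mulrA ler_wpM2r//.
  by rewrite e3 mulrAC divff ?gt_eqF// mul1r.
have sumb : `|\sum_(i < K) rho (n%:R * p i) - \sum_(i < K) rho (power_seq theta (c * n%:R) i)| <=
   2 * M * I0%:R + e / 2 * n%:R `^ (theta / 2).
  rewrite -sumrB; apply: le_trans (ler_norm_sum _ _ _) _.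
  apply: (@le_trans _ _ (\sum_(i < K) (2 * M * (i < I0)%N%:R + C * eta * (i.+1%:R `^ (- 2^-1) *
      Num.min 1 (power_seq theta (c * n%:R) i))))); first by apply: ler_sum => i _; exact: term.
  rewrite big_split/= -!mulr_sumr; apply: lerD.
    by rewrite ler_wpM2l ?mulr_ge0// sum_ltn_le.
  apply: le_trans (_ : C * eta * (D * (c * n%:R) `^ (theta / 2)) <= _).
    by rewrite ler_wpM2l ?HD// mulr_ge0// ltW.
  rewrite powRM ?(ltW c_gt0) ?(ltW n0)//.
  rewrite (_ : _ * (D * _) = eta * (C * D * c `^ (theta / 2)) * n%:R `^ (theta / 2)); last by ring.
  rewrite ler_wpM2r ?powR_ge0//.
  apply: le_trans (_ : eta * B <= _).
    by rewrite ler_wpM2l ?(ltW eta0)// lerDl.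
  by rewrite -ler_pdivlMr// ge_min lexx.
move: hE sumb; set S1 := \sum_(i < K) rho _; set S2 := \sum_(i < K) rho _.
set g := G * _; set w := n%:R `^ _ in big *.
rewrite !ler_norml => /andP[? ?] /andP[? ?]; apply/andP; split; lra.
Unshelve. all: by end_near. Qed.

End PowerLawSums.

(** * Means and variances of the three statistics *)

Section Statistics.
Context {R : realType}.
Variable theta : R.
Hypothesis theta01 : 0 < theta < 1.
Implicit Types (x : R) (h : nat -> bool).

Let theta0 : 0 < theta. Proof. by case/andP: theta01. Qed.
Let theta1 : theta < 1. Proof. by case/andP: theta01. Qed.

Definition pois_mean h (rho : R -> R) : Prop := forall x, 0 < x ->
  \sum_(a < M) pois x a * (h a)%:R @[M --> \oo] --> rho x.

Lemma pois_tail1 x : pois_tail 1 x = 1 - expR (- x).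
Proof. by rewrite /pois_tail big_ord_recl big_ord0 addr0 /pois/= expr0 fact0 divr1 mulr1. Qed.

Lemma pois_mean_occupied : pois_mean (fun a => 0 < a)%N (pois_tail 1).
Proof.
move=> x x0; rewrite pois_tail1.
rewrite -(cvg_shiftS (fun M => \sum_(a < M) pois x a * ((0 < a)%N)%:R)).
have -> : (fun M => \sum_(a < M.+1) pois x a * ((0 < a)%N)%:R) =
    (fun M => \sum_(a < M.+1) pois x a - expR (- x)).
  apply/funext => M; rewrite big_ord_recl [X in _ = X - _]big_ord_recl/= mulr0 add0r.
  rewrite /pois/= expr0 fact0 divr1 mulr1 addrAC subrr add0r.
  by apply: eq_bigr => i _; rewrite mulr1.
apply: cvgB; last exact: cvg_cst.
have := @sum_pois_cvg R x; by rewrite -(cvg_shiftS (fun M => \sum_(a < M) pois x a)).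
Qed.

(** The indicator of odd [a] is (1 - (-1)^a) / 2, and the weights with alternating signs are those
    of mean -x times exp(-2 x). *)
Lemma pois_mean_odd : pois_mean odd (fun x => 2^-1 * pois_tail 1 (2 * x)).
Proof.
move=> x x0; rewrite pois_tail1.
have -> : (fun M => \sum_(a < M) pois x a * (odd a)%:R) =
   (fun M => 2^-1 * (\sum_(a < M) pois x a - expR (- (2 * x)) * \sum_(a < M) pois (- x) a)).
  apply/funext => M; rewrite mulr_sumr -sumrB mulr_sumr; apply: eq_bigr => i _.
  have -> : expR (- (2 * x)) * pois (- x) i = (-1) ^+ i * pois x i.
    rewrite /pois [(- x) ^+ i]exprNn opprK !mulrA -expRD (_ : - (2 * x) + x = - x); last by ring.
    by ring.
  rewrite -signr_odd; case: (odd i) => /=; rewrite ?mulr1 ?mulr0 ?expr0 ?expr1; by field.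
apply: cvgMr; apply: cvgB; first exact: sum_pois_cvg.
rewrite -[X in _ --> X]mulr1; apply: cvgMr; exact: sum_pois_cvg.
Qed.

Lemma pois_mean_exact k : pois_mean (fun a => a == k) (fun x => pois x k).
Proof.
move=> x x0; apply: (@cvg_near_cst _ _ _ _ _); near=> M.
have kM : (k < M)%N by near: M; exact: nbhs_infty_gt.
rewrite (bigD1 (Ordinal kM))//= eqxx mulr1 big1 ?addr0// => i ik.
by rewrite (_ : (_ == _) = false) ?mulr0//; apply/negbTE; move: ik; rewrite -val_eqE.
Unshelve. all: by end_near. Qed.

Lemma profile_occupied : profile theta (pois_tail 1) (Gamma (1 - theta)).
Proof. by have := profile_pois_tail theta01 0; rewrite fact0 divr1. Qed.

Lemma profile_odd : profile theta (fun x => 2^-1 * pois_tail 1 (2 * x))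
  (2 `^ (theta - 1) * Gamma (1 - theta)).
Proof.
have := profileZ 2^-1 (profile_dilate (_ : 1 <= 2) profile_occupied).
rewrite mulrA (powR_add theta (-1) (_ : 0 < 2))// powRN powRr1// [_ * 2^-1]mulrC.
by apply; rewrite ler1n.
Qed.

Lemma pois_eq_tails k x : pois x k.+1 = pois_tail k.+1 x - pois_tail k.+2 x.
Proof. by rewrite /pois_tail [\sum_(j < k.+2) _]big_ord_recr/=; ring. Qed.

(** For k > 0 a weight is the difference of two consecutive tails; the functional equation of Gamma
    combines their constants. *)
Lemma profile_exact k : (0 < k)%N ->
  profile theta (pois ^~ k) (theta * (Gamma (k%:R - theta) / k`!%:R)).
Proof.
case: k => // k _; have := profileB (profile_pois_tail theta01 k) (profile_pois_tail theta01 k.+1).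
congr profile; first by apply/funext => x; rewrite pois_eq_tails.
have kt : 0 < k.+1%:R - theta by rewrite subr_gt0 (lt_le_trans theta1)// ler1n.
have -> : k.+2%:R - theta = (k.+1%:R - theta) + 1 by rewrite -(natr1 k.+1); ring.
rewrite GammaS// factS natrM.
have f0 : k`!%:R != 0 :> R by rewrite pnatr_eq0 -lt0n fact_gt0.
have k0 : k.+1%:R != 0 :> R by rewrite pnatr_eq0.
by field; rewrite nat1r k0 f0.
Qed.

(** The variance exp(-x) - exp(-2 x) is the tail at 2 x minus the tail at x. *)
Lemma profile_occupied_var :
  profile theta (fun x => pois_tail 1 x * (1 - pois_tail 1 x)) ((2 `^ theta - 1) * Gamma (1 - theta)).
Proof.
have := profileB (profile_dilate (_ : 1 <= 2) profile_occupied) profile_occupied.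
rewrite ler1n => /(_ isT); rewrite mulrBl mul1r; congr profile.
apply/funext => x; rewrite !pois_tail1 -[2 * x]/((1 + 1) * x) mulrDl mul1r opprD expRD.
by ring.
Qed.

(** The variance of the parity is (1 - exp(-4 x)) / 4, a multiple of the tail at 4 x. *)
Lemma profile_odd_var :
  profile theta (fun x => 2^-1 * pois_tail 1 (2 * x) * (1 - 2^-1 * pois_tail 1 (2 * x)))
  (2 `^ (theta - 1) * (2 `^ (theta - 1) * Gamma (1 - theta))).
Proof.
have := profileZ 4^-1 (profile_dilate (_ : 1 <= 4) profile_occupied).
rewrite ler1n => /(_ isT); congr profile.
  apply/funext => x; rewrite !pois_tail1.
  rewrite (_ : 4 * x = 2 * x + 2 * x); last by ring.
  by rewrite opprD expRD; field.
rewrite (powR_add theta (-1) (_ : 0 < 2))// powRN powRr1//.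
have -> : 4 `^ theta = 2 `^ theta * 2 `^ theta :> R by rewrite -powRM// -natrM.
by field.
Qed.

Definition exact_var k : R :=
  1 - 2 `^ theta * Gamma ((2 * k)%:R - theta) / (2 ^+ (2 * k) * k`!%:R * Gamma (k%:R - theta)).

(** The square of a Poisson weight is a multiple of the weight of order 2 k at mean 2 x. This is the
    origin of Gamma(2 k - theta) and of the powers of 2. *)
Lemma profile_exact_var k : (0 < k)%N ->
  profile theta (fun x => pois x k * (1 - pois x k))
    (exact_var k * (theta * (Gamma (k%:R - theta) / k`!%:R))).
Proof.
move=> k0; have k20 : (0 < 2 * k)%N by rewrite muln_gt0.
have f0 : k`!%:R != 0 :> R by rewrite pnatr_eq0 -lt0n fact_gt0.
have f20 : (2 * k)`!%:R != 0 :> R by rewrite pnatr_eq0 -lt0n fact_gt0.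
have t0 : 2 ^+ (2 * k) != 0 :> R by rewrite expf_neq0.
have g0 : Gamma (k%:R - theta) != 0.
  by rewrite gt_eqF// Gamma_gt0// subr_gt0 (lt_le_trans theta1)// ler1n.
have := profileB (profile_exact k0)
  (profileZ ((2 * k)`!%:R / (2 ^+ (2 * k) * k`!%:R ^+ 2)) (profile_dilate (_ : 1 <= 2) (profile_exact k20))).
rewrite ler1n => /(_ isT); congr profile.
  apply/funext => x; rewrite mulrBr mulr1; congr (_ - _).
  rewrite /pois exprMn (_ : - (2 * x) = - x + - x); last by ring.
  rewrite expRD (_ : x ^+ (2 * k) = x ^+ k * x ^+ k); last by rewrite -exprD addnn mul2n.
  move: (2 ^+ (2 * k)) t0 ((2 * k)`!%:R) f20 (x ^+ k) (k`!%:R) f0 => t t0 f f0 y g g1.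
  by field; rewrite g1 f0 t0.
by rewrite /exact_var; field; rewrite f0 t0 g0 f20.
Qed.

(** The middle one of three consecutive weights is at most the sum of the other two, and the three
    sum to at most 1. *)
Lemma pois_le_half k x : (0 < k)%N -> 0 < x -> pois x k <= 2^-1.
Proof.
case: k => // k _ x0; have := sum_pois_le1 k.+3 (ltW x0).
rewrite !big_ord_recr/=.
have : 0 <= \sum_(i < k) pois x i by apply: sumr_ge0 => i _; rewrite pois_ge0// ltW.
set S := \sum_(i < k) _; have h1 := poisS x k; have h2 := poisS x k.+1.
have q0 := pois_ge0 k (ltW x0); have q1 := pois_ge0 k.+1 (ltW x0); have q2 := pois_ge0 k.+2 (ltW x0).
move: h1 h2 q0 q1 q2; set a := pois x k; set b := pois x k.+1; set c := pois x k.+2.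
have k1 : 1 <= k.+1%:R :> R by rewrite ler1n.
rewrite -[k.+2%:R]natr1; move: k1; set m := k.+1%:R => k1 h1 h2 a0 b0 c0 S0 s1.
(* [a + c >= b], as [m / x + x / (m + 1) >= 1] *)
suff : b <= a + c by lra.
have m0 : 0 < x * (m + 1) by rewrite mulr_gt0//; lra.
rewrite -(ler_pM2r m0); have -> : (a + c) * (x * (m + 1)) = (x * a) * (m + 1) + (c * (m + 1)) * x by ring.
rewrite -h1 h2; have -> : b * m * (m + 1) + x * b * x = b * (m * (m + 1) + x * x) by ring.
rewrite ler_wpM2l//.
have : 0 <= (2 * x - (m + 1)) ^+ 2 by exact: sqr_ge0.
by nra.
Qed.

(** This gives positivity of the limit variance. As the weights are at most 1/2, rho (1 - rho) >=
    rho / 2 pointwise, and [profile_le] carries this over to the constants. *)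
Lemma exact_var_ge k : (0 < k)%N -> 2^-1 <= exact_var k.
Proof.
move=> k0; have G0 : 0 < theta * (Gamma (k%:R - theta) / k`!%:R).
  rewrite mulr_gt0// divr_gt0 ?ltr0n ?fact_gt0//.
  by rewrite Gamma_gt0// subr_gt0 (lt_le_trans theta1)// ler1n.
rewrite -(ler_pM2r G0).
apply: (profile_le theta01 _ (profileZ 2^-1 (profile_exact k0)) (profile_exact_var k0)).
move=> x x0 /=; have := pois_le_half k0 x0; have := pois_ge0 k (ltW x0); nra.
Qed.

End Statistics.

(** * Merging the small urns *)

Section Truncation.
Context {R : realType}.
Variables (theta c : R) (p eps : nat -> R).
Hypothesis theta01 : 0 < theta < 1.
Hypothesis c_gt0 : 0 < c.
Hypothesis p_gt0 : forall i, 0 < p i.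
Hypothesis p_noninc : forall i, p i.+1 <= p i.
Hypothesis p_sum1 : series p @ \oo --> (1 : R).
Hypothesis eps_o : eps =o_\oo (fun i => i.+1%:R `^ (- 2^-1)).
Hypothesis p_eq : forall i, p i = power_seq theta c i * (1 + eps i).

Let theta0 : 0 < theta. Proof. by case/andP: theta01. Qed.
Let theta1 : theta < 1. Proof. by case/andP: theta01. Qed.

(* The urns with index at least [K] are merged into one, which is ignored by
   the statistics. *)
Definition trunc_prob (K : nat) (i : 'I_K.+1) : R :=
  if (i < K)%N then p i else 1 - \sum_(j < K) p j.

Definition trunc_stat (h : nat -> bool) (K : nat) (i : 'I_K.+1) (a : nat) : bool :=
  (i < K)%N && h a.

Lemma sum_p_le1 K : \sum_(j < K) p j <= 1.
Proof.
have nd : nondecreasing_seq (series p).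
  by apply/nondecreasing_seqP => n; rewrite !seriesEnat/= big_nat_recr//= lerDl ltW.
have := nondecreasing_cvgn_le nd (cvgP _ p_sum1) K.
by rewrite (cvg_lim _ p_sum1)// seriesEnat/= big_mkord.
Qed.

Lemma trunc_prob_ge0 K i : 0 <= @trunc_prob K i.
Proof. by rewrite /trunc_prob; case: ifP => _; [exact: ltW|rewrite subr_ge0 sum_p_le1]. Qed.

Lemma sum_trunc_prob K : \sum_i @trunc_prob K i = 1.
Proof.
rewrite big_ord_recr/=.
have -> : @trunc_prob K ord_max = 1 - \sum_(j < K) p j by rewrite /trunc_prob ltnn.
have -> : \sum_(i < K) @trunc_prob K (widen_ord (leqnSn K) i) = \sum_(j < K) p j.
  by apply: eq_bigr => i _; rewrite /trunc_prob/= ltn_ord.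
by rewrite addrC subrK.
Qed.

Lemma sum_trunc K (F : 'I_K.+1 -> R) (G : nat -> R) :
  (forall i : 'I_K.+1, (i < K)%N -> F i = G i) ->
  \sum_(i : 'I_K.+1 | (i < K)%N) F i = \sum_(i < K) G i.
Proof.
move=> FG; rewrite big_mkcond big_ord_recr/= ltnn addr0.
by apply: eq_bigr => i _; rewrite ltn_ord FG//= ltn_ord.
Qed.

(** Uniform in the cutoff [K], which is chosen later as a function of [n]. The right-hand side has
    the shape that [depoissonization] integrates against the Poisson law. *)
Definition small_increments (h : nat -> bool) : Prop := forall e, 0 < e ->
  \forall n \near \oo, forall K l r, (n <= 2 * l)%N ->
    increment (@trunc_prob K) (@trunc_stat h K) l r <=
    e * n%:R `^ (theta / 2) * (1 + r%:R ^+ 2 / n%:R).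

Lemma half_powR (n l : nat) : (0 < n)%N -> (n <= 2 * l)%N ->
  l%:R `^ (theta - 1) <= 2 * n%:R `^ (theta - 1) :> R.
Proof.
move=> n0 nl; have n0' : 0 < n%:R :> R by rewrite ltr0n.
have l0 : 0 < l%:R :> R by rewrite ltr0n; case: l nl n0 => //; rewrite muln0 leqn0 => /eqP->.
have nl' : n%:R <= 2 * l%:R :> R by rewrite -natrM ler_nat.
have -> : theta - 1 = - (1 - theta) by ring.
rewrite !powRN -lef_pV2 ?posrE ?mulr_gt0 ?invr_gt0 ?powR_gt0//.
rewrite invfM !invrK -ler_pdivlMl ?invr_gt0// invrK.
have t1 : 0 <= 1 - theta by rewrite subr_ge0 ltW.
apply: le_trans (_ : (2 * l%:R) `^ (1 - theta) <= _).
  by apply: ge0_ler_powR => //; rewrite nnegrE ?(ltW n0') ?mulr_ge0 ?(ltW l0).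
rewrite powRM ?(ltW l0)// ler_wpM2r ?powR_ge0//.
by rewrite -[leRHS]powRr1// ler_powR ?ler1n// gerBl ltW.
Qed.

(** A ball changes the statistic in mean by O(n^(theta-1)), and r <= sqrt(n) (1 + r^2 / n). The
    product of the two scales is n^(theta/2) n^(-(1-theta)/2). *)
Lemma small_increments_exp (h : nat -> bool) (A : R) : 0 <= A ->
  (forall a, `|(h a.+1)%:R - (h a)%:R| <= A * 2^-1 ^+ a) -> small_increments h.
Proof.
move=> A0 hA e e0.
have h2 : 0 < 2^-1 :> R by rewrite invr_gt0.
have [C C0 HC] := sum_expR_urn_le theta01 p_gt0 c_gt0 eps_o p_eq h2.
have t2 : 0 < (1 - theta) / 2 by rewrite divr_gt0// subr_gt0.
near=> n.
have n0 : (0 < n)%N by near: n; exists 1%N.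
have n0' : 0 < n%:R :> R by rewrite ltr0n.
have big : 2 * A * C / e <= n%:R `^ ((1 - theta) / 2) by near: n; exact: near_nat_powR.
move=> K l r nl.
have l0 : 0 < l%:R :> R by rewrite ltr0n; case: (l) nl n0 => //; rewrite muln0 leqn0 => /eqP->.
(* The merged urn gets the weight 0, since the statistic ignores it. *)
apply: le_trans (increment_exp (c := fun i : 'I_K.+1 => A * (i < K)%N%:R)
  (@trunc_prob_ge0 K) (@sum_trunc_prob K) l r _ _) _.
- by move=> i; rewrite mulr_ge0.
- move=> i a; rewrite /trunc_stat; case: (i < K)%N; rewrite /= ?mulr1 ?hA//.
  by rewrite subrr normr0 mulr0 mul0r.
set S := \sum_i _.
have S_le : S <= A * (C * (2 * n%:R `^ (theta - 1))).
  apply: le_trans (_ : A * (C * l%:R `^ (theta - 1)) <= _); last first.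
    by rewrite !ler_wpM2l ?(ltW C0) ?half_powR.
  apply: le_trans (_ : A * \sum_(i < K) p i * expR (- (2^-1 * (l%:R * p i))) <= _); last first.
    by rewrite ler_wpM2l ?HC.
  rewrite mulr_sumr -(@sum_trunc K (fun i : 'I_K.+1 => A * (p i * expR (- (2^-1 * (l%:R * p i))))) (fun i => A * (p i * expR (- (2^-1 * (l%:R * p i)))))) //.
  rewrite /S [leRHS]big_mkcond; apply: ler_sum => i _; rewrite /trunc_prob; case: ifP => iK.
    rewrite mulr1 ler_wpM2l// ler_wpM2l ?(ltW (p_gt0 _))//.
    have -> : - (2^-1 * (l%:R * p i)) = l%:R * - (p i / 2) by ring.
    rewrite expRM_natl; apply: lerXn2r; rewrite ?nnegrE ?expR_ge0//.
      have := sum_p_le1 i.+1; rewrite big_ord_recr/=.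
      have : 0 <= \sum_(j < i) p j by apply: sumr_ge0 => j _; exact: ltW.
      lra.
    by have := expR_ge1Dx (- (p i / 2)); lra.
  by rewrite mulr0 mul0r.
have r_le : r%:R <= n%:R `^ 2^-1 * (1 + r%:R ^+ 2 / n%:R) :> R.
  rewrite powR12_sqrt ?(ltW n0')//; set s := Num.sqrt _.
  have s0 : 0 < s by rewrite sqrtr_gt0.
  have ss : s * s = n%:R by rewrite -expr2 sqr_sqrtr// ltW.
  rewrite -ss (_ : s * (1 + _) = (s ^+ 2 + r%:R ^+ 2) / s); last by field; rewrite gt_eqF.
  rewrite ler_pdivlMr//; have : 0 <= (r%:R - s) ^+ 2 by exact: sqr_ge0.
  have : 0 <= r%:R * s by rewrite mulr_ge0// ltW.
  nra.
have S0 : 0 <= r%:R ^+ 2 / n%:R :> R by rewrite divr_ge0 ?sqr_ge0.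
apply: le_trans (ler_wpM2l (ler0n _ _) S_le) _.
apply: le_trans (ler_wpM2r _ r_le) _.
  by rewrite !mulr_ge0 ?(ltW C0) ?powR_ge0.
rewrite mulrAC ler_wpM2r ?addr_ge0//.
have -> : n%:R `^ (theta - 1) = n%:R `^ (theta / 2) * n%:R `^ (- 2^-1) * n%:R `^ (- ((1 - theta) / 2)) :> R.
  by rewrite -!powR_add//; congr (_ `^ _); field.
have -> : n%:R `^ (- ((1 - theta) / 2)) = (n%:R `^ ((1 - theta) / 2))^-1 :> R by rewrite powRN.
have q0 : 0 < n%:R `^ ((1 - theta) / 2) :> R by rewrite powR_gt0.
have hh : n%:R `^ 2^-1 * n%:R `^ (- 2^-1) = 1 :> R.
  by rewrite -powR_add// subrr powRr0.
move: big q0 hh; set q := n%:R `^ ((1 - theta) / 2); set a := n%:R `^ 2^-1; set b := n%:R `^ (- 2^-1).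
move=> big q0 hh.
have -> : a * (A * (C * (2 * (n%:R `^ (theta / 2) * b / q)))) = 2 * A * C / q * (a * b) * n%:R `^ (theta / 2) by ring.
rewrite hh mulr1 ler_wpM2r ?powR_ge0// ler_pdivrMr//.
by move: big; rewrite ler_pdivrMr// [leRHS]mulrC.
Unshelve. all: by end_near. Qed.

(** A third urn has positive probability. If two urns received all balls, the product of their signs
    would be deterministic and the decay asked for by [parity_increment] would fail. *)
Lemma p_pair_lt1 : p 0 + p 1 < 1.
Proof.
have := sum_p_le1 3; rewrite !big_ord_recr big_ord0/=; have := p_gt0 2; lra.
Qed.

Lemma p_pair_le i j : i != j -> p i + p j <= p 0 + p 1.
Proof.
have dec : {homo p : m n / (m <= n)%N >-> n <= m}.
  apply: (homo_leq (r := fun x y => y <= x)) => //; first by move=> y x z h1 h2; exact: le_trans h2 h1.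
wlog ij : i j / (i < j)%N => [H ij|_].
  by case: (ltngtP i j) ij => // ij _; [|rewrite addrC]; apply: H; rewrite // ?neq_ltn ij ?orbT.
by apply: lerD; apply: dec => //; apply: leq_ltn_trans ij.
Qed.

(** [parity_increment] is used with [eta] equal to e n^(theta/2). The diagonal part is O(r^theta),
    with r^theta <= n^(theta/2) (1 + r^2 / n). The off-diagonal part is of order r^2 n^(2 theta - 2)
    = (r^2 / n) n^theta n^(theta - 1). Both are small against eta^2 (1 + r^2 / n). *)
Lemma small_increments_odd : small_increments odd.
Proof.
(* This rate serves both signs of 1 - 2 (x + y): the absolute value of a negative one is 1 - 2 (1 -
   (x + y)), and x + y stays away from 1. *)
move=> e e0; pose dl := 2 * (1 - (p 0 + p 1)).
have d0 : 0 < dl by have := p_pair_lt1; rewrite /dl; lra.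
have [C1 C10 HC1] := sum_min1_urn_le theta01 p_gt0 c_gt0 eps_o p_eq.
have [C2 C20 HC2] := sum_expR_urn_le theta01 p_gt0 c_gt0 eps_o p_eq d0.
have t2 : 0 < theta / 2 by rewrite divr_gt0.
have t1 : 0 < 1 - theta by rewrite subr_gt0.
near=> n.
have n0 : (0 < n)%N by near: n; exists 1%N.
have n0' : 0 < n%:R :> R by rewrite ltr0n.
have big1 : 2 * C1 / (e * e) <= n%:R `^ (theta / 2) by near: n; exact: near_nat_powR.
have big2 : 8 * C2 ^+ 2 / (e * e) <= n%:R `^ (1 - theta) by near: n; exact: near_nat_powR.
move=> K l r nl; set w := n%:R `^ (theta / 2); set S := r%:R ^+ 2 / n%:R.
have w0 : 0 < w by rewrite powR_gt0.
have S0 : 0 <= S by rewrite divr_ge0 ?sqr_ge0.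
have ee : 0 < e * e by rewrite mulr_gt0.
have [r0|r0] := posnP r.
  apply: le_trans (increment_le (@trunc_prob_ge0 K) (@sum_trunc_prob K) _ l r) _.
  by rewrite r0 mulr_ge0 ?addr_ge0 ?mulr_ge0 ?(ltW e0) ?(ltW w0).
have l0 : 0 < l%:R :> R by rewrite ltr0n; case: (l) nl n0 => //; rewrite muln0 leqn0 => /eqP->.
have eta0 : 0 < e * w by rewrite mulr_gt0.
apply: le_trans (parity_increment (dl := dl) (@trunc_prob_ge0 K) (@sum_trunc_prob K)
  (b := fun i : 'I_K.+1 => (i < K)%N) l r eta0 _) _.
  move=> i j iK jK ij; rewrite /trunc_prob iK jK.
  have pp := @p_pair_le i j ij; have p1 := p_pair_lt1.
  have pi := p_gt0 i; have pj := p_gt0 j.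
  move: pp pi pj; set x := p i; set y := p j => pp pi pj.
  have [h|h] := leP 0 (1 - 2 * x - 2 * y).
    rewrite ger0_norm//; apply: le_trans (_ : expR (- (2 * (x + y))) <= _).
      by have := expR_ge1Dx (- (2 * (x + y))); lra.
    by rewrite ler_expR lerN2 ler_wpM2r ?addr_ge0 ?ltW//; rewrite /dl; have := p_gt0 0; have := p_gt0 1; lra.
  rewrite ltr0_norm//; apply: le_trans (_ : expR (- (2 * (1 - (x + y)))) <= _).
    by have := expR_ge1Dx (- (2 * (1 - (x + y)))); lra.
  rewrite ler_expR lerN2 /dl; nra.
rewrite (@sum_trunc K _ (fun i => Num.min 1 (r%:R * p i))); last by move=> i iK; rewrite /trunc_prob iK.
rewrite (@sum_trunc K _ (fun i => p i * expR (- (dl * (l%:R * p i))))); last by move=> i iK; rewrite /trunc_prob iK.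
have r0' : 0 < r%:R :> R by rewrite ltr0n.
have := HC1 r%:R K r0'; set X := \sum_(i < K) Num.min _ _ => X_le.
have := HC2 l%:R K l0; set Y := \sum_(i < K) p i * _ => Y_le.
have Y0 : 0 <= Y by apply: sumr_ge0 => i _; rewrite mulr_ge0 ?expR_ge0// ltW.
have rth : r%:R `^ theta <= w * (1 + S).
  have -> : r%:R `^ theta = w * S `^ (theta / 2).
    rewrite /w -powRM ?(ltW n0')// /S mulrCA divff ?gt_eqF// mulr1.
    by rewrite -powR_mulrn ?ler0n// -powRrM; congr (_ `^ _); field.
  rewrite ler_pM2l//; have [S1|S1] := leP S 1.
    apply: le_trans (_ : 1 <= _); last by rewrite lerDl.
    have : S `^ (theta / 2) <= 1 `^ (theta / 2).
      by apply: ge0_ler_powR; rewrite ?nnegrE ?(ltW t2).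
    by rewrite powR1.
  apply: le_trans (_ : S <= _); last by rewrite lerDr.
  by rewrite -[leRHS]powRr1// ler_powR ?(ltW S1)//; lra.
have X_le2 : X <= C1 * (w * (1 + S)) by apply: le_trans X_le _; rewrite ler_pM2l.
pose u := n%:R `^ (theta - 1) : R.
have Y_le2 : Y <= C2 * (2 * u).
  by apply: le_trans Y_le _; rewrite ler_pM2l// half_powR.
have u0 : 0 < u by rewrite powR_gt0.
have u2 : n%:R * (u * u) = w * w * u.
  by rewrite /u /w -[X in X * _]powRr1 ?(ltW n0')// -!powR_add//; congr (_ `^ _); field.
have uV : u = (n%:R `^ (1 - theta))^-1 by rewrite /u -powRN; congr (_ `^ _); ring.
have ub : 8 * C2 ^+ 2 * u <= e * e.
  rewrite uV ler_pdivrMr ?powR_gt0//.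
  by move: big2; rewrite ler_pdivrMr// [leRHS]mulrC.
have wb : 2 * C1 <= e * e * w by move: big1; rewrite ler_pdivrMr// [leRHS]mulrC.
have YY : r%:R ^+ 2 * Y ^+ 2 <= S * (4 * C2 ^+ 2 * u) * (w * w).
  have -> : r%:R ^+ 2 = S * n%:R by rewrite /S divfK// gt_eqF.
  have : Y ^+ 2 <= (C2 * (2 * u)) ^+ 2 by rewrite ler_sqr// nnegrE// mulr_ge0 ?mulr_ge0 ?ltW.
  move=> /(ler_wpM2l (mulr_ge0 S0 (ltW n0'))); move/le_trans; apply.
  have -> : S * n%:R * (C2 * (2 * u)) ^+ 2 = S * (4 * C2 ^+ 2) * (n%:R * (u * u)) by ring.
  by rewrite u2 le_eqVlt; apply/orP; left; apply/eqP; ring.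
have YY2 : r%:R ^+ 2 * Y ^+ 2 <= (1 + S) * (e * e / 2) * (w * w).
  apply: le_trans YY _; rewrite ler_wpM2r ?mulr_ge0 ?(ltW w0)//.
  have c2 : 0 <= C2 ^+ 2 by exact: sqr_ge0.
  apply: ler_pM => //; [|by rewrite lerDr|lra].
  by rewrite mulr_ge0 ?(ltW u0)// mulr_ge0.
have XX : X <= (1 + S) * (e * e / 2) * (w * w).
  apply: le_trans X_le2 _.
  have -> : C1 * (w * (1 + S)) = (1 + S) * w * C1 by ring.
  have -> : (1 + S) * (e * e / 2) * (w * w) = (1 + S) * w * (e * e * w / 2) by ring.
  by rewrite ler_wpM2l ?mulr_ge0 ?addr_ge0 ?(ltW w0)//; lra.
have sum_le : (X + r%:R ^+ 2 * Y ^+ 2) / (e * w) <= e * w * (1 + S).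
  rewrite ler_pdivrMr//.
  have -> : e * w * (1 + S) * (e * w) = (1 + S) * (e * e / 2) * (w * w) + (1 + S) * (e * e / 2) * (w * w) by field.
  exact: lerD.
have : e * w <= e * w * (1 + S) by rewrite ler_peMr ?(ltW eta0)// lerDl.
move: sum_le; set Z := (_ + _) / _; lra.
Unshelve. all: by end_near. Qed.

End Truncation.

Section Diagonal.
Context {R : realType}.

(** [K0 n] is the largest threshold over the accuracies 1 / (j + 1) with j <= n, so that one cutoff
    eventually serves every accuracy. *)
Lemma near_diagonal (Q : R -> nat -> nat -> Prop) :
  (forall e e' n K, e <= e' -> Q e n K -> Q e' n K) ->
  (forall e, 0 < e -> \forall n \near \oo, \forall K \near \oo, Q e n K) ->
  exists K0 : nat -> nat, forall e, 0 < e ->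
    \forall n \near \oo, forall K, (K0 n <= K)%N -> Q e n K.
Proof.
move=> mono near_Q.
(* Where no threshold exists the value is arbitrary; for each fixed [j] this concerns only finitely
   many [n]. *)
have ch nj : exists K0 : nat, (\forall K \near \oo, Q nj.2.+1%:R^-1 nj.1 K) ->
    forall K, (K0 <= K)%N -> Q nj.2.+1%:R^-1 nj.1 K.
  have [[N _ HN]|H] := pselect (\forall K \near \oo, Q nj.2.+1%:R^-1 nj.1 K).
    by exists N => _ K NK; apply: HN.
  by exists 0%N.
have [k Hk] := choice ch.
exists (fun n => \max_(j < n.+1) k (n, j : nat))%N => e e0.
have [j _ /(_ j (leqnn j)) /= je] := @nbhs_infty_ger R e^-1.
have j0 : 0 < j%:R :> R by apply: lt_le_trans je; rewrite invr_gt0.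
have je2 : j.+1%:R^-1 <= e.
  rewrite -[e]invrK lef_pV2 ?posrE ?invr_gt0//; apply: le_trans je _.
  by rewrite ler_nat.
have /near_Q HQ : 0 < j.+1%:R^-1 :> R by rewrite invr_gt0.
near=> n; move=> K nK; apply: mono je2 _.
have jn : (j < n.+1)%N by rewrite ltnS; near: n; exact: nbhs_infty_ge.
apply: (Hk (n, j)) => /=; first by near: n.
apply: leq_trans nK; exact: (leq_bigmax (Ordinal jn)).
Unshelve. all: by end_near. Qed.

End Diagonal.

(** * The central limit theorem for finitely many urns *)

Section TruncatedCLT.
Context {R : realType}.
Variables (theta c : R) (p eps : nat -> R).
Hypothesis theta01 : 0 < theta < 1.
Hypothesis c_gt0 : 0 < c.
Hypothesis p_gt0 : forall i, 0 < p i.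
Hypothesis p_sum1 : series p @ \oo --> (1 : R).
Hypothesis eps_o : eps =o_\oo (fun i => i.+1%:R `^ (- 2^-1)).
Hypothesis p_eq : forall i, p i = power_seq theta c i * (1 + eps i).

Let theta0 : 0 < theta. Proof. by case/andP: theta01. Qed.

Variables (h : nat -> bool) (rho : R -> R) (G v : R).
Hypothesis G_gt0 : 0 < G.
Hypothesis v_gt0 : 0 < v.
Hypothesis h_mean : pois_mean h rho.
Hypothesis rho_profile : profile theta rho G.
Hypothesis var_profile : profile theta (fun x => rho x * (1 - rho x)) (v * G).
Hypothesis h_increments : small_increments theta p h.

Definition centering (n : nat) : R := G * (c * n%:R) `^ theta.

Lemma centering_gt0 n : (0 < n)%N -> 0 < centering n.
Proof. by move=> n0; rewrite mulr_gt0// powR_gt0// mulr_gt0// ltr0n. Qed.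

Let kappa : R := Num.sqrt G * c `^ (theta / 2).

Let kappa_gt0 : 0 < kappa.
Proof. by rewrite mulr_gt0 ?sqrtr_gt0// powR_gt0. Qed.

Lemma sqrt_centering n : Num.sqrt (centering n) = Num.sqrt G * c `^ (theta / 2) * n%:R `^ (theta / 2).
Proof.
rewrite /centering sqrtrM ?(ltW G_gt0)// -mulrA; congr (_ * _).
rewrite -powRM ?(ltW c_gt0)//.
have -> : (c * n%:R) `^ theta = ((c * n%:R) `^ (theta / 2)) ^+ 2.
  by rewrite -powR_mulrn ?powR_ge0// -powRrM divfK.
by rewrite sqrtr_sqr ger0_norm ?powR_ge0.
Qed.

Lemma rho_01 x : 0 < x -> 0 <= rho x <= 1.
Proof.
move=> x0; have x0' := ltW x0; apply/andP; split.
  have c0 : (fun=> 0 : R) @ \oo --> (0 : R) by exact: cvg_cst.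
  apply: (ler_cvg_to c0 (h_mean x0)); near=> M.
  by apply: sumr_ge0 => i _; rewrite mulr_ge0 ?pois_ge0.
have c1 : (fun=> 1 : R) @ \oo --> (1 : R) by exact: cvg_cst.
apply: (ler_cvg_to (h_mean x0) c1); near=> M.
apply: le_trans (sum_pois_le1 M x0'); apply: ler_sum => i _.
by rewrite ler_piMr ?pois_ge0//; case: (h i).
Unshelve. all: by end_near. Qed.

(** One cutoff serves the three purposes listed in [Q]: the mean, the variance and the probability
    of a ball beyond it. The mean must match [centering n] up to o(n^(theta/2)), because
    [centering n] is what the estimating equation contains. *)
Theorem truncated_clt : exists Kn : nat -> nat,
  (n%:R * (1 - \sum_(i < Kn n) p i) @[n --> \oo] --> (0 : R)) /\
  forall f L M, lipschitz_bounded f L M ->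
    Ex (@trunc_prob R p (Kn n)) n (fun s =>
      f (((stat (@trunc_stat h (Kn n)) s)%:R - centering n) / Num.sqrt (centering n)))
    @[n --> \oo] --> \int[normal_prob 0 (Num.sqrt v)]_x f x.
Proof.
pose Q e n K := [/\ `|\sum_(i < K) rho (n%:R * p i) - centering n| <= e * n%:R `^ (theta / 2),
  `|\sum_(i < K) rho (n%:R * p i) * (1 - rho (n%:R * p i)) - v * centering n| <= e * n%:R `^ (theta / 2)
  & n%:R * (1 - \sum_(i < K) p i) <= e].
have [K0 HK0] : exists K0 : nat -> nat, forall e, 0 < e ->
    \forall n \near \oo, forall K, (K0 n <= K)%N -> Q e n K.
  apply: near_diagonal => [e e' n K ee [q1 q2 q3]|e e0].
    split; [| |exact: le_trans q3 ee].
    - by apply: le_trans q1 _; rewrite ler_wpM2r ?powR_ge0.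
    - by apply: le_trans q2 _; rewrite ler_wpM2r ?powR_ge0.
  have H1 := profile_urn theta01 p_gt0 c_gt0 eps_o p_eq rho_profile e0.
  have H2 := profile_urn theta01 p_gt0 c_gt0 eps_o p_eq var_profile e0.
  near=> n.
  have H1n : \forall K \near \oo, `|\sum_(i < K) rho (n%:R * p i) - G * (c * n%:R) `^ theta| <= e * n%:R `^ (theta / 2).
    by near: n.
  have H2n : \forall K \near \oo, `|\sum_(i < K) rho (n%:R * p i) * (1 - rho (n%:R * p i)) - v * G * (c * n%:R) `^ theta| <= e * n%:R `^ (theta / 2).
    by near: n.
  have n0 : 0 < n%:R :> R by rewrite ltr0n; near: n; exists 1%N.
  have en0 : 0 < e / n%:R by rewrite divr_gt0.
  have := p_sum1; move/cvgrPdist_le => /(_ _ en0) H3.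
  near=> K; split.
  - by near: K.
  - by rewrite /centering mulrA; near: K.
  - rewrite mulrC -ler_pdivlMr//; apply: le_trans (ler_norm _) _.
    have -> : \sum_(i < K) p i = series p K by rewrite seriesEnat/= big_mkord.
    by near: K.
pose Kn := K0; exists Kn; pose q n := @trunc_prob R p (Kn n).
have q0 n : forall i, 0 <= q n i by exact: trunc_prob_ge0.
have q1 n : \sum_i q n i = 1 by exact: sum_trunc_prob.
pose ee n (i : 'I_(Kn n).+1) : R := if (i < Kn n)%N then rho (n%:R * p i) else 0.
pose s_ n := map (@ee n) (enum 'I_(Kn n).+1).
have sumE n (g : R -> R) : g 0 = 0 ->
    \sum_(y <- s_ n) g y = \sum_(i < Kn n) g (rho (n%:R * p i)).
  move=> g0; rewrite big_map big_enum/=.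
  rewrite big_ord_recr/= /ee ltnn g0 addr0; apply: eq_bigr => i _.
  by rewrite /= ltn_ord.
have meanE n : bern_mean (s_ n) = \sum_(i < Kn n) rho (n%:R * p i) by exact: (sumE n id).
have varE n : bern_var (s_ n) = \sum_(i < Kn n) rho (n%:R * p i) * (1 - rho (n%:R * p i)).
  by apply: (sumE n (fun y => y * (1 - y))); rewrite mul0r.
have s01 n : (0 < n)%N -> probs (s_ n).
  move=> n0; apply/allP => _ /mapP[i _ ->]; rewrite /ee; case: ifP => _; last by rewrite lexx ler01.
  by apply: rho_01; rewrite mulr_gt0// ltr0n.
have QKn e : 0 < e -> \forall n \near \oo, Q e n (Kn n).
  by move=> e0; apply: filterS (HK0 e e0) => n; apply.
have th2 : 0 < theta / 2 by rewrite divr_gt0.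
pose dl n := (Num.sqrt (centering n))^-1.
have dlE n : dl n = kappa^-1 / n%:R `^ (theta / 2) by rewrite /dl sqrt_centering -/kappa invfM.
have dl0 n : 0 < dl n.+1 by rewrite invr_gt0 sqrtr_gt0 centering_gt0.
have dlcv : dl n @[n --> \oo] --> (0 : R).
  apply/cvgrPdist_le => e e0; near=> n.
  have n0 : 0 < n%:R :> R by rewrite ltr0n; near: n; exists 1%N.
  have w0 : 0 < n%:R `^ (theta / 2) :> R by rewrite powR_gt0.
  have big : kappa^-1 / e <= n%:R `^ (theta / 2) by near: n; exact: near_nat_powR.
  rewrite sub0r normrN dlE ger0_norm ?divr_ge0 ?invr_ge0 ?powR_ge0 ?(ltW kappa_gt0)//.
  rewrite ler_pdivrMr//; move: big; rewrite ler_pdivrMr// => h1.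
  by rewrite mulrC.
split.
  apply/cvgrPdist_le => e e0; near=> n.
  have [_ _ h3] : Q e n (Kn n) by near: n; exact: QKn.
  rewrite sub0r normrN ger0_norm// mulr_ge0// subr_ge0.
  exact: sum_p_le1.
move=> f L M fLM; have [fL fM] := fLM; have [L0 M0] := lipschitz_bounded_ge0 fLM.
pose B n := bern (s_ n) (fun y => f (dl n * (y - bern_mean (s_ n)))) 0.
pose E n := Ex (q n) n (fun s => f (((stat (@trunc_stat h (Kn n)) s)%:R - centering n) / Num.sqrt (centering n))).
have Bcv : B n @[n --> \oo] --> \int[normal_prob 0 (Num.sqrt v)]_x f x.
  (* The index is shifted because [centering 0] is 0, so [dl 0] is not positive. *)
  rewrite -(cvg_shiftS B).
  apply: (@bernoulli_clt R (fun n => s_ n.+1) (fun n => dl n.+1) v v_gt0 (fun n => s01 n.+1 isT) dl0 _ _ f L M fLM).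
    by rewrite (cvg_shiftS dl).
  rewrite (cvg_shiftS (fun n => dl n ^+ 2 * bern_var (s_ n))).
  apply/cvgrPdist_le => e e0.
  have e'0 : 0 < e * kappa ^+ 2 by rewrite mulr_gt0// exprn_gt0.
  near=> n.
  have n0 : (0 < n)%N by near: n; exists 1%N.
  have [_ h2 _] : Q (e * kappa ^+ 2) n (Kn n) by near: n; exact: QKn.
  have w1 : 1 <= n%:R `^ (theta / 2) :> R by near: n; exact: near_nat_powR.
  have c0 := centering_gt0 n0.
  have d2 : dl n ^+ 2 = (centering n)^-1 by rewrite /dl exprVn sqr_sqrtr// ltW.
  rewrite varE d2; set V := \sum_(i < Kn n) _ in h2 *.
  have -> : v - (centering n)^-1 * V = (v * centering n - V) / centering n.
    by field; rewrite gt_eqF.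
  rewrite normrM normrV ?unitfE ?gt_eqF// (gtr0_norm c0) ler_pdivrMr// distrC.
  apply: le_trans h2 _; rewrite -(sqr_sqrtr (ltW c0)) sqrt_centering -/kappa.
  have -> : e * (kappa * n%:R `^ (theta / 2)) ^+ 2 = e * kappa ^+ 2 * (n%:R `^ (theta / 2) * n%:R `^ (theta / 2)) by ring.
  by rewrite ler_wpM2l ?(ltW e'0)// ler_peMl// (le_trans _ w1).
suff EB : (fun n => E n - B n) @ \oo --> (0 : R).
  have FF : Filter (\oo : set_system nat) by exact _.
  have := @cvgD R R nat \oo FF _ _ _ _ EB Bcv; rewrite add0r.
  rewrite (_ : _ + B = E) //.
  by apply/funext => n; exact: subrK.
apply/cvgrPdist_le => e e0.
have L10 : 0 < L + 1 by lra.
(* The errors add up to 5 L e1 / kappa, within the margin 8; the shift by one covers L = 0. *)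
pose e1 : R := e * kappa / (8 * (L + 1)).
have e10 : 0 < e1 by rewrite /e1 divr_gt0//; apply: mulr_gt0.
near=> n.
have n0 : (0 < n)%N by near: n; exists 1%N.
have n0' : 0 < n%:R :> R by rewrite ltr0n.
have w0 : 0 < n%:R `^ (theta / 2) :> R by rewrite powR_gt0.
have [h1 _ _] : Q e1 n (Kn n) by near: n; exact: QKn.
have inc : forall K l r, (n <= 2 * l)%N ->
    increment (@trunc_prob R p K) (@trunc_stat h K) l r <=
    e1 * n%:R `^ (theta / 2) * (1 + r%:R ^+ 2 / n%:R).
  by near: n; exact: h_increments.
have big : e1^-1 <= n%:R `^ (theta / 2) by near: n; exact: near_nat_powR.
have c0 := centering_gt0 n0; have s0 : 0 < dl n by rewrite invr_gt0 sqrtr_gt0.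
pose g y := f ((y - centering n) / Num.sqrt (centering n)).
have gLM : lipschitz_bounded g (L * dl n) M.
  split=> [x y|x]; last exact: fM.
  apply: le_trans (fL _ _) _; rewrite -mulrBl opprB addrA subrK normrM.
  by rewrite -/(dl n) (gtr0_norm s0) [_ * dl n]mulrC mulrA.
have tau0 : 0 <= e1 * n%:R `^ (theta / 2) by rewrite mulr_ge0 ?(ltW e10) ?(ltW w0).
have dp : `|E n - bern (s_ n) g 0| <= L * dl n * (2 * (e1 * n%:R `^ (theta / 2)) + 2).
  apply: (@depoissonization _ _ (q n) (q0 n) (q1 n) (@trunc_stat h (Kn n)) n (@ee n) g (L * dl n) M) => //; last first.
    exact: inc.
  move=> i; rewrite /ee /q /trunc_prob /trunc_stat; case: ifP => iK /=.
    by apply: h_mean; rewrite mulr_gt0.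
  rewrite (_ : (fun _ : nat => _) = fun=> 0); first exact: cvg_cst.
  by apply/funext => m; rewrite big1// => a _; rewrite mulr0.
have bd : `|bern (s_ n) g 0 - B n| <= L * (dl n * (e1 * n%:R `^ (theta / 2))).
  apply: bern_dist; first exact: s01.
  move=> y; apply: le_trans (fL _ _) _; rewrite ler_wpM2l//.
  rewrite -/(dl n) [_ * dl n]mulrC -mulrBr normrM (gtr0_norm s0) ler_pM2l//.
  by rewrite opprB addrC addrA subrK meanE.
have dlw : dl n * n%:R `^ (theta / 2) = kappa^-1 by rewrite dlE divfK ?gt_eqF.
have dl_le : dl n <= kappa^-1 * e1.
  rewrite dlE ler_pM2l ?invr_gt0//.
  by rewrite -[leRHS]invrK lef_pV2 ?posrE ?invr_gt0.
rewrite sub0r normrN; apply: le_trans (_ : `|(E n - bern (s_ n) g 0) + (bern (s_ n) g 0 - B n)| <= _).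
  by rewrite addrA subrK.
apply: le_trans (ler_normD _ _) _; apply: le_trans (lerD dp bd) _.
have -> : L * dl n * (2 * (e1 * n%:R `^ (theta / 2)) + 2) + L * (dl n * (e1 * n%:R `^ (theta / 2))) =
  L * (3 * e1 * (dl n * n%:R `^ (theta / 2)) + 2 * dl n) by ring.
rewrite dlw; apply: le_trans (_ : L * (5 * (kappa^-1 * e1)) <= _).
  by rewrite ler_wpM2l//; lra.
have -> : L * (5 * (kappa^-1 * e1)) = 5 / 8 * (L / (L + 1)) * e.
  by rewrite /e1; field; rewrite (gt_eqF L10) gt_eqF.
have l1 : L / (L + 1) <= 1 by rewrite ler_pdivrMr// mul1r; lra.
have l2 : 0 <= L / (L + 1) by rewrite divr_ge0// ltW.
rewrite -[leRHS]mul1r ler_wpM2r ?(ltW e0)//; lra.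
Unshelve. all: by end_near. Qed.

End TruncatedCLT.

(** * From random variables to allocations *)

Section RintegralSum.
Context {R : realType} d (T : measurableType d) (mu : {measure set T -> \bar R}).

Lemma Rintegral_sum (J : Type) (r : seq J) (f : J -> T -> R) :
  (forall j, mu.-integrable setT (EFin \o f j)) ->
  \int[mu]_w (\sum_(j <- r) f j w) = \sum_(j <- r) \int[mu]_w f j w.
Proof.
move=> fi.
have sumi s : mu.-integrable setT (EFin \o (fun w => \sum_(j <- s) f j w)).
  elim: s => [|j s IH].
    under [X in EFin \o X]eq_fun do rewrite big_nil.
    exact: integrable0.
  under [X in EFin \o X]eq_fun do rewrite big_cons.
  exact: integrable_add.
elim: r => [|j r IH].
  rewrite big_nil; under eq_Rintegral do rewrite big_nil.
  by rewrite /Rintegral integral0.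
rewrite big_cons -IH -RintegralD//.
by under eq_Rintegral do rewrite big_cons.
Qed.

End RintegralSum.

(** * The law of the urns of the first balls *)

Section Sample.
Context {R : realType} d (T : measurableType d) (P : probability T R).
Variables (p : nat -> R) (X : nat -> {RV P >-> nat}).
Hypothesis X_indep : mutually_independent P (fun j => X j : T -> nat).
Hypothesis X_dist : forall j i, P (X j @^-1` [set i]) = (p i)%:E.

Lemma measurable_X j (A : set nat) : measurable (X j @^-1` A).
Proof. exact: measurable_funPTI. Qed.

Lemma prob_lt j K : P (X j @^-1` `I_K) = (\sum_(i < K) p i)%:E.
Proof.
elim: K => [|K IH]; first by rewrite II0 preimage_set0 measure0 big_ord0.
rewrite big_ord_recr/= EFinD -IH -(X_dist j) -measureU; try exact: measurable_X.
  by rewrite -preimage_setU -IIS.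
by rewrite -preimage_setI; apply/seteqP; split=> w //= [+ e]; rewrite e ltnn.
Qed.

Variable K : nat.
Local Notation q := (@trunc_prob R p K).

Lemma prob_ge j : P (~` (X j @^-1` `I_K)) = (1 - \sum_(i < K) p i)%:E.
Proof. by rewrite probability_setC ?prob_lt -?EFinB//; exact: measurable_X. Qed.

Definition merge_urns (m : nat) : 'I_K.+1 := inord (minn m K).

Lemma merge_urnsE m : merge_urns m = minn m K :> nat.
Proof. by rewrite inordK// ltnS geq_minr. Qed.

Lemma prob_merge j i : P (X j @^-1` [set m | merge_urns m = i]) = (q i)%:E.
Proof.
rewrite /trunc_prob; case: ltnP => iK.
  rewrite -(X_dist j i); congr (P (_ @^-1` _)); apply/seteqP; split=> m /=.
    move=> mi; have := merge_urnsE m; rewrite mi /minn; case: ifP => // _ iK'.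
    by move: iK; rewrite iK' ltnn.
  by move=> mi; apply: val_inj; rewrite /= merge_urnsE mi (minn_idPl (ltnW iK)).
have -> : X j @^-1` [set m | merge_urns m = i] = ~` (X j @^-1` `I_K).
  apply/seteqP; split=> w /=.
    move=> mi; have := merge_urnsE (X j w); rewrite mi /minn; case: ifP => // h h'.
    by move: h; rewrite -h' ltnNge iK.
  move/negP; rewrite -leqNgt => h; apply: val_inj; rewrite /= merge_urnsE (minn_idPr h).
  by apply/eqP; rewrite eqn_leq iK -ltnS ltn_ord.
exact: prob_ge.
Qed.

Definition sample (n : nat) (w : T) : seq 'I_K.+1 :=
  [seq merge_urns (X j w) | j <- iota 0 n].

Lemma size_sample n w : size (sample n w) = n.
Proof. by rewrite size_map size_iota. Qed.

Lemma sampleS n w : sample n.+1 w = rcons (sample n w) (merge_urns (X n w)).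
Proof.
have e : iota 0 n.+1 = rcons (iota 0 n) n by rewrite -addn1 iotaD cats1.
by rewrite /sample e map_rcons.
Qed.

Lemma sample_set n u : size u = n -> [set w | sample n w = u] =
  \bigcap_(j in [set` iota 0 n]) (X j @^-1` [set m | merge_urns m = nth ord0 u j]).
Proof.
move=> un; apply/seteqP; split=> w /=.
  move=> su j /=; rewrite mem_iota add0n => /andP[_ jn].
  by rewrite -su (nth_map 0%N) ?size_iota// nth_iota.
move=> H; apply: (@eq_from_nth _ ord0); first by rewrite size_sample un.
move=> j; rewrite size_sample => jn; rewrite (nth_map 0%N) ?size_iota// nth_iota//.
by apply: H => /=; rewrite mem_iota.
Qed.

Lemma measurable_sample_eq n u : measurable [set w | sample n w = u].
Proof.
have [un|un] := eqVneq (size u) n.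
  rewrite sample_set//; apply: fin_bigcap_measurable; first exact: finite_seq.
  by move=> j _; exact: measurable_X.
rewrite (_ : [set _ | _] = set0); first exact: measurable0.
by apply/seteqP; split=> w //= su; move: un; rewrite -su size_sample eqxx.
Qed.

Lemma prob_sample n u : size u = n ->
  P [set w | sample n w = u] = (\prod_(i <- u) q i)%:E.
Proof.
move=> un; rewrite sample_set// (X_indep (A := fun j => [set m | merge_urns m = nth ord0 u j])) ?iota_uniq//.
rewrite (big_nth ord0) un /index_iota subn0 -prodEFin.
by apply: eq_bigr => j _; exact: prob_merge.
Qed.

Lemma measurable_sample n (F : seq 'I_K.+1 -> R) : measurable_fun setT (fun w => F (sample n w)).
Proof.
elim: n F => [|n IH] F.
  by rewrite (_ : (fun w => _) = cst (F [::]))//; exact: measurable_cst.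
rewrite (_ : (fun w => _) = fun w => \sum_i (\1_(X n @^-1` [set m | merge_urns m = i]) w * F (rcons (sample n w) i))).
  apply: measurable_sum => i; apply: measurable_funM; last exact: (IH (fun s => F (rcons s i))).
  by apply: measurable_indic; exact: measurable_X.
apply/funext => w; rewrite sampleS (bigD1 (merge_urns (X n w)))//= big1 ?addr0.
  by rewrite indicE mem_set// mul1r.
by move=> i /negP im; rewrite indicE memNset ?mul0r// => /= h; apply: im; rewrite h.
Qed.

(** Induction on the number [m] of free balls, the first [a] being prescribed: the event is split
    according to the urn of the next ball, which is the recursion of [Ex]. At m = 0 all balls are
    prescribed and independence gives the product. *)
Lemma integral_sample_prefix m a u (F : seq 'I_K.+1 -> R) (M : R) :
  (forall s, `|F s| <= M) -> size u = a ->
  \int[P]_w ((sample a w == u)%:R * F (sample (a + m) w)) =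
  (\prod_(i <- u) q i) * Ex q m (fun s => F (u ++ s)).
Proof.
move=> FM; have M0 : 0 <= M by apply: le_trans (FM [::]).
have ii n b (v : seq 'I_K.+1) : P.-integrable setT
    (EFin \o (fun w => (sample b w == v)%:R * F (sample n w))).
  apply: (@integrable_bounded _ _ _ _ _ M).
    apply: measurable_funM; last exact: measurable_sample.
    exact: (measurable_sample b (fun s => (s == v)%:R)).
  by move=> w; case: (_ == _); rewrite ?mul1r// mul0r normr0.
elim: m a u => [|m IH] a u ua.
  rewrite addn0 /= cats0.
  transitivity (\int[P]_w (F u * \1_[set w | sample a w = u] w)).
    apply: eq_Rintegral => w _; rewrite indicE.
    have [e|ne] := eqVneq (sample a w) u; first by rewrite e mem_set// mul1r mulr1.
    by rewrite mul0r memNset ?mulr0//= => e; rewrite e eqxx in ne.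
  rewrite RintegralZl//; last first.
    apply: (@integrable_bounded _ _ _ _ _ 1).
      by apply: measurable_indic; exact: measurable_sample_eq.
    by move=> w; rewrite indicE; case: (_ \in _); rewrite ?normr1 ?normr0 ?ler01.
  rewrite mulrC; congr (_ * _).
  rewrite /Rintegral integral_indic ?setIT//; last exact: measurable_sample_eq.
  exact: (congr1 fine (prob_sample ua)).
transitivity (\int[P]_w (\sum_i (sample a.+1 w == rcons u i)%:R * F (sample (a.+1 + m) w))).
  apply: eq_Rintegral => w _; rewrite -mulr_suml addSnnS; congr (_ * _).
  rewrite (bigD1 (merge_urns (X a w)))//= big1 ?addr0.
    by rewrite sampleS eqseq_rcons eqxx andbT.
  by move=> i im; rewrite sampleS eqseq_rcons eq_sym [_ == i]eq_sym (negPf im) andbF.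
rewrite Rintegral_sum// mulr_sumr; apply: eq_bigr => i _.
rewrite IH ?size_rcons ?ua// big_rcons/= mulrA; congr (_ * _); last first.
  by apply: eq_Ex => s _; rewrite cat_rcons.
Qed.

Lemma integral_sample n (F : seq 'I_K.+1 -> R) (M : R) :
  (forall s, `|F s| <= M) -> \int[P]_w F (sample n w) = Ex q n F.
Proof.
move=> FM; have := integral_sample_prefix n FM (erefl (size [::])).
rewrite big_nil mul1r add0n => <-.
by apply: eq_Rintegral => w _; rewrite mul1r.
Qed.

Lemma prob_large n : (P (\bigcup_(j in `I_n) (~` (X j @^-1` `I_K))) <=
  (n%:R * (1 - \sum_(i < K) p i))%:E)%E.
Proof.
elim: n => [|n IH]; first by rewrite II0 bigcup_set0 measure0 mul0r.
rewrite IIS bigcup_setU bigcup_set1.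
apply: (le_trans (measureU2 _ _ _)).
- by apply: bigcup_measurable => j _; apply: measurableC; exact: measurable_X.
- by apply: measurableC; exact: measurable_X.
rewrite -natr1 mulrDl mul1r EFinD; apply: leeD; first exact: IH.
by rewrite le_eqVlt; apply/orP; left; apply/eqP; exact: prob_ge.
Qed.

End Sample.

Section UrnStatistic.
Context {R : realType} d (T : measurableType d) (P : probability T R).
Variables (X : nat -> {RV P >-> nat}) (h : nat -> bool).
Hypothesis h0 : h 0 = false.

(** Common form of the three counts; [h0] ensures that only finitely many urns contribute. *)
Definition nb_urns (n : nat) (w : T) : R :=
  \sum_(i \in [set: nat]) ((h (balls X i n w))%:R : R).

Lemma nb_urns_trunc n N w : (forall j, (j < n)%N -> (X j w < N)%N) ->
  nb_urns n w = \sum_(i < N) (h (balls X i n w))%:R.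
Proof.
move=> XN; transitivity (\sum_(i \in `I_N) ((h (balls X i n w))%:R : R)); last by symmetry; exact: fsbig_ord.
symmetry; apply: fsbig_widen => //.
move=> i [_ /= /negP]; rewrite -leqNgt => Ni /=.
rewrite /balls big1 ?h0// => j _.
by have := XN j (ltn_ord j); case: eqP => // ->; rewrite ltnNge Ni.
Qed.

Lemma cnt_sample K n w (i : 'I_K.+1) : (i < K)%N ->
  cnt i (sample X K n w) = balls X i n w.
Proof.
move=> iK; rewrite /cnt /sample count_map /balls -sum1_count.
rewrite big_mkcond -(big_mkord xpredT (fun j => nat_of_bool (X j w == i))) /index_iota subn0.
apply: eq_bigr => j _ /=.
rewrite -val_eqE/= merge_urnsE; case: (ltnP (X j w) K) => h1.
  by case: eqP.
by rewrite !gtn_eqF//; apply: leq_trans h1.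
Qed.

Lemma stat_sample K n w : stat (trunc_stat h (K := K)) (sample X K n w) =
  (\sum_(i < K) h (balls X i n w))%N.
Proof.
rewrite /stat big_ord_recr/= {2}/trunc_stat ltnn addn0; apply: eq_bigr => i _.
by rewrite /trunc_stat/= ltn_ord cnt_sample//= ltn_ord.
Qed.

Lemma nb_urns_stat K n w : (forall j, (j < n)%N -> (X j w < K)%N) ->
  nb_urns n w = (stat (trunc_stat h (K := K)) (sample X K n w))%:R.
Proof. by move=> XK; rewrite stat_sample natr_sum; exact: nb_urns_trunc. Qed.

(** For each outcome the truncated statistics are eventually constant in [K], so the count is a
    pointwise limit of measurable functions. *)
Lemma measurable_nb_urns n : measurable_fun setT (nb_urns n).
Proof.
apply: (measurable_fun_cvg (h := fun K w => (stat (trunc_stat h (K := K)) (sample X K n w))%:R : R)) => //.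
  by move=> K; exact: (@measurable_sample R d T P X K n (fun s => (stat (trunc_stat h (K := K)) s)%:R)).
move=> w _; apply: (@cvg_near_cst _ _ _ _ _); near=> K.
apply/esym; apply: nb_urns_stat => j jn.
apply: (@leq_ltn_trans (\sum_(i < n) X i w)); first by rewrite (bigD1 (Ordinal jn))//= leq_addr.
by near: K; exact: nbhs_infty_gt.
Unshelve. all: by end_near. Qed.

End UrnStatistic.

Section UrnCLT.
Context {R : realType} d (T : measurableType d) (P : probability T R).
Variables (p : nat -> R) (X : nat -> {RV P >-> nat}).
Hypothesis p_gt0 : forall i, 0 < p i.
Hypothesis p_sum1 : series p @ \oo --> (1 : R).
Hypothesis X_indep : mutually_independent P (fun j => X j : T -> nat).
Hypothesis X_dist : forall j i, P (X j @^-1` [set i]) = (p i)%:E.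
Variables (theta c : R) (eps : nat -> R).
Hypothesis theta01 : 0 < theta < 1.
Hypothesis c_gt0 : 0 < c.
Hypothesis eps_o : eps =o_\oo (fun i => i.+1%:R `^ (- 2^-1)).
Hypothesis p_eq : forall i, p i = power_seq theta c i * (1 + eps i).
Variables (h : nat -> bool) (rho : R -> R) (G v : R).
Hypothesis h0 : h 0 = false.
Hypothesis G_gt0 : 0 < G.
Hypothesis v_gt0 : 0 < v.
Hypothesis h_mean : pois_mean h rho.
Hypothesis rho_profile : profile theta rho G.
Hypothesis var_profile : profile theta (fun x => rho x * (1 - rho x)) (v * G).
Hypothesis h_increments : small_increments theta p h.

Local Notation centering := (centering theta c G).

(** Off the event that one of the [n] balls falls beyond the cutoff, the count equals the truncated
    statistic; the union bound makes this event negligible. *)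
Theorem urn_clt :
  lip_cvg P (fun n w => (nb_urns X h n w - centering n) / Num.sqrt (centering n)) v.
Proof.
move=> f L M fLM; have [fL fM] := fLM; have [L0 M0] := lipschitz_bounded_ge0 fLM.
have mf := lipschitz_measurable fLM.
have [Kn [Kn0 KnE]] := truncated_clt theta01 c_gt0 p_gt0 p_sum1 eps_o p_eq
  G_gt0 v_gt0 h_mean rho_profile var_profile h_increments.
have {}KnE := KnE f L M fLM.
pose g n (y : R) := f ((y - centering n) / Num.sqrt (centering n)).
have mg n : measurable_fun setT (g n : measurableTypeR R -> R).
  apply: (measurableT_comp (f := f : measurableTypeR R -> R)); first exact: mf.
  by apply: measurable_funM => //; exact: measurable_funB.
pose s n w : R := (stat (trunc_stat h (K := Kn n)) (sample X (Kn n) n w))%:R.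
have ms n : measurable_fun setT (s n).
  exact: (@measurable_sample R d T P X (Kn n) n (fun s => (stat (trunc_stat h (K := Kn n)) s)%:R)).
have E n : \int[P]_w g n (s n w) = Ex (@trunc_prob R p (Kn n)) n (fun s =>
      f (((stat (trunc_stat h (K := Kn n)) s)%:R - centering n) / Num.sqrt (centering n))).
  exact: (integral_sample X_indep X_dist n (fun s : seq 'I_(Kn n).+1 =>
    fM (((stat (trunc_stat h (K := Kn n)) s)%:R - centering n) / Num.sqrt (centering n)))).
pose A n := \bigcup_(j in `I_n) (~` (X j @^-1` `I_(Kn n))).
have mA n : measurable (A n).
  by apply: bigcup_measurable => j _; apply: measurableC; exact: measurable_X.
have PA n : fine (P (A n)) <= n%:R * (1 - \sum_(i < Kn n) p i).
  rewrite -lee_fin fineK; last by rewrite fin_num_measure.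
  exact: prob_large X_dist _ _.
have dist n : `|\int[P]_w f ((nb_urns X h n w - centering n) / Num.sqrt (centering n)) - \int[P]_w g n (s n w)| <= 2 * M * (n%:R * (1 - \sum_(i < Kn n) p i)).
  apply: (@le_trans _ _ (0 + 2 * M * fine (P (A n)))); last by rewrite add0r ler_wpM2l// mulr_ge0.
  apply: (@Rintegral_dist_le R d T P (fun w => g n (nb_urns X h n w)) (fun w => g n (s n w)) (A n) M 0) => //.
  - by apply: (measurableT_comp (mg n)); exact: measurable_nb_urns.
  - exact: (measurableT_comp (mg n) (ms n)).
  - by move=> w; exact: fM.
  - by move=> w; exact: fM.
  - move=> w Aw; rewrite /s -nb_urns_stat// ?subrr ?normr0//.
    by move=> j jn; apply/negPn/negP => hj; apply: Aw; exists j => //; exact/negP.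
apply/cvgrPdist_le => e e0.
have e20 : 0 < e / 2 by rewrite divr_gt0.
have e30 : 0 < e / 2 / (2 * M + 1) by rewrite divr_gt0// ltr_wpDl// mulr_ge0.
move/cvgrPdist_le: KnE => /(_ _ e20) KnE.
move/cvgrPdist_le: Kn0 => /(_ _ e30) Kn0.
near=> n.
have h1 : `|\int[normal_prob 0 (Num.sqrt v)]_x f x - \int[P]_w g n (s n w)| <= e / 2.
  by rewrite E; near: n.
have h2 : `|0 - n%:R * (1 - \sum_(i < Kn n) p i)| <= e / 2 / (2 * M + 1) by near: n.
apply: le_trans (ler_distD (\int[P]_w g n (s n w)) _ _) _.
rewrite [e in _ <= e]splitr; apply: lerD => //.
rewrite distrC; apply: le_trans (dist n) _.
have M1 : 0 < 2 * M + 1 by rewrite ltr_wpDl// mulr_ge0.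
move: h2; rewrite sub0r normrN ler_pdivlMr// => h2.
have := ler_norm (n%:R * (1 - \sum_(i < Kn n) p i)).
set u := n%:R * _ in h2 *; have : 0 <= `|u| by []; nra.
Unshelve. all: by end_near. Qed.

End UrnCLT.

(** * Inversion of the estimating equations *)

Section LipschitzAt.
Context {R : realType}.
Implicit Types (f g : R -> R) (x t : R).

(** A Lipschitz condition with [x] as one of the two points. It follows from differentiability at
    [x] alone, so no continuity of the derivative of [c] is asked, and it is stable under the
    operations that build [phi]. *)
Definition lip_at f x : Prop := exists L e : R, [/\ 0 <= L, 0 < e &
  forall t, `|t - x| <= e -> `|f t - f x| <= L * `|t - x|].

Lemma lip_at_continuous f x : lip_at f x -> {for x, continuous f}.
Proof.
move=> [L [e [L0 e0 H]]]; apply/cvgrPdist_le => z z0.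
have L10 : 0 < L + 1 by lra.
have m0 : 0 < Num.min e (z / (L + 1)) by rewrite lt_min e0 divr_gt0.
near=> t.
have : `|x - t| <= Num.min e (z / (L + 1)).
  by near: t; have /cvgrPdist_le := @cvg_id _ (nbhs x); apply.
rewrite distrC le_min => /andP[h1 h2]; rewrite distrC.
apply: le_trans (H t h1) _; apply: le_trans (ler_wpM2l L0 h2) _.
by rewrite mulrA ler_pdivrMr// mulrC ler_wpM2l ?(ltW z0)//; lra.
Unshelve. all: by end_near. Qed.

Lemma lip_at_derivable f x : derivable f x 1 -> lip_at f x.
Proof.
move=> /cvg_ex[l /= /cvgrPdist_le /(_ 1 ltr01)].
move=> [e /= e0 H]; exists (`|l| + 1), (e / 2).
split; rewrite ?divr_gt0 ?addr_ge0// => t tx.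
have [->|ne] := eqVneq t x; first by rewrite !subrr normr0 mulr0.
have tx0 : t - x != 0 by rewrite subr_eq0.
have := H (t - x); rewrite /ball_/= sub0r normrN => /(_ _ tx0) h.
have {}h : `|l - (t - x)^-1 *: (f ((t - x) *: 1 + x) - f x)| <= 1.
  by apply: h; apply: le_lt_trans tx _; lra.
move: h; rewrite /GRing.scale/= mulr1 subrK; set u := _^-1 * _ => h.
have -> : f t - f x = u * (t - x) by rewrite /u mulrC mulrA divff// mul1r.
rewrite normrM ler_wpM2r//.
by have := ler_normB l (l - u); rewrite opprB addrC subrK; lra.
Qed.

Lemma lip_atD f g x : lip_at f x -> lip_at g x -> lip_at (fun t => f t + g t) x.
Proof.
move=> [L1 [e1 [L10 e10 H1]]] [L2 [e2 [L20 e20 H2]]].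
exists (L1 + L2), (Num.min e1 e2); split; rewrite ?addr_ge0 ?lt_min ?e10// => t.
rewrite le_min => /andP[h1 h2]; rewrite opprD addrACA mulrDl.
by apply: le_trans (ler_normD _ _) _; rewrite lerD ?H1 ?H2.
Qed.

Lemma lip_atM f g x : lip_at f x -> lip_at g x -> lip_at (fun t => f t * g t) x.
Proof.
move=> [L1 [e1 [L10 e10 H1]]] [L2 [e2 [L20 e20 H2]]].
exists (L1 * (`|g x| + L2 * e2) + `|f x| * L2), (Num.min e1 e2).
split; rewrite ?lt_min ?e10//.
  by rewrite addr_ge0 ?mulr_ge0 ?addr_ge0 ?mulr_ge0 ?(ltW e20).
move=> t; rewrite le_min => /andP[h1 h2].
have -> : f t * g t - f x * g x = (f t - f x) * g t + f x * (g t - g x) by ring.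
apply: le_trans (ler_normD _ _) _; rewrite !normrM mulrDl; apply: lerD; last first.
  by rewrite -mulrA ler_wpM2l ?H2.
rewrite mulrAC; apply: ler_pM; rewrite ?H1//.
have := ler_normD (g t - g x) (g x); rewrite subrK => h3; apply: le_trans h3 _.
rewrite addrC lerD2l; apply: le_trans (H2 t h2) _.
by rewrite ler_wpM2l.
Qed.

Lemma lip_at_comp f g x : lip_at f x -> lip_at g (f x) -> lip_at (g \o f) x.
Proof.
move=> [L1 [e1 [L10 e10 H1]]] [L2 [e2 [L20 e20 H2]]].
have L11 : 0 < L1 + 1 by lra.
exists (L2 * L1), (Num.min e1 (e2 / (L1 + 1))).
split; rewrite ?mulr_ge0 ?lt_min ?e10 ?divr_gt0// => t.
rewrite le_min => /andP[h1 h2] /=; have h3 := H1 t h1.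
have h4 : `|f t - f x| <= e2.
  apply: le_trans h3 _; move: h2; rewrite ler_pdivlMr// => h2.
  by have : 0 <= `|t - x| by []; nra.
by apply: le_trans (H2 _ h4) _; rewrite -mulrA ler_wpM2l.
Qed.

Lemma lip_at_id x : lip_at id x.
Proof. by exists 1, 1; split => // t _; rewrite mul1r. Qed.

Lemma lip_at_cst (a : R) x : lip_at (fun=> a) x.
Proof. by exists 0, 1; split => // t _; rewrite subrr normr0 mul0r. Qed.

Lemma lip_at_ln x : 0 < x -> lip_at (@ln R) x.
Proof. by move=> x0; apply: lip_at_derivable; have d := is_derive1_ln x0. Qed.

Lemma lip_at_Gamma x : 0 < x -> lip_at (@Gamma R) x.
Proof.
move=> x0; have x20 : 0 < x / 2 by rewrite divr_gt0.
have [L L0 H] := Gamma_lipschitz (2 * x) x20.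
exists L, (x / 2); split => //; first exact: ltW.
move=> t; rewrite ler_norml => /andP[h1 h2].
by apply: H; apply/andP; split; lra.
Qed.

End LipschitzAt.

Section Inversion.
Context {R : realType}.
Implicit Types (x s : R).

Lemma ln1D_bound x : `|x| <= 2^-1 -> `|ln (1 + x) - x| <= 2 * x ^+ 2.
Proof.
rewrite ler_norml => /andP[h1 h2].
have x10 : 0 < 1 + x by lra.
have up : ln (1 + x) <= x by apply: le_ln1Dx; lra.
have lo : - ln (1 + x) <= (1 + x)^-1 - 1.
  rewrite -lnV ?posrE//; have := @le_ln1Dx R ((1 + x)^-1 - 1).
  rewrite addrCA subrr addr0; apply.
  have : 0 < (1 + x)^-1 by rewrite invr_gt0.
  by lra.
have : (1 + x)^-1 - 1 <= - x + 2 * x ^+ 2.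
  have -> : (1 + x)^-1 - 1 = - x / (1 + x) by field; rewrite gt_eqF.
  rewrite ler_pdivrMr//; nra.
by move=> h3; rewrite ler_norml; apply/andP; split; have := sqr_ge0 x; lra.
Qed.

Lemma sqrt1D_bound x : `|x| <= 2^-1 -> `|Num.sqrt (1 + x) - 1| <= `|x|.
Proof.
move=> hx; have := hx; rewrite ler_norml => /andP[h1 h2].
have x10 : 0 < 1 + x by lra.
have s0 : 0 < Num.sqrt (1 + x) by rewrite sqrtr_gt0.
have ss : Num.sqrt (1 + x) ^+ 2 = 1 + x by rewrite sqr_sqrtr// ltW.
have e : (Num.sqrt (1 + x) - 1) * (Num.sqrt (1 + x) + 1) = x.
  by move: ss; set q := Num.sqrt _ => ss; rewrite (_ : _ * _ = q ^+ 2 - 1); [rewrite ss; ring|ring].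
rewrite -[X in _ <= `|X|]e normrM [X in _ <= _ * X]ger0_norm; last lra.
by rewrite ler_peMr//; lra.
Qed.

(* [y] is the normalized statistic, [u] the estimation error, [ell] is [ln n]
   and [F * expR (del + u * ell)] is the right-hand side of the estimating
   equation. *)
Lemma inversion_bound (F y u del ell L B : R) : 0 < F -> 0 <= L -> 0 < ell ->
  `|y| <= B -> `|y / Num.sqrt F| <= 2^-1 -> 2 * L <= ell ->
  `|del| <= L * `|u| -> ln (1 + y / Num.sqrt F) = del + u * ell ->
  `|ell * Num.sqrt (F * (1 + y / Num.sqrt F)) * u - y| <=
  5 * B ^+ 2 / Num.sqrt F + 8 * L * B / ell.
Proof.
move=> F0 L0 l0 yB; set r := Num.sqrt F; set x := y / r => x2 Ll du lnE.
have r0 : 0 < r by rewrite sqrtr_gt0.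
have yE : y = r * x by rewrite /x mulrC divfK// gt_eqF.
have lb := ln1D_bound x2; have sb := sqrt1D_bound x2.
have B0 : 0 <= B by apply: le_trans yB.
have xx : `|x| ^+ 2 = x ^+ 2 by rewrite real_normK// num_real.
set s := Num.sqrt (1 + x) in sb.
have s2 : `|s| <= 2.
  have := ler_normD (s - 1) 1; rewrite subrK normr1; lra.
have l2 : `|ln (1 + x)| <= 2 * `|x|.
  have := ler_normD (ln (1 + x) - x) x; rewrite subrK => h.
  by apply: le_trans h _; have : 0 <= `|x| by []; nra.
(* As L <= ell / 2, the term [del] is absorbed by half of u ell. *)
have u2 : `|u| * ell <= 4 * `|x|.
  have : `|u * ell| <= `|ln (1 + x)| + `|del|.
    have -> : u * ell = ln (1 + x) - del by rewrite lnE; ring.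
    exact: ler_normB.
  rewrite normrM (gtr0_norm l0) => h.
  have : L * `|u| <= ell / 2 * `|u| by rewrite ler_wpM2r//; lra.
  lra.
(* Substituting ln(1 + x) - del for ell u leaves terms of second order in [x] and a multiple of
   [del]. *)
have -> : ell * Num.sqrt (F * (1 + x)) * u - y =
    r * (s * (ln (1 + x) - x) + (s - 1) * x - s * del).
  by rewrite sqrtrM ?(ltW F0)// -/r -/s {1}yE lnE; ring.
rewrite normrM (gtr0_norm r0).
have hB : r * `|x| <= B by rewrite -(gtr0_norm r0) -normrM -yE.
have b1 : `|s * (ln (1 + x) - x)| <= 2 * (2 * x ^+ 2) by rewrite normrM ler_pM.
have b2 : `|(s - 1) * x| <= x ^+ 2 by rewrite normrM -xx expr2 ler_wpM2r.
have b3 : `|s * del| <= 2 * (L * (4 * `|x| / ell)).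
  rewrite normrM ler_pM//; apply: le_trans du _; rewrite ler_wpM2l//.
  by rewrite ler_pdivlMr.
have b4 : `|s * (ln (1 + x) - x) + (s - 1) * x - s * del| <=
   5 * x ^+ 2 + 8 * L * `|x| / ell.
  apply: le_trans (ler_normB _ _) _.
  have := ler_normD (s * (ln (1 + x) - x)) ((s - 1) * x).
  have -> : 8 * L * `|x| / ell = 2 * (L * (4 * `|x| / ell)) by ring.
  lra.
apply: le_trans (ler_wpM2l (ltW r0) b4) _.
rewrite -xx; have -> : r * (5 * `|x| ^+ 2 + 8 * L * `|x| / ell) =
    5 * (r * `|x|) ^+ 2 / r + 8 * L * (r * `|x|) / ell.
  by field; rewrite !gt_eqF.
have rx0 : 0 <= r * `|x| by rewrite mulr_ge0// ltW.
apply: lerD; rewrite ler_pM2r ?invr_gt0//.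
  by rewrite ler_pM2l// ler_sqr// nnegrE.
by rewrite ler_wpM2l// mulr_ge0.
Qed.

End Inversion.

(** * Asymptotic normality of a solution *)

Section Estimator.
Context {R : realType} d (T : measurableType d) (P : probability T R).

Lemma near_ln (A : R) : \forall n \near \oo, A <= ln n%:R.
Proof.
near=> n; have n0 : 0 < n%:R :> R by rewrite ltr0n; near: n; exists 1%N.
rewrite -[A]expRK ler_ln ?posrE ?expR_gt0//.
by near: n; exact: nbhs_infty_ger.
Unshelve. all: by end_near. Qed.

Lemma lip_at_bounded (phi : R -> R) (a b : R) : a <= b ->
  (forall t, a <= t <= b -> lip_at phi t) ->
  exists D, forall t, a <= t <= b -> `|phi t| <= D.
Proof.
move=> ab lip.
have c : {within `[a, b], continuous (fun t => `|phi t|)}.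
  apply: continuous_in_subspaceT => t; rewrite inE/= in_itv/= => /lip /lip_at_continuous h.
  by apply: continuous_comp => //; exact: norm_continuous.
have [t _ H] := EVT_max ab c; exists `|phi t| => s sab.
by apply: H; rewrite in_itv.
Qed.

Variables (S : nat -> T -> R) (F : nat -> R -> R) (th : nat -> {RV P >-> R}).
Variables (phi : R -> R) (theta v : R).
Hypothesis mS : forall n, measurable_fun setT (S n).
Hypothesis theta01 : 0 < theta < 1.
Hypothesis F_exp : forall n t, (0 < n)%N -> 0 < t < 1 ->
  F n t = expR (phi t + t * ln n%:R).
Hypothesis phi_lip : forall t, 0 < t < 1 -> lip_at phi t.
Hypothesis th_sol : solution_estimator S F th.
Hypothesis th_in : inside_unit_interval P th.
Hypothesis S_clt : lip_cvg P (fun n w => (S n w - F n theta) / Num.sqrt (F n theta)) v.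

Local Notation Y := (fun n w => (S n w - F n theta) / Num.sqrt (F n theta)).

Let mY n : measurable_fun setT (Y n).
Proof. by apply: measurable_funM => //; exact: measurable_funB. Qed.

(** At both ends of [theta / 2, (theta + 1) / 2] the term t ln n has moved by at least 2 D + 1,
    which outweighs the variation of [phi] and the unit margin for [y]. The intermediate value
    theorem applies. *)
Lemma solution_exists (D : R) n (y : R) : (0 < n)%N ->
  (forall t, theta / 2 <= t <= (theta + 1) / 2 -> `|phi t| <= D) ->
  2 * D + 1 <= theta / 2 * ln n%:R -> 2 * D + 1 <= (1 - theta) / 2 * ln n%:R ->
  `|y - (phi theta + theta * ln n%:R)| <= 1 ->
  exists t, 0 < t < 1 /\ expR y = F n t.
Proof.
have /andP[th0 th1] := theta01; move=> n0 HD l1 l2; rewrite ler_norml => /andP[y1 y2].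
pose psi t := phi t + t * ln n%:R.
have ab : theta / 2 <= (theta + 1) / 2 by lra.
have key (t : R) : theta / 2 <= t <= (theta + 1) / 2 -> {for t, continuous psi}.
  move=> /andP[t1 t2]; apply: cvgD; last by apply: cvgMl; exact: cvg_id.
  by apply: lip_at_continuous; apply: phi_lip; apply/andP; split; lra.
have c : {within `[theta / 2, (theta + 1) / 2], continuous psi}.
  by apply: continuous_in_subspaceT => t; rewrite inE/= in_itv/=; exact: key.
have := HD theta; have := HD (theta / 2); have := HD ((theta + 1) / 2).
rewrite ab !lexx !ler_norml => /(_ isT) /andP[h1 h2] /(_ isT) /andP[h3 h4].
move=> /(_ ltac:(apply/andP; split; lra)) /andP[h5 h6].
have psi_a : psi (theta / 2) <= y by rewrite /psi; lra.
have psi_b : y <= psi ((theta + 1) / 2).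
  by rewrite /psi (_ : (theta + 1) / 2 * _ = theta * ln n%:R + (1 - theta) / 2 * ln n%:R); [lra|field].
have [|t tab tE] := IVT ab c (v := y).
  by rewrite ge_min psi_a le_max psi_b orbT.
move: tab; rewrite in_itv/= => /andP[t1 t2].
have t01 : 0 < t < 1 by apply/andP; split; lra.
by exists t; split=> //; rewrite F_exp// -/(psi t) tE.
Qed.

(** A deterministic statement, for use on the good event. Boundedness of [phi] alone brings [th n w]
    within [dl] of theta; only then does the Lipschitz condition at theta give the sharp
    estimate. *)
Lemma linearization (D L dl e B : R) n w : (0 < n)%N -> 0 < e ->
  (forall t, theta / 2 <= t <= (theta + 1) / 2 -> `|phi t| <= D) ->
  `|phi (th n w)| <= D ->
  (forall t, `|t - theta| <= dl -> `|phi t - phi theta| <= L * `|t - theta|) ->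
  0 <= L -> 0 < dl -> 1 <= ln n%:R :> R -> 2 * L <= ln n%:R -> (2 * D + 1) / dl <= ln n%:R ->
  (2 * D + 1) / (theta / 2) <= ln n%:R -> (2 * D + 1) / ((1 - theta) / 2) <= ln n%:R ->
  (2 * (2 * B + 10 * B ^+ 2 / e) + D) / theta <= ln n%:R -> 16 * L * B / e <= ln n%:R ->
  `|Y n w| <= B ->
  `|ln n%:R * Num.sqrt (S n w) * (th n w - theta) - Y n w| <= e.
Proof.
have /andP[th0 th1] := theta01.
(* [W] collects what is asked of r, the square root of F n theta: r >= 2 B for |y / r| <= 1/2, and r
   >= 10 B^2 / e for the quadratic error. As r is an exponential in ln n, its linear lower bound
   suffices. *)
move=> n0 e0 HD' thD HL L0 dl0 l_1 l_L l_dl l_a l_b; set W := 2 * B + _ => l_W l_e yB.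
have Dth : `|phi theta| <= D by apply: HD'; apply/andP; split; lra.
have D0 : 0 <= D by apply: le_trans Dth.
have B0 : 0 <= B by apply: le_trans yB.
have BB : 0 <= 10 * B ^+ 2 / e by rewrite divr_ge0 ?mulr_ge0 ?sqr_ge0// ltW.
set ell := ln n%:R in l_1 l_L l_dl l_a l_b l_W l_e *.
have ell0 : 0 < ell by lra.
have t20 : 0 < theta / 2 by lra. have t21 : 0 < (1 - theta) / 2 by lra.
rewrite ler_pdivrMr// in l_dl; rewrite ler_pdivrMr// in l_a.
rewrite ler_pdivrMr// in l_b; rewrite ler_pdivrMr// in l_W; rewrite ler_pdivrMr// in l_e.
have Fth : F n theta = expR (phi theta + theta * ell) by rewrite F_exp.
have F0 : 0 < F n theta by rewrite Fth expR_gt0.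
have rE : Num.sqrt (F n theta) = expR ((phi theta + theta * ell) / 2).
  rewrite Fth (_ : expR (phi theta + _) = expR ((phi theta + theta * ell) / 2) ^+ 2).
    by rewrite sqrtr_sqr gtr0_norm// expR_gt0.
  by rewrite expr2 -expRD; congr expR; field.
set r := Num.sqrt (F n theta) in rE yB *.
have r0 : 0 < r by rewrite rE expR_gt0.
have rW : W <= r.
  rewrite rE; have := expR_ge1Dx ((phi theta + theta * ell) / 2).
  by move: Dth; rewrite ler_norml => /andP[? ?]; lra.
set y := (S n w - F n theta) / r in yB *.
have x2 : `|y / r| <= 2^-1.
  rewrite normrM normfV (gtr0_norm r0) ler_pdivrMr//; rewrite /W in rW; lra.
have SE : S n w = F n theta * (1 + y / r).
  rewrite /y -/r; have -> : F n theta = r ^+ 2 by rewrite sqr_sqrtr// ltW.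
  by field; rewrite gt_eqF.
have lb := ln1D_bound x2.
have x10 : 0 < 1 + y / r by move: x2; rewrite ler_norml => /andP[? ?]; lra.
have lnx : `|ln (1 + y / r)| <= 1.
  have := ler_normD (ln (1 + y / r) - y / r) (y / r); rewrite subrK => h1.
  apply: le_trans h1 _; have : `|y / r| ^+ 2 = (y / r) ^+ 2 by rewrite real_normK// num_real.
  move: lb x2; set x := y / r; have : 0 <= `|x| by []; nra.
have S0 : 0 < S n w by rewrite SE mulr_gt0.
have lnS : ln (S n w) = phi theta + theta * ell + ln (1 + y / r).
  by rewrite SE lnM ?posrE// Fth expRK.
(* The estimator is constrained only where a solution exists, so existence comes first. *)
have [] := th_sol (n := n) (w := w).
  have [| | |t [t01 tE]] := @solution_exists D n (ln (S n w)) n0 HD'.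
  - by rewrite [leRHS]mulrC.
  - by rewrite [leRHS]mulrC.
  - by rewrite lnS addrC addKr.
  - by exists t; split=> //; rewrite -tE lnK ?posrE.
move=> th01 thE.
have lnE : ln (1 + y / r) = (phi (th n w) - phi theta) + (th n w - theta) * ell.
  have : ln (S n w) = phi (th n w) + th n w * ell by rewrite thE F_exp// expRK.
  rewrite lnS; lra.
(* Consistency: |th - theta| ln n is at most 1 + 2 D. *)
have udl : `|th n w - theta| <= dl.
  rewrite -(ler_pM2r ell0) -{1}(gtr0_norm ell0) -normrM.
  have -> : (th n w - theta) * ell = ln (1 + y / r) - phi (th n w) + phi theta by rewrite lnE; ring.
  apply: le_trans (ler_normD _ _) _; have := ler_normB (ln (1 + y / r)) (phi (th n w)).
  rewrite [dl * _]mulrC; lra.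
have du := HL _ udl.
have := inversion_bound F0 L0 ell0 yB x2 l_L du lnE; rewrite -/r -SE.
move/le_trans; apply.
have b1' : 5 * B ^+ 2 / r <= e / 2.
  rewrite ler_pdivrMr//; have : 10 * B ^+ 2 / e <= r by rewrite /W in rW; lra.
  by rewrite ler_pdivrMr//; lra.
have b2' : 8 * L * B / ell <= e / 2 by rewrite ler_pdivrMr//; lra.
by rewrite [e]splitr lerD.
Qed.

Theorem estimator_clt :
  weak_cvg_normal P (fun n w => ln n%:R * Num.sqrt (S n w) * (th n w - theta)) v.
Proof.
have /andP[th0 th1] := theta01.
have mZ n : measurable_fun setT (fun w => ln n%:R * Num.sqrt (S n w) * (th n w - theta)).
  apply: measurable_funM; last by apply: measurable_funB => //; exact: measurable_funPT.
  apply: measurable_funM => //; apply: measurableT_comp (mS n).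
  by apply: continuous_measurable_fun; exact: sqrt_continuous.
apply: lip_cvg_weak => //; apply: (lip_cvg_slutsky mY mZ) S_clt => e eta e0 eta0.
have [a [b [a0 b1 inside]]] := th_in.
have eta20 : 0 < eta / 2 by rewrite divr_gt0.
have [B B0 tight] := lip_cvg_tight mY S_clt eta20.
move/fine_cvgP: inside => [_ /cvgrPdist_le /(_ _ eta20) inside].
(* One interval contains both the range [a, b] of the estimator and the bracket of
   [solution_exists]. *)
pose a1 := Num.min a (theta / 2); pose b2 := Num.max b ((theta + 1) / 2).
have a10 : 0 < a1 by rewrite lt_min a0 divr_gt0.
have b21 : b2 < 1 by rewrite gt_max b1/=; lra.
have a1le : a1 <= a /\ a1 <= theta / 2 by rewrite !ge_min !lexx orbT.
have b2ge : b <= b2 /\ (theta + 1) / 2 <= b2 by rewrite !le_max !lexx orbT.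
have ab : a1 <= b2 by case: a1le; case: b2ge; lra.
have [D HD] : exists D, forall t, a1 <= t <= b2 -> `|phi t| <= D.
  apply: lip_at_bounded => // t /andP[t1 t2]; apply: phi_lip; apply/andP; split.
    exact: lt_le_trans t1.
  exact: le_lt_trans t2 _.
have HDab t : a <= t <= b -> `|phi t| <= D.
  by case: a1le b2ge => ? _ [? _] /andP[? ?]; apply: HD; apply/andP; split; lra.
have HD' t : theta / 2 <= t <= (theta + 1) / 2 -> `|phi t| <= D.
  by case: a1le b2ge => _ ? [_ ?] /andP[? ?]; apply: HD; apply/andP; split; lra.
have Dth : `|phi theta| <= D by apply: HD'; apply/andP; split; lra.
have [L [dl [L0 dl0 HL]]] := phi_lip theta01.
have D0 : 0 <= D by apply: le_trans Dth.
near=> n.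
have n0 : (0 < n)%N by near: n; exists 1%N.
have l_1 : 1 <= ln n%:R :> R by near: n; exact: near_ln.
have l_L : 2 * L <= ln n%:R by near: n; exact: near_ln.
have l_dl : (2 * D + 1) / dl <= ln n%:R by near: n; exact: near_ln.
have l_a : (2 * D + 1) / (theta / 2) <= ln n%:R by near: n; exact: near_ln.
have l_b : (2 * D + 1) / ((1 - theta) / 2) <= ln n%:R by near: n; exact: near_ln.
have l_W : (2 * (2 * B + 10 * B ^+ 2 / e) + D) / theta <= ln n%:R by near: n; exact: near_ln.
have l_e : 16 * L * B / e <= ln n%:R by near: n; exact: near_ln.
have Pin : `|1 - fine (P [set w | a <= th n w <= b])| <= eta / 2 by near: n.
have Pt : (P [set w | (B < `|Y n w|)%R] <= (eta / 2)%:E)%E by near: n.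
have mB : measurable [set w | (B < `|Y n w|)%R].
  have := @measurable_fun_ltr _ _ _ _ (cst B) (fun w => `|Y n w|).
  move=> m; rewrite -[X in measurable X]setTI; apply: m => //.
  by apply: measurableT_comp => //.
have mI : measurable [set w | a <= th n w <= b].
  rewrite (_ : [set w | _] = th n @^-1` `[a, b]%classic); first exact: measurable_funPTI.
  by apply/seteqP; split=> w /=; rewrite in_itv.
exists ([set w | (B < `|Y n w|)%R] `|` ~` [set w | a <= th n w <= b]); split.
- by apply: measurableU => //; exact: measurableC.
- apply: le_trans (measureU2 _ _ _) _ => //; first exact: measurableC.
  rewrite [eta]splitr EFinD; apply: leeD; first exact: Pt.
  apply: (@le_trans _ _ (1 - P [set w | (a <= th n w <= b)%R])%E).
    by rewrite le_eqVlt; apply/orP; left; apply/eqP; exact: probability_setC.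
  rewrite -[P _]fineK ?fin_num_measure// -EFinB lee_fin.
  exact: le_trans (ler_norm _) Pin.
- move=> w /not_orP[/negP]; rewrite -leNgt => yB /contrapT /= tab.
  apply: (linearization n0 e0 HD' _ HL L0 dl0 l_1 l_L l_dl l_a l_b l_W l_e yB).
  exact: HDab.
Unshelve. all: by end_near. Qed.

End Estimator.

(** * Application to the three estimators *)

Section UrnEstimators.
Context {R : realType} d (T : measurableType d) (P : probability T R).
Variables (p : nat -> R) (X : nat -> {RV P >-> nat}).
Hypothesis p_gt0 : forall i, 0 < p i.
Hypothesis p_sum1 : series p @ \oo --> (1 : R).
Hypothesis X_indep : mutually_independent P (fun j => X j : T -> nat).
Hypothesis X_dist : forall j i, P (X j @^-1` [set i]) = (p i)%:E.
Variables (theta : R) (c : R -> R) (eps : nat -> R).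
Hypothesis theta01 : 0 < theta < 1.
Hypothesis c_gt0 : forall t, 0 < t < 1 -> 0 < c t.
Hypothesis c_der : forall t, 0 < t < 1 -> derivable c t 1.
Hypothesis eps_o : eps =o_\oo (fun i => i.+1%:R `^ (- 2^-1)).
Hypothesis p_eq : forall i, p i = power_seq theta (c theta) i * (1 + eps i).

Theorem urn_estimator_clt (h : nat -> bool) (rho g : R -> R) (v : R)
    (th : nat -> {RV P >-> R}) :
  h 0 = false -> 0 < v -> pois_mean h rho -> profile theta rho (g theta) ->
  profile theta (fun x => rho x * (1 - rho x)) (v * g theta) ->
  small_increments theta p h ->
  (forall t, 0 < t < 1 -> 0 < g t) -> (forall t, 0 < t < 1 -> lip_at g t) ->
  solution_estimator (nb_urns X h) (fun n t => g t * (c t * n%:R) `^ t) th ->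
  inside_unit_interval P th ->
  weak_cvg_normal P
    (fun n w => ln n%:R * Num.sqrt (nb_urns X h n w) * (th n w - theta)) v.
Proof.
move=> h0 v0 hm hp hv hi g0 gl sol ins.
have cth := c_gt0 theta01; have gth := g0 _ theta01.
have clt := urn_clt p_gt0 p_sum1 X_indep X_dist theta01 cth eps_o p_eq h0
  gth v0 hm hp hv hi.
apply: (estimator_clt (phi := fun t => ln (g t) + t * ln (c t)) _ theta01 _ _ sol ins clt).
- by move=> n; exact: measurable_nb_urns.
- move=> n t n0 t01; have n0' : 0 < n%:R :> R by rewrite ltr0n.
  have ct := c_gt0 t01.
  rewrite -addrA -mulrDr expRD lnK ?posrE ?g0// -lnM ?posrE//.
  by rewrite /powR gt_eqF// mulr_gt0.
- move=> t t01; apply: lip_atD.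
    by apply: (lip_at_comp (f := g) (g := @ln R)); [exact: gl|apply: lip_at_ln; exact: g0].
  apply: lip_atM; first exact: lip_at_id.
  apply: (lip_at_comp (f := c) (g := @ln R)); first by apply: lip_at_derivable; exact: c_der.
  by apply: lip_at_ln; exact: c_gt0.
Qed.

Lemma lip_at_Gamma_sub (a t : R) : 0 < a - t -> lip_at (fun t => Gamma (a - t)) t.
Proof.
move=> at0; apply: (lip_at_comp (g := @Gamma R)); last exact: lip_at_Gamma.
apply: lip_atD; first exact: lip_at_cst.
have -> : (-%R : R -> R) = fun t => (-1) * t by apply/funext => s; rewrite mulN1r.
by apply: lip_atM; [exact: lip_at_cst|exact: lip_at_id].
Qed.

Lemma lip_at_powR2 (t : R) : lip_at (fun t => 2 `^ (t - 1)) t.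
Proof.
rewrite (_ : (fun _ => _) = expR \o (fun t => (t - 1) * ln 2)); last first.
  by apply/funext => s /=; rewrite /powR gt_eqF.
apply: lip_at_comp; last by apply: lip_at_derivable; exact: derivable_expR.
apply: lip_atM; last exact: lip_at_cst.
by apply: lip_atD; [exact: lip_at_id|exact: lip_at_cst].
Qed.

Lemma small_increments_occupied : small_increments theta p (fun a => 0 < a)%N.
Proof.
apply: (small_increments_exp theta01 (c_gt0 theta01) p_gt0 p_sum1 eps_o p_eq (A := 1)) => //.
case=> [|a] /=; first by rewrite subr0 expr0 mulr1 normr1.
by rewrite subrr normr0 mul1r exprn_ge0// invr_ge0.
Qed.

Lemma small_increments_exact k : small_increments theta p (fun a => a == k).
Proof.
(* The indicator changes only at a = k - 1 and a = k, where 2^k 2^(-a) >= 1. *)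
apply: (small_increments_exp theta01 (c_gt0 theta01) p_gt0 p_sum1 eps_o p_eq (A := 2 ^+ k)).
  by rewrite exprn_ge0.
move=> a; have [ak|ka] := leqP a k.
  apply: (@le_trans _ _ 1).
    by case: (a.+1 == k); case: (a == k); rewrite ?subrr ?subr0 ?sub0r ?normrN ?normr1 ?normr0.
  by rewrite exprVn ler_pdivlMr ?exprn_gt0// mul1r ler_eXn2l// ltr1n.
rewrite !gtn_eqF ?(ltnW ka)// ?subrr ?normr0 ?mulr_ge0 ?exprn_ge0 ?invr_ge0//.
by rewrite ltnS ltnW.
Qed.

End UrnEstimators.

Theorem corollary1 (R : realType)
  (* balls and urns *)
  (d : measure_display) (T : measurableType d) (P : probability T R)
  (p : nat -> R)
  (p_gt0 : forall i, 0 < p i)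
  (p_noninc : forall i, p i.+1 <= p i)
  (p_sum1 : series p @ \oo --> (1 : R))
  (X : nat -> {RV P >-> nat})
  (X_indep : mutually_independent P (fun j => X j : T -> nat))
  (X_dist : forall j i, P (X j @^-1` [set i]) = (p i)%:E)
  (* the power law *)
  (theta : R) (theta01 : 0 < theta < 1)
  (c : R -> R)
  (c_gt0 : forall t, 0 < t < 1 -> 0 < c t)
  (c_der : forall t, 0 < t < 1 -> derivable c t 1)
  (eps : nat -> R)
  (eps_o : eps =o_\oo (fun i => i.+1%:R `^ (- 2^-1)))
  (p_eq : forall i, p i = c theta * i.+1%:R `^ (- theta^-1) * (1 + eps i))
  (* the estimators *)
  (k : nat) (k_gt0 : (0 < k)%N)
  (thR thU thk : nat -> {RV P >-> R})
  (thR_sol : solution_estimator (nb_nonempty R X)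
     (fun n t => Gamma (1 - t) * (c t * n%:R) `^ t) thR)
  (thU_sol : solution_estimator (nb_odd R X)
     (fun n t => 2 `^ (t - 1) * Gamma (1 - t) * (c t * n%:R) `^ t) thU)
  (thk_sol : solution_estimator (nb_exact R X k)
     (fun n t => t * (Gamma (k%:R - t) / k`!%:R) * (c t * n%:R) `^ t) thk)
  (thR_in : inside_unit_interval P thR)
  (thU_in : inside_unit_interval P thU)
  (thk_in : inside_unit_interval P thk) :
  [/\ weak_cvg_normal P
        (fun n w => ln n%:R * Num.sqrt (nb_nonempty R X n w)
                    * (thR n w - theta))
        (2 `^ theta - 1),
      weak_cvg_normal P
        (fun n w => ln n%:R * Num.sqrt (nb_odd R X n w)
                    * (thU n w - theta))
        (2 `^ (theta - 1)) &
      weak_cvg_normal P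
        (fun n w => ln n%:R * Num.sqrt (nb_exact R X k n w)
                    * (thk n w - theta))
        (1 - 2 `^ theta * Gamma ((2 * k)%:R - theta)
             / (2 ^+ (2 * k) * k`!%:R * Gamma (k%:R - theta)))].
Proof.
have urn := @urn_estimator_clt R d T P p X p_gt0 p_sum1 X_indep X_dist theta c eps
  theta01 c_gt0 c_der eps_o p_eq.
have /andP[theta0 theta1] := theta01.
split.
- apply: (urn (fun a => 0 < a)%N (pois_tail 1) (fun t => Gamma (1 - t))) => //.
  + rewrite subr_gt0; apply: (@le_lt_trans _ _ (2 `^ 0)); first by rewrite powRr0.
    by rewrite /powR gt_eqF// ltr_expR mul0r mulr_gt0// ln_gt0// ltr1n.
  + exact: pois_mean_occupied.
  + exact: profile_occupied.
  + exact: profile_occupied_var.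
  + exact: (small_increments_occupied p_gt0 p_sum1 theta01 c_gt0 eps_o p_eq).
  + by move=> t /andP[? ?]; rewrite Gamma_gt0// subr_gt0.
  + by move=> t /andP[? ?]; apply: lip_at_Gamma_sub; rewrite subr_gt0.
(* The other two counts are instances of [nb_urns] by conversion; here the congruence modulo 2 has
   to be rewritten as [odd]. *)
- have nb_oddE : nb_odd R X = nb_urns X odd.
    apply/funext => n; apply/funext => w; apply: eq_fsbigr => i _.
    by rewrite !modn2; case: odd.
  rewrite nb_oddE in thU_sol *.
  apply: (urn odd (fun x => 2^-1 * pois_tail 1 (2 * x)) (fun t => 2 `^ (t - 1) * Gamma (1 - t))) => //.
  + exact: pois_mean_odd.
  + exact: profile_odd.
  + exact: profile_odd_var.
  + exact: (small_increments_odd theta01 (c_gt0 _ theta01) p_gt0 p_noninc p_sum1 eps_o p_eq).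
  + by move=> t /andP[? ?]; rewrite mulr_gt0 ?powR_gt0 ?Gamma_gt0 ?subr_gt0.
  + move=> t /andP[? ?]; apply: lip_atM; first exact: lip_at_powR2.
    by apply: lip_at_Gamma_sub; rewrite subr_gt0.
- have kt t : t < 1 -> 0 < k%:R - t by move=> t1; rewrite subr_gt0 (lt_le_trans t1)// ler1n.
  have fk : 0 < k`!%:R :> R by rewrite ltr0n fact_gt0.
  apply: (urn (fun a => a == k) (fun x => pois x k) (fun t => t * (Gamma (k%:R - t) / k`!%:R))) => //.
  + by apply/negbTE; rewrite eq_sym -lt0n.
  + by apply: lt_le_trans (exact_var_ge theta01 k_gt0); rewrite invr_gt0.
  + exact: pois_mean_exact.
  + exact: profile_exact.
  + exact: profile_exact_var.
  + exact: (small_increments_exact p_gt0 p_sum1 theta01 c_gt0 eps_o p_eq).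
  + by move=> t /andP[? ?]; rewrite mulr_gt0// divr_gt0// Gamma_gt0// kt.
  + move=> t /andP[? ?]; apply: lip_atM; first exact: lip_at_id.
    apply: lip_atM; last exact: lip_at_cst.
    by apply: lip_at_Gamma_sub; exact: kt.
Qed.
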